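(* Let $E,E_0,E_1$ be r.i. spaces, $b\in SV(0,1)$, $1<p_0<p_1<\infty$ and $\alpha,\beta<1$, with $(1+u)^{\alpha-1}\in E_0$. Put $$\rho(u)=u^{\frac1{p_0}-\frac1{p_1}}\frac{\|\ell^{\alpha-1}(t)\|_{\widetilde E_0(0,u)}}{\ell^{\beta-1}(u)\,\varphi_{E_1}(\ell(u))},\qquad u\in(0,1).$$ (a) If $0<\theta<1$, then $\big(A_{p_0,\alpha,E_0},B_{p_1,\beta,E_1}\big)_{\theta,b,E}=L_{p,B_\theta,E}$, where $\frac1p=\frac{1-\theta}{p_0}+\frac{\theta}{p_1}$ and $B_\theta(u)=\|\ell^{\alpha-1}(t)\|^{1-\theta}_{\widetilde E_0(0,u)}\big(\ell^{\beta-1}(u)\varphi_{E_1}(\ell(u))\big)^{\theta}\,b(\rho(u))$, $u\in(0,1)$. (b) If $\theta=0$, then $\big(A_{p_0,\alpha,E_0},B_{p_1,\beta,E_1}\big)_{0,b,E}=L^{\mathcal R,\mathcal L}_{p_0,\,b\circ\rho,\,E,\,\ell^{\alpha-1}(u),\,E_0,\,1,\,L_1}$. (c) If $\theta=1$ and $\|b\|_{\widetilde E(0,1)}<\infty$, then $\big(A_{p_0,\alpha,E_0},B_{p_1,\beta,E_1}\big)_{1,b,E}=L^{\mathcal L,\mathcal R}_{p_1,\,b\circ\rho,\,E,\,1,\,E_1,\,\ell^{\beta-1}(u),\,L_\infty}$.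
   Context: Notation. $\ell(t)=1+|\log t|$, $\ell^\sigma(t)=(\ell(t))^\sigma$. An r.i. space $E$ is a rearrangement invariant Banach function space on $(0,\infty)$ with the Fatou property; $\varphi_E(s)=\|\chi_{(0,s)}\|_E$, $s>0$, is its fundamental function; $\widetilde E$ is the corresponding space for the measure $dt/t$, with $\|g\|_{\widetilde E}=\|g^\star\|_E$ ($g^\star$ the non-increasing rearrangement with respect to $dt/t$); for an interval $I$, $\|g\|_{\widetilde E(I)}=\|g\chi_I\|_{\widetilde E}$. A positive finite measurable $b$ on $(0,1)$ is in $SV(0,1)$ if for all $\varepsilon>0$, $t^\varepsilon b(t)$ is equivalent to a non-decreasing function and $t^{-\varepsilon}b(t)$ to a non-increasing one on $(0,1)$. In $b(\rho(u))$, $b$ is understood as extended to $[1,\infty)$ by $b(s)=1$ for $s\ge1$ (the choice of slowly varying extension is immaterial up to equivalence of norms). Interpolation spaces: for (quasi-)Banach spaces with $Y_1\hookrightarrow Y_0$, $(Y_0,Y_1)_{\theta,b,E}$ is the set of $f\in Y_0$ with $\|t^{-\theta}b(t)K(t,f;Y_0,Y_1)\|_{\widetilde E(0,1)}<\infty$, $0\le\theta\le1$, where $K$ is Peetre's $K$-functional. Function spaces: functions are measurable on $(0,1)$ with Lebesgue measure; $f^*$ is the non-increasing rearrangement and $f^{**}(t)=\frac1t\int_0^tf^*(s)\,ds$. Each space is the set of measurable $f$ with finite indicated norm (innermost norm in $s$, next in $t$, outermost in $u$), $1<p<\infty$: - $L_{p,b,E}$: $\|t^{1/p}b(t)f^*(t)\|_{\widetilde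 E(0,1)}$; - $L^{\mathcal R,\mathcal L}_{p,c,E,b,F,a,G}$: $\Big\|c(u)\big\|b(t)\|s^{1/p}a(s)f^*(s)\|_{\widetilde G(t,u)}\big\|_{\widetilde F(0,u)}\Big\|_{\widetilde E(0,1)}$; - $L^{\mathcal L,\mathcal R}_{p,c,E,b,F,a,G}$: $\Big\|c(u)\big\|b(t)\|s^{1/p}a(s)f^*(s)\|_{\widetilde G(u,t)}\big\|_{\widetilde F(u,1)}\Big\|_{\widetilde E(0,1)}$; - $A_{p,\alpha,E}$ ($\alpha<1$, $(1+u)^{\alpha-1}\in E$, i.e. $\|\ell^{\alpha-1}\|_{\widetilde E(0,1)}<\infty$): $\Big\|\ell^{\alpha-1}(t)\int_t^1s^{1/p}f^{**}(s)\,\frac{ds}s\Big\|_{\widetilde E(0,1)}$; - $B_{p,\alpha,E}$ ($\alpha<1$): $\Big\|\sup_{0<s<t}s^{1/p}\ell^{\alpha-1}(s)f^{**}(s)\Big\|_{\widetilde E(0,1)}$. Equality of spaces means equality as sets with equivalent norms. *)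

(* Defs.v *)
From HB Require Import structures.
From mathcomp Require Import all_boot all_order all_algebra.
From mathcomp Require Import all_classical all_reals all_analysis.
From mathcomp Require Import measurable_realfun ess_sup_inf.

Set Implicit Arguments.
Unset Strict Implicit.
Unset Printing Implicit Defensive.

Import Order.TTheory GRing.Theory Num.Theory.
Import numFieldNormedType.Exports.

Local Open Scope classical_set_scope.
Local Open Scope ring_scope.

(* A space is given by its norm, a functional on extended-real functions.
   Only the restriction of the functions to (0, +oo) is relevant. *)
Definition function_norm (R : realType) := (R -> \bar R) -> \bar R.

Definition Mplus (R : realType) (f : R -> \bar R) : Prop :=
  measurable_fun (`]0, +oo[ : set R) f /\ (forall x : R, 0 < x -> (0 <= f x)%E).

(* The axioms (P1)-(P5) of Bennett and Sharpley, which include the Fatou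
   property, together with rearrangement invariance. *)
Record ri_space (R : realType) (E : function_norm R) : Prop := RiSpace {
  ri_ge0 : forall f, Mplus f -> (0 <= E f)%E ;
  ri_eq0 : forall f, Mplus f ->
    (E f = 0%E <-> {ae lebesgue_measure, forall x : R, 0 < x -> f x = 0%E}) ;
  ri_scale : forall (a : R) f, 0 <= a -> Mplus f ->
    E (fun x => (a%:E * f x)%E) = (a%:E * E f)%E ;
  ri_triangle : forall f g, Mplus f -> Mplus g ->
    (E (fun x => (f x + g x)%E) <= E f + E g)%E ;
  ri_mono : forall f g, Mplus f -> Mplus g ->
    {ae lebesgue_measure, forall x : R, 0 < x -> (f x <= g x)%E} ->
    (E f <= E g)%E ;
  ri_fatou : forall (f_ : nat -> R -> \bar R) (f : R -> \bar R),
    (forall n, Mplus (f_ n)) -> Mplus f ->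
    (forall n, {ae lebesgue_measure, forall x : R, 0 < x ->
                  (f_ n x <= f_ n.+1 x)%E}) ->
    {ae lebesgue_measure, forall x : R, 0 < x ->
       f_ ^~ x @ \oo --> f x} ->
    (fun n => E (f_ n)) @ \oo --> E f ;
  ri_indic : forall A : set R, measurable A -> A `<=` `]0, +oo[ ->
    (lebesgue_measure A < +oo)%E ->
    (E (fun x => (\1_A x)%:E) < +oo)%E ;
  ri_int : forall A : set R, measurable A -> A `<=` `]0, +oo[ ->
    (lebesgue_measure A < +oo)%E ->
    exists2 C : R, 0 < C & forall f, Mplus f ->
      (\int[lebesgue_measure]_(x in A) f x <= C%:E * E f)%E ;
  ri_equimeasurable : forall f g, Mplus f -> Mplus g ->
    (forall l : R, 0 <= l ->
       lebesgue_measure [set x : R | 0 < x /\ (l%:E < f x)%E] =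
       lebesgue_measure [set x : R | 0 < x /\ (l%:E < g x)%E]) ->
    E f = E g }.

Definition Lq (R : realType) (q : \bar R) : function_norm R :=
  fun f => Lnorm lebesgue_measure q (f \_ `]0, +oo[).

Definition fundamental (R : realType) (E : function_norm R) (s : R) : \bar R :=
  E (fun x => (\1_`]0, s[ x)%:E).

(* Non-increasing rearrangement of g : D -> \bar R with respect to mu. *)
Definition rearr (R : realType) (mu : set R -> \bar R) (D : set R)
    (g : R -> \bar R) (s : R) : \bar R :=
  ereal_inf [set l%:E | l in [set l : R |
    0 <= l /\ (mu (D `&` [set x | (l%:E < `|g x|)%E]) <= s%:E)%E]].

Definition dtt (R : realType) (A : set R) : \bar R :=
  (\int[lebesgue_measure]_(t in A) (t^-1)%:E)%E.

Definition tnorm (R : realType) (E : function_norm R) (I : set R)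
    (g : R -> \bar R) : \bar R :=
  E (rearr (@dtt R) `]0, +oo[ (g \_ I)).

Definition fstar (R : realType) (f : R -> R) : R -> \bar R :=
  rearr lebesgue_measure `]0, 1[ (EFin \o f).

Definition fstarstar (R : realType) (f : R -> R) (t : R) : \bar R :=
  ((t^-1)%:E * \int[lebesgue_measure]_(s in `]0%R, t[) fstar f s)%E.

Definition ell (R : realType) (t : R) : R := 1 + `|ln t|.

Definition equiv01 (R : realType) (f g : R -> R) : Prop :=
  exists2 C : R, 0 < C &
    forall t, 0 < t < 1 -> C^-1 * g t <= f t /\ f t <= C * g t.

Definition SV (R : realType) (b : R -> R) : Prop :=
  [/\ measurable_fun (`]0, 1[ : set R) b,
      (forall t, 0 < t < 1 -> 0 < b t) &
      forall eps : R, 0 < eps ->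
        (exists2 g : R -> R,
           (forall x y, 0 < x -> x <= y -> y < 1 -> g x <= g y) &
           equiv01 (fun t => t `^ eps * b t) g) /\
        (exists2 h : R -> R,
           (forall x y, 0 < x -> x <= y -> y < 1 -> h y <= h x) &
           equiv01 (fun t => t `^ (- eps) * b t) h)].

(* Slowly varying functions on (0, 1) are extended to [1, +oo) by 1. *)
Definition sv_ext (R : realType) (b : R -> R) (s : R) : R :=
  if s < 1 then b s else 1.

(* A.e. classes on (0, 1) are represented by functions R -> R, whose values
   outside (0, 1) are irrelevant. *)
Record fspace (R : realType) := Fspace {
  carrier : set (R -> R) ;
  fnorm : (R -> R) -> \bar R }.

Definition fspace_of (R : realType) (N : (R -> R) -> \bar R) : fspace R :=
  Fspace [set f | measurable_fun (`]0, 1[ : set R) f /\ (N f < +oo)%E] N.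

Definition same_space (R : realType) (X Y : fspace R) : Prop :=
  carrier X = carrier Y /\
  exists2 C : R, 0 < C & forall f, carrier X f ->
    (fnorm X f <= C%:E * fnorm Y f)%E /\ (fnorm Y f <= C%:E * fnorm X f)%E.

Definition L_space (R : realType) (p : R) (b : R -> R) (E : function_norm R) :
    fspace R :=
  fspace_of (fun f =>
    tnorm E `]0, 1[ (fun t => (t `^ p^-1 * b t)%:E * fstar f t)%E).

Definition LRL_space (R : realType) (p : R) (c : R -> R) (E : function_norm R)
    (b : R -> R) (F : function_norm R) (a : R -> R) (G : function_norm R) :
    fspace R :=
  fspace_of (fun f =>
    tnorm E `]0, 1[ (fun u => (c u)%:E *
      tnorm F `]0%R, u[ (fun t => (b t)%:E *
        tnorm G `]t, u[ (fun s => (s `^ p^-1 * a s)%:E * fstar f s)))%E).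

Definition LLR_space (R : realType) (p : R) (c : R -> R) (E : function_norm R)
    (b : R -> R) (F : function_norm R) (a : R -> R) (G : function_norm R) :
    fspace R :=
  fspace_of (fun f =>
    tnorm E `]0, 1[ (fun u => (c u)%:E *
      tnorm F `]u, 1%R[ (fun t => (b t)%:E *
        tnorm G `]u, t[ (fun s => (s `^ p^-1 * a s)%:E * fstar f s)))%E).

Definition A_space (R : realType) (p alpha : R) (E : function_norm R) :
    fspace R :=
  fspace_of (fun f =>
    tnorm E `]0, 1[ (fun t => (ell t `^ (alpha - 1))%:E *
      \int[lebesgue_measure]_(s in `]t, 1%R[)
        ((s `^ p^-1 / s)%:E * fstarstar f s))%E).

Definition B_space (R : realType) (p alpha : R) (E : function_norm R) :
    fspace R :=
  fspace_of (fun f =>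
    tnorm E `]0, 1[ (fun t =>
      ereal_sup [set ((s `^ p^-1 * ell s `^ (alpha - 1))%:E * fstarstar f s)%E
                | s in `]0, t[])).

Definition K_functional (R : realType) (Y0 Y1 : fspace R) (t : R) (f : R -> R) :
    \bar R :=
  ereal_inf [set r | exists f0 f1 : R -> R,
    [/\ carrier Y0 f0, carrier Y1 f1,
        {ae lebesgue_measure, forall x : R, 0 < x < 1 -> f x = f0 x + f1 x} &
        r = (fnorm Y0 f0 + t%:E * fnorm Y1 f1)%E]].

Definition interp_norm (R : realType) (Y0 Y1 : fspace R) (theta : R)
    (b : R -> R) (E : function_norm R) (f : R -> R) : \bar R :=
  tnorm E `]0, 1[
    (fun t => (t `^ (- theta) * b t)%:E * K_functional Y0 Y1 t f)%E.

Definition interp_space (R : realType) (Y0 Y1 : fspace R) (theta : R)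
    (b : R -> R) (E : function_norm R) : fspace R :=
  Fspace [set f | carrier Y0 f /\ (interp_norm Y0 Y1 theta b E f < +oo)%E]
         (interp_norm Y0 Y1 theta b E).

(* The norms in the weights are finite once (1 + u) ^ (alpha - 1) belongs to
   E0, so that fine loses nothing. *)
Definition ell_norm (R : realType) (alpha : R) (E0 : function_norm R) (u : R) :
    R :=
  fine (tnorm E0 `]0, u[ (fun t => (ell t `^ (alpha - 1))%:E)).

Definition ell_phi (R : realType) (beta : R) (E1 : function_norm R) (u : R) :
    R :=
  ell u `^ (beta - 1) * fine (fundamental E1 (ell u)).

Definition rho (R : realType) (p0 p1 alpha beta : R) (E0 E1 : function_norm R)
    (u : R) : R :=
  u `^ (p0^-1 - p1^-1) * (ell_norm alpha E0 u / ell_phi beta E1 u).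

Definition Btheta (R : realType) (theta p0 p1 alpha beta : R)
    (E0 E1 : function_norm R) (b : R -> R) (u : R) : R :=
  ell_norm alpha E0 u `^ (1 - theta) * ell_phi beta E1 u `^ theta *
  sv_ext b (rho p0 p1 alpha beta E0 E1 u).

(* Main.v *)
(* Cut (0, 1) into the cells e^-(n+1) < t <= e^-n, which have measure 1 for
   dt/t.  Since the rearrangement is monotone for inclusion of level sets, every
   norm over (0, 1) for dt/t is squeezed between norms of step functions on these
   cells, that is, between norms nu(v) of sequences, and the iterated norms need
   no measurability argument.  The sequence norms inherited from an r.i. space
   are invariant under injections of the index set, hence under the shifts that
   turn Hardy type inequalities into convergent geometric series.

   Put F n = f*(e^-n) and S n = sum_j e^-j F (n + j), which is equivalent to
   f**(e^-n).  Let I n and J n be the discrete norms of A and B restricted to the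
   indices beyond and before n, and rho_n the discrete form of rho.  Then
   K(rho_n, f) is equivalent to I n (S) + rho_n J n (S): truncate f at the level
   f*(e^-n) for the upper bound, and use S[f0 + f1] <= e (S[f0] + S[f1]) for the
   lower bound.  As rho_n is regularly varying of positive index 1/p0 - 1/p1,
   the variable t of the interpolation norm can be replaced by rho_n, up to
   a reparametrisation with fibres of bounded diameter.

   It remains to estimate rho_n^-theta b(rho_n) (I n (S) + rho_n J n (S)).  With
   the weight lambda of the Lorentz space in (a), the norm of the first term is
   at most that of lambda S if theta > 0, the second one if theta < 1; conversely
   lambda S is pointwise dominated by the first term.  Finally S can be replaced
   by F, which gives (a), (b) and (c). *)

From HB Require Import structures.
From mathcomp Require Import all_boot all_order all_algebra.
From mathcomp Require Import all_classical all_reals all_analysis.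
From mathcomp Require Import measurable_realfun ess_sup_inf.
From mathcomp Require Import lra ring.
Require Import Defs.

Set Implicit Arguments.
Unset Strict Implicit.
Unset Printing Implicit Defensive.

Import Order.TTheory GRing.Theory Num.Theory.
Import numFieldNormedType.Exports.

Local Open Scope classical_set_scope.
Local Open Scope ring_scope.

(** * Regularly varying sequences and sequence norms *)

(** Everything rests on two point estimates: up to constants, [wA n * w0 n * G n] is bounded by
    [Iop n G] and, for nondecreasing [G], [wP n * w1 n * G n] by [Jop n.+2 G]. [rho] is the quotient
    of the two weights, so each estimate turns the other operator into a sum of values of [wrho] or
    of its inverse: an element of B beyond [n] costs the tail of [wrho], an element of A before [n]
    the partial sum of [1 / wrho]. As p0 < p1, these sums are of the order of their term at [n],
    whatever the r.i. norms are. Likewise 1/p0 < 1 lets f* replace f**. With 0 < theta < 1 both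
    terms collapse to one Lorentz norm; at theta = 0 or 1 the weight of one of them has index 0, the
    geometric gain is lost and the iterated norm has to remain. The price of the cells is a
    bookkeeping of indices: an open interval contains the cells strictly inside but meets those of
    its end points, and f* on a cell is known only between two consecutive values. Upper and lower
    discrete bounds thus differ by one or two shifts, absorbed by the weights and by shift
    invariance. *)

Section regular_variation.
Variable R : realType.
Implicit Types (k a e : R) (w : nat -> R).

(* Regular variation of index [-k] along the powers of [e^-1]. *)
Definition reg k w := (forall n, 0 < w n) /\
  forall e, 0 < e -> exists2 C : R, 0 < C & forall n j,
    w (n + j)%N <= C * expR (- ((k - e) * j%:R)) * w n /\
    w n <= C * expR ((k + e) * j%:R) * w (n + j)%N.

Lemma reg_gt0 k w n : reg k w -> 0 < w n.
Proof. by case. Qed.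

Lemma reg_ge0 k w n : reg k w -> 0 <= w n.
Proof. by move=> /(@reg_gt0 _ _ n)/ltW. Qed.

Lemma reg_expR k : reg k (fun n => expR (- (k * n%:R))).
Proof.
split=> [n|e e0]; first exact: expR_gt0.
exists 1 => // n j; rewrite !mul1r -!expRD !ler_expR natrD.
have : 0 <= e * j%:R by rewrite mulr_ge0 // ltW.
by move=> h; split; nra.
Qed.

Lemma regM k1 k2 w1 w2 : reg k1 w1 -> reg k2 w2 ->
  reg (k1 + k2) (fun n => w1 n * w2 n).
Proof.
move=> [p1 h1] [p2 h2]; split=> [n|e e0]; first exact: mulr_gt0.
have e20 : 0 < e / 2 by rewrite divr_gt0.
have [C1 C10 H1] := h1 _ e20; have [C2 C20 H2] := h2 _ e20.
exists (C1 * C2); first exact: mulr_gt0.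
move=> n j; have [a1 b1] := H1 n j; have [a2 b2] := H2 n j.
split.
- apply: (le_trans (ler_pM (ltW (p1 _)) (ltW (p2 _)) a1 a2)).
  rewrite le_eqVlt; apply/orP; left; apply/eqP.
  have -> : - ((k1 + k2 - e) * j%:R) =
    - ((k1 - e / 2) * j%:R) + - ((k2 - e / 2) * j%:R) by field.
  by rewrite expRD; ring.
- apply: (le_trans (ler_pM (ltW (p1 _)) (ltW (p2 _)) b1 b2)).
  rewrite le_eqVlt; apply/orP; left; apply/eqP.
  have -> : (k1 + k2 + e) * j%:R =
    (k1 + e / 2) * j%:R + (k2 + e / 2) * j%:R by field.
  by rewrite expRD; ring.
Qed.

Lemma regV k w : reg k w -> reg (- k) (fun n => (w n)^-1).
Proof.
move=> [p h]; split=> [n|e e0]; first by rewrite invr_gt0.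
have [C C0 H] := h _ e0; exists C => // n j; have [a b] := H n j.
have -> : - ((- k - e) * j%:R) = (k + e) * j%:R by ring.
have -> : (- k + e) * j%:R = - ((k - e) * j%:R) by ring.
by split; rewrite ler_pdivlMr // mulrC ler_pdivrMr.
Qed.

Lemma reg_powR k w a : 0 <= a -> reg k w -> reg (k * a) (fun n => w n `^ a).
Proof.
(* The case [a = 0] is separate because the loss [e] is passed to [w] as [e / a]. *)
rewrite le_eqVlt => /orP[/eqP<- _|a0 [p h]].
  have := @reg_expR 0; rewrite mulr0; congr (reg _ _); apply/funext => n.
  by rewrite powRr0 mul0r oppr0 expR0.
split=> [n|e e0]; first exact: powR_gt0.
have [C C0 H] := h _ (divr_gt0 e0 a0).
exists (C `^ a); first exact: powR_gt0.
have E t x : 0 < x -> (C * expR t * x) `^ a = C `^ a * expR (t * a) * x `^ a.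
  by move=> x0; rewrite !powRM ?mulr_ge0 ?expR_ge0 ?expRM // ltW.
have L x y : 0 < x -> x <= y -> x `^ a <= y `^ a.
  move=> x0 xy; apply: ge0_ler_powR => //; rewrite ?nnegrE ltW //.
  exact: lt_le_trans xy.
move=> n j; have [/(L _ _ (p _)) u /(L _ _ (p _)) v] := H n j.
move: u v; rewrite !E //.
have -> : - ((k - e / a) * j%:R) * a = - ((k * a - e) * j%:R).
  by field; rewrite gt_eqF.
have -> // : (k + e / a) * j%:R * a = (k * a + e) * j%:R.
by field; rewrite gt_eqF.
Qed.

Lemma eq_reg k k' w w' : k = k' -> w =1 w' -> reg k w -> reg k' w'.
Proof. by move=> -> /funext ->. Qed.

(** The form in which regular variation is used, together with [reg_growth]: [c] is taken strictly
    on one side of the index, and the exponential left over makes a series converge. *)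
Lemma reg_decay k w c : c < k -> reg k w -> exists2 C : R, 0 < C &
  forall n j, w (n + j)%N <= C * expR (- (c * j%:R)) * w n.
Proof.
move=> ck [p h]; have [|C C0 H] := h (k - c); first by rewrite subr_gt0.
exists C => // n j; have [+ _] := H n j.
by have -> : k - (k - c) = c by ring.
Qed.

Lemma reg_growth k w c : k < c -> reg k w -> exists2 C : R, 0 < C &
  forall n j, w n <= C * expR (c * j%:R) * w (n + j)%N.
Proof.
move=> ck [p h]; have [|C C0 H] := h (c - k); first by rewrite subr_gt0.
exists C => // n j; have [_] := H n j.
by have -> : k + (c - k) = c by ring.
Qed.

(** Pays for the shifts by one cell that separate the upper from the lower discrete bounds. *)
Lemma reg_step k w : reg k w -> exists2 C : R, 0 < C &
  forall n, w n <= C * w n.+1 /\ w n.+1 <= C * w n.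
Proof.
move=> [p h]; have [C C0 H] := h _ ltr01.
exists (C * (expR (- ((k - 1))) + expR (k + 1))).
  by rewrite mulr_gt0 // addr_gt0 // expR_gt0.
move=> n; have := H n 1%N; rewrite addn1 !mulr1 => -[a b].
have := expR_ge0 (-(k-1)); have := expR_ge0 (k + 1) => e1 e2.
have := p n; have := p n.+1 => p1 p2.
split.
- by apply: (le_trans b); rewrite ler_pM2r // ler_pM2l // lerDr.
- by apply: (le_trans a); rewrite ler_pM2r // ler_pM2l // lerDl.
Qed.

(** Linear growth is what subadditivity of a norm yields; it is absorbed by 1 + j <= (1 + 1/e) exp(e
    j). *)
Lemma reg0_linear w :
  (forall n, 0 < w n) ->
  (exists2 C : R, 0 < C & forall n j,
    w (n + j)%N <= C * (1 + j%:R) * w n /\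
    w n <= C * (1 + j%:R) * w (n + j)%N) ->
  reg 0 w.
Proof.
move=> p [C C0 H]; split=> // e e0; exists (C * (1 + e^-1)).
  by rewrite mulr_gt0 // addr_gt0 // invr_gt0.
have B j : 1 + j%:R <= (1 + e^-1) * expR (e * j%:R).
  have h : 0 <= 1 + e^-1 by rewrite addr_ge0 // invr_ge0 ltW.
  apply: le_trans (ler_wpM2l h (expR_ge1Dx _)).
  rewrite mulrDl !mul1r mulrDr mulr1 mulrA mulVf ?gt_eqF // mul1r.
  have : 0 <= e^-1 by rewrite invr_ge0 ltW.
  have : 0 <= e * j%:R by rewrite mulr_ge0 // ltW.
  lra.
move=> n j; have [a b] := H n j.
rewrite sub0r mulNr opprK add0r.
have B' : C * (1 + j%:R) <= C * (1 + e^-1) * expR (e * j%:R).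
  by rewrite -mulrA ler_pM2l //; exact: B.
by split; [apply: (le_trans a)|apply: (le_trans b)]; rewrite ler_pM2r.
Qed.

Lemma reg0_succ : reg 0 (fun n => 1 + n%:R).
Proof.
apply: reg0_linear => [n|]; first by rewrite ltr_wpDr.
exists 1 => // n j; rewrite natrD mul1r.
have : (0 : R) <= n%:R * j%:R by rewrite mulr_ge0.
have : (0 : R) <= n%:R by []. have : (0 : R) <= j%:R by [].
by move=> *; split; nra.
Qed.

Lemma reg0_succ_powR a : reg 0 (fun n => (1 + n%:R) `^ a).
Proof.
have [a0|a0] := leP 0 a.
  by apply: eq_reg (reg_powR a0 reg0_succ) => //; rewrite mul0r.
have a1 : 0 <= - a by lra.
apply: eq_reg (regV (reg_powR a1 reg0_succ)) => [|n]; first by rewrite mul0r oppr0.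
by rewrite -powRN opprK.
Qed.

End regular_variation.

(** * Shift invariant norms of sequences *)

Section sequence_norm.
Local Open Scope ereal_scope.
Variable R : realType.
Implicit Types (u v : nat -> \bar R).

Definition nonneg u := forall n, 0 <= u n.

(** Countable subadditivity [sn_sigma] keeps what is needed of the Fatou property. The partial
    injection of [sn_inj], given by [P] and [r], covers at once shifts in both directions,
    restrictions and subsequences. *)
Record seq_norm (nu : (nat -> \bar R) -> \bar R) : Prop := SeqNorm {
  sn_mono : forall u v, nonneg u -> nonneg v -> (forall n, u n <= v n) ->
    nu u <= nu v ;
  sn_scale : forall (c : R) u, (0 <= c)%R -> nonneg u ->
    nu (fun n => c%:E * u n) = c%:E * nu u ;
  sn_ge0 : forall u, nonneg u -> 0 <= nu u ;
  sn_sigma : forall u : nat -> nat -> \bar R, (forall j, nonneg (u j)) ->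
    nu (fun n => \sum_(j <oo) u j n) <= \sum_(j <oo) nu (u j) ;
  sn_inj : forall (P : pred nat) (r : nat -> nat) u, nonneg u ->
    {in P &, injective r} ->
    nu (fun n => if P n then u (r n) else 0) <= nu u ;
  sn_delta_gt0 : 0 < nu (fun n => if n == 0%N then 1 else 0) ;
  sn_delta_lty : nu (fun n => if n == 0%N then 1 else 0) < +oo }.

Variable nu : (nat -> \bar R) -> \bar R.
Hypothesis hnu : seq_norm nu.

Lemma eq_sn u v : u =1 v -> nu u = nu v.
Proof. by move=> /funext ->. Qed.

Lemma sn0 : nu (fun=> 0) = 0.
Proof.
have := sn_scale hnu (lexx 0%R) (u := fun=> 0) (fun=> lexx 0).
by under eq_fun do rewrite mul0e; rewrite mul0e.
Qed.

Lemma sn_le (c : R) u v : (0 <= c)%R -> nonneg u -> nonneg v ->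
  (forall n, u n <= c%:E * v n) -> nu u <= c%:E * nu v.
Proof.
move=> c0 u0 v0 uv; rewrite -(sn_scale hnu) //; apply: (sn_mono hnu) => // n.
by rewrite mule_ge0.
Qed.

Lemma sn_add u v : nonneg u -> nonneg v ->
  nu (fun n => u n + v n) <= nu u + nu v.
Proof.
move=> u0 v0.
(* Countable subadditivity is applied to the family u, v, 0, 0, ... *)
pose w j := if j is 0%N then u else if j is 1%N then v else fun=> 0.
have w0 j : nonneg (w j) by case: j => [|[|j]] n //=.
have E (f : nat -> \bar R) : (forall j, 0 <= f j) -> (forall j, (1 < j)%N -> f j = 0) ->
    \sum_(j <oo) f j = f 0%N + f 1%N.
  move=> f0 fz; rewrite (nneseries_split 0 2) // [X in _ + X]eseries0 ?adde0.
    by rewrite big_nat_recr //= big_nat1.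
  by move=> j + _; exact: fz.
have := sn_sigma hnu w0; rewrite (E (fun j => nu (w j))) => [|j|[|[|j]] //= _]; last 2 first.
- exact: sn_ge0.
- exact: sn0.
congr (_ <= _); apply: eq_sn => n; rewrite (E (fun j => w j n)) // => [j|[|[|j]]//].
exact: w0.
Qed.

Lemma sn_add_le u v w (a b : \bar R) : nonneg u -> nonneg v -> nonneg w ->
  (forall n, u n <= v n + w n) -> nu v <= a -> nu w <= b -> nu u <= a + b.
Proof.
move=> u0 v0 w0 h va wb; apply: (@le_trans _ _ (nu v + nu w)); last exact: leeD.
apply: le_trans (sn_add v0 w0); apply: (sn_mono hnu) => // n.
by rewrite adde_ge0.
Qed.

Lemma sn_shift k u : nonneg u -> nu (fun n => u (n + k)%N) <= nu u.
Proof.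
move=> u0; have := sn_inj hnu (P := xpredT) (r := fun n => (n + k)%N) u0; apply.
by move=> i j _ _; exact: addIn.
Qed.

Lemma sn_unshift k u : nonneg u ->
  nu (fun n => if (k <= n)%N then u (n - k)%N else 0) <= nu u.
Proof.
move=> u0.
have := sn_inj hnu (P := leq k) (r := fun n => (n - k)%N) u0; apply.
move=> i j; rewrite !unfold_in => ki kj h.
by rewrite -(subnK ki) -(subnK kj) h.
Qed.

Lemma sn_single k (x : \bar R) : 0 <= x ->
  nu (fun n => if n == k then x else 0) <=
  nu (fun n => if n == 0%N then x else 0).
Proof.
move=> x0; have h : nonneg (fun n => if n == 0%N then x else 0).
  by move=> n; case: ifP.
apply: le_trans (sn_unshift k h); apply: (sn_mono hnu) => n; rewrite ?lexx.
- by case: ifP.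
- by case: ifP.
by case: eqVneq => [->|_]; [rewrite leqnn subnn eqxx|repeat case: ifP].
Qed.

(* A map with fibres of diameter less than [M] is injective on every residue
   class modulo [M]. *)
Lemma sn_quasi_inj (M : nat) (r : nat -> nat) u : nonneg u ->
  (forall n m, r n = r m -> (n <= m)%N -> (m - n < M)%N) ->
  nu (u \o r) <= M%:R%:E * nu u.
Proof.
move=> u0 hr; have M0 : (0 < M)%N by have := hr 0%N 0%N erefl isT.
pose w j n := if (j < M)%N && (n %% M == j)%N then u (r n) else 0.
have w0 j : nonneg (w j) by move=> n; rewrite /w; case: ifP.
have := sn_sigma hnu w0.
have -> : nu (fun n => \sum_(j <oo) w j n) = nu (u \o r).
  apply: eq_sn => n; rewrite (nneseriesD1 (n := (n %% M)%N)) // => [|j _]; last exact: w0.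
  rewrite {1}/w ltn_pmod // eqxx /= eseries0 ?adde0 // => i _ ne.
  by rewrite /w eq_sym (negbTE ne) andbF.
move=> h; apply: (le_trans h).
rewrite (nneseries_split 0 M) => [|j _]; last exact: sn_ge0.
rewrite [X in _ + X]eseries0 ?adde0 => [|j + _]; last first.
  rewrite add0n => Mj; rewrite -[RHS]sn0; apply: eq_sn => n.
  by rewrite /w ltnNge Mj.
have B j : nu (w j) <= nu u.
  have := sn_inj hnu (P := fun n => (j < M)%N && (n %% M == j)%N) (r := r) u0.
  apply => n m; rewrite !unfold_in => /andP[jM /eqP nj] /andP[_ /eqP mj] rnm.
  wlog nm : n m nj mj rnm / (n <= m)%N.
    move=> H; case/orP: (leq_total n m) => nm; first exact: H.
    by apply/esym/H.
  have := hr _ _ rnm nm; have : ((m - n) %% M)%N = 0%N.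
    by apply/eqP; rewrite -[_ == _]/(M %| m - n)%N -eqn_mod_dvd // nj mj.
  by move=> + lt; rewrite modn_small // => /eqP; rewrite subn_eq0 => mn; apply/eqP; rewrite eqn_leq nm.
apply: (le_trans (lee_sum _ (fun j _ => B j))).
by rewrite add0n big_mkord sumr_const card_ord mule_natl.
Qed.

(** The new case is x = +oo. One inequality is countable subadditivity for infinitely many copies of
    [u], the other is scaling by arbitrarily large reals. It serves for values of f** that may be
    infinite. *)
Lemma sn_scalee (x : \bar R) u : 0 <= x -> nonneg u ->
  nu (fun n => x * u n) = x * nu u.
Proof.
case: x => [c||] c0 u0; [by rewrite (sn_scale hnu)| |by []].
have w0 : nonneg (fun n => +oo * u n) by move=> n; rewrite mule_ge0.
apply/eqP; rewrite eq_le; apply/andP; split.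
  have := sn_sigma hnu (u := fun _ => u) (fun _ => u0).
  have E (y : \bar R) : 0 <= y -> \sum_(j <oo) y = +oo * y.
    rewrite le_eqVlt => /orP[/eqP <-|y0]; first by rewrite eseries0 // mule0.
    rewrite gt0_mulye //; case: y y0 => [r||] r0; [|by rewrite (nneseries_pinfty (k := 0%N))|by []].
    apply/cvg_lim => //; apply/cvgeyPge => B; near=> n.
    rewrite big_mkord sumEFin sumr_const card_ord lee_fin -mulr_natl.
    rewrite -ler_pdivrMr //; near: n; exact: nbhs_infty_ger.
  by rewrite E ?(sn_ge0 hnu) //; under eq_fun do rewrite E //.
have [->|n0] := eqVneq (nu u) 0; first by rewrite mule0 (sn_ge0 hnu).
rewrite gt0_mulye ?lt0e ?n0 ?(sn_ge0 hnu) //.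
have np : 0 < nu u by rewrite lt0e n0 (sn_ge0 hnu).
have H (c : R) : (0 <= c)%R -> c%:E * nu u <= nu (fun n => +oo * u n).
  move=> c0'; rewrite -(sn_scale hnu) //; apply: (sn_mono hnu) => // n.
    by rewrite mule_ge0.
  by rewrite lee_wpmul2r // leey.
case: (nu u) np H n0 => [r||] r0 H n0; [|by have := H 1%R ler01; rewrite mul1e|by []].
case E : (nu _) => [s||]; [|by []|by have := H 0%R (lexx _); rewrite E mul0e].
have r1 : (0 < r)%R by [].
have := H ((`|s| + 1) / r)%R; rewrite E -EFinM divfK ?gt_eqF // lee_fin.
have d0 : (0 <= (`|s| + 1) / r)%R by rewrite divr_ge0 ?addr_ge0 // ltW.
by move=> /(_ d0) h; exfalso; move: h; have := ler_norm s; lra.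
Unshelve. all: by end_near. Qed.

(** The sum of exp(- c j) over j, the constant of every convolution estimate below. *)
Definition geo (c : R) : R := ((1 - expR (- c))^-1)%R.

Lemma geo_gt0 c : (0 < c)%R -> (0 < geo c)%R.
Proof. by move=> c0; rewrite invr_gt0 subr_gt0 expR_lt1 oppr_lt0. Qed.

Lemma geo_partial c n : (0 < c)%R ->
  (\sum_(j < n) expR (- (c * j%:R)) <= geo c)%R.
Proof.
move=> c0; have q1 : (0 < 1 - expR (- c))%R by rewrite subr_gt0 expR_lt1 oppr_lt0.
suff -> : (\sum_(j < n) expR (- (c * j%:R)) = (1 - expR (- (c * n%:R))) * geo c)%R.
  by apply: ler_piMl; rewrite ?(ltW (geo_gt0 c0)) // lerBlDr lerDl expR_ge0.
elim: n => [|n IH]; first by rewrite big_ord0 mulr0 oppr0 expR0 subrr mul0r.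
rewrite big_ord_recr /= {}IH /geo.
have -> : (- (c * n.+1%:R) = - (c * n%:R) - c)%R by rewrite -natr1; ring.
by rewrite expRD; field; rewrite gt_eqF.
Qed.

Lemma geo_sum c : (0 < c)%R -> \sum_(j <oo) (expR (- (c * j%:R)))%:E <= (geo c)%:E.
Proof.
move=> c0; apply: lime_le => [|]; first by apply: is_cvg_nneseries => n _ _; rewrite lee_fin expR_ge0.
apply: nearW => n; rewrite big_mkord sumEFin lee_fin; exact: geo_partial.
Qed.

(** Minkowski's inequality for a geometric superposition. With [u j] the [j]-th shift of one
    sequence, it reduces a Hardy inequality to a pointwise bound by shifted terms. *)
Lemma sn_conv c (x : \bar R) (u : nat -> nat -> \bar R) : (0 < c)%R ->
  (forall j, nonneg (u j)) -> (forall j, nu (u j) <= x) ->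
  nu (fun n => \sum_(j <oo) (expR (- (c * j%:R)))%:E * u j n) <= (geo c)%:E * x.
Proof.
move=> c0 u0 ux; have e0 j : (0 : R)%:E <= (expR (- (c * j%:R)))%:E.
  by rewrite lee_fin expR_ge0.
have x0 : 0 <= x by apply: le_trans (ux 0%N); exact: sn_ge0.
have w0 j : nonneg (fun n => (expR (- (c * j%:R)))%:E * u j n).
  by move=> n; rewrite mule_ge0 // u0.
apply: (le_trans (sn_sigma hnu w0)).
apply: (@le_trans _ _ (\sum_(j <oo) (expR (- (c * j%:R)))%:E * x)).
  apply: lee_nneseries => [j _ _|j _]; first by apply: (sn_ge0 hnu); exact: w0.
  by rewrite (sn_scale hnu) ?expR_ge0 // lee_wpmul2l.
have [xf|] := boolP (x \is a fin_num); last first.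
  rewrite ge0_fin_numE // -leNgt leye_eq => /eqP ->.
  by rewrite gt0_muley ?leey // lte_fin geo_gt0.
rewrite -(fineK xf); under eq_eseriesr do rewrite muleC.
rewrite nneseriesZl => [|j _]; last by rewrite lee_fin expR_ge0.
by rewrite muleC lee_wpmul2r ?geo_sum // fineK.
Qed.

Lemma sn_conv_fwd c u v : (0 < c)%R -> nonneg u -> nonneg v ->
  (forall n, u n <= \sum_(j <oo) (expR (- (c * j%:R)))%:E * v (n + j)%N) ->
  nu u <= (geo c)%:E * nu v.
Proof.
move=> c0 u0 v0 h.
apply: le_trans (sn_conv c0 _ (fun j => sn_shift j v0)); last by move=> j n; exact: v0.
apply: (sn_mono hnu) => // n; apply: nneseries_ge0 => j _ _.
by rewrite mule_ge0 // lee_fin expR_ge0.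
Qed.

Lemma sn_conv_bwd c u v : (0 < c)%R -> nonneg u -> nonneg v ->
  (forall n, u n <= \sum_(j <oo) (expR (- (c * j%:R)))%:E *
                     (if (j <= n)%N then v (n - j)%N else 0)) ->
  nu u <= (geo c)%:E * nu v.
Proof.
move=> c0 u0 v0 h.
have w0 j : nonneg (fun n => if (j <= n)%N then v (n - j)%N else 0).
  by move=> n; case: ifP.
apply: le_trans (sn_conv c0 w0 (fun j => sn_unshift j v0)).
apply: (sn_mono hnu) => // n; apply: nneseries_ge0 => j _ _.
by rewrite mule_ge0 ?w0 // lee_fin expR_ge0.
Qed.

End sequence_norm.

(** * Suprema of tails and the discrete average *)

Section ereal_facts.
Local Open Scope ereal_scope.
Variable R : realType.

Lemma lee_wpM2r (a b : R) (x : \bar R) : (a <= b)%R -> 0 <= x ->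
  a%:E * x <= b%:E * x.
Proof. by move=> ab x0; rewrite lee_wpmul2r // lee_fin. Qed.

(** The strict inequality [m < k] reflects the supremum over s < t in the norm of B: for t in cell
    [m], the cells of larger index are those that lie entirely below t. *)
Definition tsup (g : nat -> \bar R) (m : nat) : \bar R :=
  ereal_sup [set g k | k in [set k | (m < k)%N]].

Lemma tsup_le g m x : (forall k, (m < k)%N -> g k <= x) -> tsup g m <= x.
Proof. by move=> h; apply: ge_ereal_sup => _ [k /= mk <-]; exact: h. Qed.

Lemma le_tsup (g : nat -> \bar R) m k : (m < k)%N -> g k <= tsup g m.
Proof. by move=> mk; apply: ereal_sup_ubound; exists k. Qed.

Lemma tsup_ge0 g : nonneg g -> nonneg (tsup g).
Proof. by move=> g0 m; apply: le_trans (le_tsup g (ltnSn m)). Qed.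

Definition below n (g : nat -> \bar R) k := if (k < n)%N then g k else 0.

Definition wt (w : nat -> R) (G : nat -> \bar R) k := (w k)%:E * G k.

Lemma below_ge0 n g : nonneg g -> nonneg (below n g).
Proof. by move=> g0 k; rewrite /below; case: ifP. Qed.

Lemma wt_ge0 k w G : reg k w -> nonneg G -> nonneg (wt w G).
Proof. by move=> [w0 _] G0 i; rewrite mule_ge0 // lee_fin ltW. Qed.

(* [avg F] models [f**] when [F n = f* (e^-n)]. *)
Definition avg (F : nat -> \bar R) n :=
  \sum_(j <oo) (expR (- j%:R))%:E * F (n + j)%N.

Lemma expE_ge0 (x : R) : 0 <= (expR x)%:E.
Proof. by rewrite lee_fin expR_ge0. Qed.

Lemma avg_ge0 F : nonneg F -> nonneg (avg F).
Proof. by move=> F0 n; apply: nneseries_ge0 => j _ _; rewrite mule_ge0 ?expE_ge0. Qed.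

Lemma le_avg F n : nonneg F -> F n <= avg F n.
Proof.
move=> F0; rewrite /avg nneseries_recl => [|j _|//]; last by rewrite mule_ge0 ?expE_ge0.
rewrite oppr0 expR0 mul1e addn0 leeDl //.
by apply: nneseries_ge0 => j _ _; rewrite mule_ge0 ?expE_ge0.
Qed.

Lemma avg_nd F : {homo F : n m / (n <= m)%N >-> n <= m} -> nonneg F ->
  {homo avg F : n m / (n <= m)%N >-> n <= m}.
Proof.
move=> Fnd F0 n m nm; apply: lee_nneseries => j _ => [_|].
  by rewrite mule_ge0 ?expE_ge0.
by rewrite lee_wpmul2l ?expE_ge0 // Fnd // leq_add2r.
Qed.

(** Discrete form of splitting the integral of f* over (0, e^-n) at e^-(n + k): the tail is a
    rescaled copy of the average. *)
Lemma avg_split F n k : nonneg F ->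
  avg F n = \sum_(j < k) (expR (- j%:R))%:E * F (n + j)%N +
            (expR (- k%:R))%:E * avg F (n + k)%N.
Proof.
move=> F0; rewrite /avg (nneseries_split 0 k) => [|j _]; last first.
  by rewrite mule_ge0 ?expE_ge0.
rewrite add0n big_mkord; congr (_ + _).
rewrite -nneseriesZl => [|j _]; last by rewrite mule_ge0 ?expE_ge0.
rewrite -nneseries_addn => [|j]; last by rewrite mule_ge0 ?expE_ge0.
apply: eq_eseriesr => j _; rewrite muleA -EFinM -expRD.
by rewrite -addnA (addnC j) natrD opprD.
Qed.

(** Discrete form of the monotonicity of t f**(t). *)
Lemma avg_step F n : nonneg F -> avg F n.+1 <= (expR 1)%:E * avg F n.
Proof.
move=> F0; rewrite (avg_split n 1) // big_ord1 addn1 addn0 oppr0 expR0 mul1e.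
rewrite ge0_muleDr ?mule_ge0 ?expE_ge0 // ?avg_ge0 // muleA -EFinM -expRD subrr.
by rewrite expR0 mul1e leeDr // !mule_ge0 ?expE_ge0.
Qed.

End ereal_facts.

(** * Weights given by the norms of tails and of initial blocks *)

Section weights.
Local Open Scope ereal_scope.
Variables (R : realType) (nu : (nat -> \bar R) -> \bar R).
Hypothesis hnu : seq_norm nu.

Definition tailnorm (a : nat -> R) n :=
  nu (fun m => if (n <= m)%N then (a m)%:E else 0).

(** The fundamental function at the integer [n]. The weights use [initnorm n.+1], which is positive
    and corresponds to ell(e^-n) = 1 + n. *)
Definition initnorm n := nu (fun m => if (m < n)%N then 1 else 0).

Lemma delta_le_single n : nu (fun m => if m == 0%N then 1 else 0) <=
  nu (fun m => if m == n then 1 else 0).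
Proof.
have h : nonneg (fun m : nat => if m == n then 1 else 0 : \bar R).
  by move=> m; case: ifP.
apply: le_trans (sn_shift hnu n h); apply: (sn_mono hnu) => m; rewrite ?h //.
- by case: ifP.
- by case: eqVneq => [->|_]; rewrite ?add0n ?eqxx //; case: ifP.
Qed.

Lemma initnorm_nd n m : (n <= m)%N -> initnorm n <= initnorm m.
Proof.
move=> nm; apply: (sn_mono hnu) => k; [by case: ifP|by case: ifP|].
by case: ifP => [kn|_]; [rewrite (leq_trans kn nm)|case: ifP].
Qed.

Lemma initnorm_lty n : initnorm n < +oo.
Proof.
elim: n => [|n IH].
  by rewrite /initnorm (@eq_sn _ nu _ (fun=> 0)) ?(sn0 hnu).
apply: (@le_lt_trans _ _ (initnorm n + nu (fun m => if m == 0%N then 1 else 0))).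
  apply: (sn_add_le hnu (v := fun m => if (m < n)%N then 1 else 0)
    (w := fun m => if m == n then 1 else 0)) => //.
  - by move=> k; case: ifP.
  - by move=> k; case: ifP.
  - by move=> k; case: ifP.
  - move=> k; rewrite ltnS leq_eqVlt; case: (ltngtP k n) => //=; rewrite ?adde0 ?add0e //.
  - exact: (sn_single hnu n).
by rewrite lte_add_pinfty // (sn_delta_lty hnu).
Qed.

Lemma initnorm_gt0 n : 0 < initnorm n.+1.
Proof.
apply: lt_le_trans (sn_delta_gt0 hnu) _; apply: (sn_mono hnu) => k.
- by case: ifP.
- by case: ifP.
- by case: eqVneq => [->|_] //; case: ifP.
Qed.

Lemma initnorm_fin n : initnorm n \is a fin_num.
Proof. by rewrite ge0_fin_numE ?initnorm_lty // (sn_ge0 hnu) // => k; case: ifP. Qed.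

(** Adding one point to a block adds at most the norm of a point, itself at most the norm of the
    initial block; growth is therefore at most linear. *)
Lemma reg_initnorm : reg 0 (fun n => fine (initnorm n.+1)).
Proof.
apply: reg0_linear => [n|].
  by rewrite fine_gt0 // initnorm_gt0 initnorm_lty.
exists 1%R => // n j; rewrite mul1r; split; last first.
  apply: (@le_trans _ _ (fine (initnorm (n + j).+1))).
    by rewrite fine_le ?initnorm_fin // initnorm_nd // ltnS leq_addr.
  rewrite ler_peMl ?lerDl // fine_ge0 // (sn_ge0 hnu) // => k; by case: ifP.
rewrite -lee_fin EFinM !fineK ?initnorm_fin //.
elim: j => [|j IH]; first by rewrite addn0 addr0 mul1e.
have -> : ((1 + j.+1%:R)%:E : \bar R) = (1 + j%:R)%:E + 1 by rewrite -EFinD -natr1 addrA.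
rewrite ge0_muleDl ?lee_fin ?addr_ge0 // mul1e.
apply: (sn_add_le hnu (v := fun m => if (m < (n + j).+1)%N then 1 else 0)
    (w := fun m => if m == (n + j).+1 then 1 else 0)) => //.
- by move=> k; case: ifP.
- by move=> k; case: ifP.
- by move=> k; case: ifP.
- move=> k; rewrite addnS ltnS leq_eqVlt; case: (ltngtP k (n + j).+1) => //=; rewrite ?adde0 ?add0e //.
- apply: (le_trans (sn_single hnu _ lee01)); apply: (sn_mono hnu) => k.
  + by case: ifP.
  + by case: ifP.
  + by case: eqVneq => [->|_] //; case: ifP.
Qed.

Variable a : nat -> R.
Hypothesis ha : reg 0 a.
Hypothesis fa : nu (fun m => (a m)%:E) < +oo.

Let ai0 n : nonneg (fun m => if (n <= m)%N then (a m)%:E else 0).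
Proof. by move=> m; case: ifP => // _; rewrite lee_fin (reg_ge0 _ ha). Qed.

Lemma tailnorm_ni n m : (n <= m)%N -> tailnorm a m <= tailnorm a n.
Proof.
move=> nm; apply: (sn_mono hnu); [exact: ai0|exact: ai0|move=> k].
by case: ifP => [mk|_]; [rewrite (leq_trans nm mk)|exact: (ai0 n k)].
Qed.

Lemma single_le_tailnorm n :
  (a n)%:E * nu (fun m => if m == 0%N then 1 else 0) <= tailnorm a n.
Proof.
have an : 0 <= (a n)%:E by rewrite lee_fin (reg_ge0 _ ha).
apply: (@le_trans _ _ ((a n)%:E * nu (fun m => if m == n then 1 else 0))).
  by rewrite lee_wpmul2l // delta_le_single.
rewrite -(sn_scalee hnu) // => [|k]; last by case: ifP.
apply: (sn_mono hnu); [by move=> k; case: ifP; rewrite ?mule1 ?mule0|exact: ai0|move=> k].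
by case: eqVneq => [->|_]; rewrite ?mule1 ?leqnn // mule0 (ai0 n k).
Qed.

Lemma tailnorm_fin n : tailnorm a n \is a fin_num.
Proof.
rewrite ge0_fin_numE; last by apply: (sn_ge0 hnu); exact: ai0.
apply: le_lt_trans fa; apply: (sn_mono hnu) => k; first exact: (ai0 n k).
  by rewrite lee_fin (reg_ge0 _ ha).
by case: ifP => // _; rewrite lee_fin (reg_ge0 _ ha).
Qed.

Lemma tailnorm_gt0 n : 0 < tailnorm a n.
Proof.
apply: lt_le_trans (single_le_tailnorm n).
by rewrite mule_gt0 ?(sn_delta_gt0 hnu) // lte_fin (reg_gt0 _ ha).
Qed.

(** One bound is monotonicity. For the other, the tail from [n] is the shift by [j] of the tail from
    [n + j], and moving the weight [a] by [j] costs at most a multiple of exp(e j). *)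
Lemma reg_tailnorm : reg 0 (fun n => fine (tailnorm a n)).
Proof.
split=> [n|e e0].
  by rewrite fine_gt0 // tailnorm_gt0 -ge0_fin_numE ?tailnorm_fin // ltW // tailnorm_gt0.
have [C C0 H] := reg_growth e0 ha.
exists (1 + C)%R => [|n j]; first exact: addr_gt0.
rewrite sub0r mulNr opprK add0r; split.
  apply: (@le_trans _ _ (fine (tailnorm a n))).
    by rewrite fine_le ?tailnorm_fin // tailnorm_ni // leq_addr.
  have t0 : (0 <= fine (tailnorm a n))%R by rewrite fine_ge0 // ltW // tailnorm_gt0.
  apply: ler_peMl => //; have : (1 <= expR (e * j%:R))%R.
    by rewrite -[leLHS](@expR0 R) ler_expR mulr_ge0 // ltW.
  by nra.
rewrite -lee_fin EFinM !fineK ?tailnorm_fin //.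
apply: (@le_trans _ _ ((C * expR (e * j%:R))%:E * tailnorm a (n + j)%N)); last first.
  apply: lee_wpM2r; last exact/ltW/tailnorm_gt0.
  by rewrite ler_pM2r ?expR_gt0 // lerDr.
have cc : (0 <= C * expR (e * j%:R))%R by rewrite mulr_ge0 ?expR_ge0 // ltW.
apply: (@le_trans _ _ ((C * expR (e * j%:R))%:E *
   nu (fun m => if (n + j <= m + j)%N then (a (m + j)%N)%:E else 0))); last first.
  rewrite lee_wpmul2l ?lee_fin //; exact: (sn_shift hnu j (ai0 (n + j)%N)).
apply: (sn_le hnu cc (ai0 n) (fun m => ai0 (n + j)%N (m + j)%N)) => m.
rewrite leq_add2r; case: ifP => _; last by rewrite mule0.
by rewrite -EFinM lee_fin.
Qed.

End weights.

(** * Discrete Hardy inequalities *)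

Section discrete_operators.
Local Open Scope ereal_scope.
Variable R : realType.
Implicit Types (g h : nat -> \bar R) (w : nat -> R).

Definition above n g k := if (n <= k)%N then g k else 0.

(** Models an integral over (t, 1) for t in cell [m]: the cells [k < m] are those lying entirely
    above t. *)
Definition psum g m := \sum_(k < m) g k.

Lemma above_ge0 n g : nonneg g -> nonneg (above n g).
Proof. by move=> g0 k; rewrite /above; case: ifP. Qed.

Lemma psum_ge0 g : nonneg g -> nonneg (psum g).
Proof. by move=> g0 m; apply: sume_ge0 => k _; exact: g0. Qed.

Lemma le_psum g h m : (forall k, g k <= h k) -> psum g m <= psum h m.
Proof. by move=> gh; apply: lee_sum => k _; exact: gh. Qed.

Lemma psum_term g m k : nonneg g -> (k < m)%N -> g k <= psum g m.
Proof.
move=> g0 km; rewrite /psum (bigD1 (Ordinal km)) //= leeDl // sume_ge0 // => i _; exact: g0.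
Qed.

Lemma psum_shift g m j : nonneg g -> psum (fun k => g (k + j)%N) m <= psum g (m + j)%N.
Proof.
move=> g0; rewrite /psum addnC big_split_ord /=.
under [leLHS]eq_bigr do rewrite addnC.
by rewrite leeDr // sume_ge0 // => i _; exact: g0.
Qed.

Lemma series_below (f : nat -> \bar R) n : nonneg f ->
  \sum_(k <oo) below n f k = \sum_(k < n) f k.
Proof.
move=> f0; rewrite (nneseries_split 0 n) => [|k _]; last exact: below_ge0.
rewrite add0n big_mkord [X in _ + X]eseries0 ?adde0 => [|k nk _].
  by apply: eq_bigr => i _; rewrite /below ltn_ord.
by rewrite /below ltnNge nk.
Qed.

Lemma series_above (f : nat -> \bar R) n : nonneg f ->
  \sum_(k <oo) above n f k = \sum_(j <oo) f (n + j)%N.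
Proof.
move=> f0; rewrite (nneseries_split 0 n) => [|k _]; last exact: above_ge0.
rewrite add0n big_mkord big1 ?add0e => [|i _]; last by rewrite /above leqNgt ltn_ord.
rewrite -nneseries_addn => [|k]; last exact: above_ge0.
by apply: eq_eseriesr => j _; rewrite /above leq_addl addnC.
Qed.

Lemma series_le_term (f : nat -> \bar R) k : nonneg f -> f k <= \sum_(i <oo) f i.
Proof. by move=> f0; rewrite (nneseriesD1 (n := k)) // leeDl // nneseries_ge0. Qed.

Lemma series_le_scale (c : nat -> R) (K : R) (x : \bar R) : (0 < K)%R ->
  (forall j, 0 <= c j)%R -> 0 <= x -> \sum_(j <oo) (c j)%:E <= K%:E ->
  \sum_(j <oo) (c j)%:E * x <= K%:E * x.
Proof.
move=> K0 c0 x0 h; have [xf|] := boolP (x \is a fin_num); last first.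
  rewrite ge0_fin_numE // -leNgt leye_eq => /eqP ->.
  by rewrite gt0_muley ?leey // lte_fin.
rewrite -(fineK xf); under eq_eseriesr do rewrite muleC.
rewrite nneseriesZl => [|j _]; last by rewrite lee_fin.
by rewrite muleC; apply: lee_wpmul2r; rewrite ?fineK.
Qed.

(** Discrete Karamata estimates, here and in [reg_sum_below]: half of the nonzero index is kept as
    geometric decay away from the term at [n]. *)
Lemma reg_sum_above k w : (0 < k)%R -> reg k w -> exists2 C : R, (0 < C)%R &
  forall n, \sum_(j <oo) (w (n + j)%N)%:E <= (C * w n)%:E.
Proof.
move=> k0 rw; have k20 : (0 < k / 2)%R by rewrite divr_gt0.
have [|C C0 H] := reg_decay (c := (k / 2)%R) _ rw; first by lra.
exists (C * geo (k / 2))%R => [|n]; first by rewrite mulr_gt0 // geo_gt0.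
apply: (@le_trans _ _ (\sum_(j <oo) (C * w n)%:E * (expR (- (k / 2 * j%:R)))%:E)).
  apply: lee_nneseries => j _ => [_|]; first by rewrite lee_fin (reg_ge0 _ rw).
  rewrite -EFinM lee_fin; apply: le_trans (H n j) _.
  by rewrite le_eqVlt; apply/orP; left; apply/eqP; ring.
rewrite nneseriesZl => [|j _]; last exact: expE_ge0.
have -> : (C * geo (k / 2) * w n = C * w n * geo (k / 2))%R by ring.
rewrite [leRHS]EFinM; apply: lee_wpmul2l; last exact: geo_sum.
by rewrite lee_fin mulr_ge0 ?(reg_ge0 _ rw) // ltW.
Qed.

Lemma reg_sum_below k w : (k < 0)%R -> reg k w -> exists2 C : R, (0 < C)%R &
  forall n, (\sum_(i < n) w i <= C * w n)%R.
Proof.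
move=> k0 rw; have k20 : (0 < - (k / 2))%R by lra.
have [|C C0 H] := reg_growth (c := (k / 2)%R) _ rw; first by lra.
exists (C * geo (- (k / 2)))%R => [|n]; first by rewrite mulr_gt0 // geo_gt0.
apply: (@le_trans _ _ (\sum_(i < n) C * w n * expR (- (- (k / 2) * (n - i)%:R))))%R.
  apply: ler_sum => i _; have := H i (n - i)%N; rewrite subnKC; last exact/ltnW.
  move=> h; apply: (le_trans h); rewrite mulNr opprK.
  by rewrite le_eqVlt; apply/orP; left; apply/eqP; ring.
rewrite -mulr_sumr.
have -> : (C * geo (- (k / 2)) * w n = C * w n * geo (- (k / 2)))%R by ring.
apply: ler_wpM2l; first by rewrite mulr_ge0 ?(reg_ge0 _ rw) // ltW.
(* The exponents n - i run over 1, ..., n; the term of exponent 0 is added to obtain a full partial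
   sum. *)
apply: le_trans (geo_partial n.+1 k20).
rewrite big_ord_recl /= (reindex_inj rev_ord_inj) /=.
apply: (@le_trans _ _ (\sum_(i < n) expR (- (- (k / 2) * (bump 0 i)%:R))))%R.
  rewrite le_eqVlt; apply/orP; left; apply/eqP; apply: eq_bigr => i _.
  by rewrite subKn // ltn_ord.
by rewrite lerDr expR_ge0.
Qed.

End discrete_operators.

(** * Hardy type inequalities for [Iop] and [Jop] *)

Section discrete_inequalities.
Local Open Scope ereal_scope.
Variables (R : realType) (nu0 nu1 : (nat -> \bar R) -> \bar R).
Hypothesis (hn0 : seq_norm nu0) (hn1 : seq_norm nu1).
Variables (a d : nat -> R) (k0 k1 : R).
Hypothesis (ha : reg 0 a) (hd : reg 0 d).
Hypothesis fa : nu0 (fun m => (a m)%:E) < +oo.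
Hypothesis (k1_gt0 : (0 < k1)%R) (k10 : (k1 < k0)%R) (k0_lt1 : (k0 < 1)%R).
Implicit Types (G H F : nat -> \bar R).

(* [wA] and [wP] model [ell_norm] and [fundamental E1 (ell u)] at [u = e^-n],
   and [wrho] models [rho]. *)
Definition wA n : R := fine (tailnorm nu0 a n).
Definition wP n : R := fine (initnorm nu1 n.+1).
Definition w0 n : R := expR (- (k0 * n%:R)).
Definition w1 n : R := (expR (- (k1 * n%:R)) * d n)%R.
Definition wrho n : R := (wA n * w0 n / (wP n * w1 n))%R.

(* With [k0 = 1/p0], [k1 = 1/p1], [G = avg F] and [F n = f* (e^-n)], [Iop 0 G]
   and [normB G] are equivalent to the norms of [f] in the spaces A and B;
   [Iop n G] and [Jop n G] keep the indices [k] on one side of [n]. *)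
Definition Iop n G := nu0 (fun m => (a m)%:E * psum (above n (wt w0 G)) m).
Definition Jop n G := nu1 (tsup (below n (wt w1 G))).
Definition normB G := nu1 (tsup (wt w1 G)).

Lemma reg_wA : reg 0 wA. Proof. exact: reg_tailnorm. Qed.
Lemma reg_wP : reg 0 wP. Proof. exact: reg_initnorm. Qed.
Lemma reg_w0 : reg k0 w0. Proof. exact: reg_expR. Qed.
Lemma reg_w1 : reg k1 w1.
Proof. by apply: eq_reg (regM (reg_expR k1) hd) => //; rewrite addr0. Qed.
Lemma reg_wrho : reg (k0 - k1) wrho.
Proof.
apply: eq_reg (regM (regM reg_wA reg_w0) (regV (regM reg_wP reg_w1))) => //.
by ring.
Qed.

Lemma wA_E n : tailnorm nu0 a n = (wA n)%:E.
Proof. by rewrite fineK // tailnorm_fin. Qed.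
Lemma wP_E n : initnorm nu1 n.+1 = (wP n)%:E.
Proof. by rewrite fineK // initnorm_fin. Qed.

Let a0 m : 0 <= (a m)%:E. Proof. by rewrite lee_fin (reg_ge0 _ ha). Qed.

Lemma Iop_arg_ge0 g : nonneg g -> nonneg (fun m => (a m)%:E * psum g m).
Proof. by move=> g0 m; rewrite mule_ge0 // psum_ge0. Qed.

Lemma Iop_ge0 n G : nonneg G -> 0 <= Iop n G.
Proof.
move=> G0; apply: (sn_ge0 hn0); apply: Iop_arg_ge0.
by apply: above_ge0; exact: wt_ge0 reg_w0 _.
Qed.

Lemma Jop_ge0 n G : nonneg G -> 0 <= Jop n G.
Proof.
move=> G0; apply: (sn_ge0 hn1); apply: tsup_ge0.
by apply: below_ge0; exact: wt_ge0 reg_w1 _.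
Qed.

Lemma normB_ge0 G : nonneg G -> 0 <= normB G.
Proof.
by move=> G0; apply: (sn_ge0 hn1); apply: tsup_ge0; exact: wt_ge0 reg_w1 _.
Qed.

(* Interchanging the norm with the summation over [k]. *)
Lemma psum_norm_le g : nonneg g ->
  nu0 (fun m => (a m)%:E * psum g m) <= \sum_(k <oo) (wA k)%:E * g k.
Proof.
move=> g0; pose u k m := if (k < m)%N then (a m)%:E * g k else 0.
have u0 k : nonneg (u k) by move=> m; rewrite /u; case: ifP => // _; rewrite mule_ge0.
have -> : nu0 (fun m => (a m)%:E * psum g m) = nu0 (fun m => \sum_(k <oo) u k m).
  apply: eq_sn => m; rewrite /psum -(series_below m g0) -nneseriesZl => [|k _]; last exact: below_ge0.
  by apply: eq_eseriesr => k _; rewrite /below /u; case: ifP => // _; rewrite mule0.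
apply: (le_trans (sn_sigma hn0 u0)); apply: lee_nneseries => k _ => [_|].
  exact: (sn_ge0 hn0).
rewrite -wA_E muleC -(sn_scalee hn0) // => [|m]; last by case: ifP.
apply: (sn_mono hn0) => // m; first by rewrite mule_ge0 //; case: ifP.
rewrite /u; case: ltnP => km; first by rewrite ltnW // muleC.
by rewrite mule_ge0 //; case: ifP.
Qed.

(** The supremum is majorised by the sum: the term [g k] is seen by the indices [m < k], a block of
    norm at most [wP k]. The loss is harmless where the resulting sums are geometric. *)
Lemma tsup_norm_le g : nonneg g -> nu1 (tsup g) <= \sum_(k <oo) (wP k)%:E * g k.
Proof.
move=> g0; pose u k m := if (m < k)%N then g k else 0.
have u0 k : nonneg (u k) by move=> m; rewrite /u; case: ifP.
apply: (@le_trans _ _ (nu1 (fun m => \sum_(k <oo) u k m))).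
  apply: (sn_mono hn1) => [||m]; [exact: tsup_ge0|by move=> m; apply: nneseries_ge0 => k _ _; exact: u0|].
  apply: tsup_le => k mk; apply: le_trans (series_le_term k _); last by move=> i; exact: u0.
  by rewrite /u mk.
apply: (le_trans (sn_sigma hn1 u0)); apply: lee_nneseries => k _ => [_|].
  exact: (sn_ge0 hn1).
rewrite -wP_E muleC -(sn_scalee hn1) // => [|m]; last by case: ifP.
apply: (sn_mono hn1) => // m; first by rewrite mule_ge0 //; case: ifP.
rewrite /u; case: ltnP => mk; first by rewrite ltnS ltnW // mule1.
by rewrite mule_ge0 //; case: ifP.
Qed.

Lemma Iop_le_series n G : nonneg G ->
  Iop n G <= \sum_(j <oo) (wA (n + j)%N * w0 (n + j)%N)%:E * G (n + j)%N.
Proof.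
move=> G0; have g0 := wt_ge0 reg_w0 G0.
apply: (le_trans (psum_norm_le (above_ge0 n g0))).
have h0 : nonneg (fun k => (wA k)%:E * wt w0 G k).
  by move=> k; rewrite mule_ge0 // lee_fin (reg_ge0 _ reg_wA).
have := series_above n h0; rewrite /wt; under [in X in _ = X -> _]eq_eseriesr do rewrite muleA -EFinM.
move=> <-; rewrite le_eqVlt; apply/orP; left; apply/eqP.
by apply: eq_eseriesr => k _; rewrite /above; case: ifP => // _; rewrite mule0.
Qed.

Lemma Jop_le_sum n G : nonneg G ->
  Jop n G <= \sum_(k < n) (wP k * w1 k)%:E * G k.
Proof.
move=> G0; have g0 := wt_ge0 reg_w1 G0.
apply: (le_trans (tsup_norm_le (below_ge0 n g0))).
have h0 : nonneg (fun k => (wP k)%:E * wt w1 G k).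
  by move=> k; rewrite mule_ge0 // lee_fin (reg_ge0 _ reg_wP).
have := series_below n h0; rewrite /wt; under [in X in _ = X -> _]eq_bigr do rewrite muleA -EFinM.
move=> <-; rewrite le_eqVlt; apply/orP; left; apply/eqP.
by apply: eq_eseriesr => k _; rewrite /below; case: ifP => // _; rewrite mule0.
Qed.

Lemma Iop_ni n m G : (n <= m)%N -> nonneg G -> Iop m G <= Iop n G.
Proof.
move=> nm G0; have g0 := wt_ge0 reg_w0 G0.
apply: (sn_mono hn0) => [|| i]; [exact/Iop_arg_ge0/above_ge0..|].
apply: lee_wpmul2l => //; apply: le_psum => k; rewrite /above.
case: leqP => mk; first by rewrite (leq_trans nm mk).
by case: ifP => // _; exact: g0.
Qed.

Lemma le_Iop n G H : nonneg G -> nonneg H -> (forall k, G k <= H k) -> Iop n G <= Iop n H.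
Proof.
move=> G0 H0 GH; have g0 := wt_ge0 reg_w0 G0; have h0 := wt_ge0 reg_w0 H0.
apply: (sn_mono hn0) => [|| i]; [exact/Iop_arg_ge0/above_ge0..|].
apply: lee_wpmul2l => //; apply: le_psum => k; rewrite /above.
by case: ifP => // _; rewrite lee_wpmul2l // lee_fin (reg_ge0 _ reg_w0).
Qed.

Lemma le_Jop n G H : nonneg G -> nonneg H -> (forall k, G k <= H k) -> Jop n G <= Jop n H.
Proof.
move=> G0 H0 GH; have g0 := wt_ge0 reg_w1 G0; have h0 := wt_ge0 reg_w1 H0.
apply: (sn_mono hn1) => [|| i]; [exact/tsup_ge0/below_ge0..|].
apply: tsup_le => k ik; apply: le_trans (le_tsup _ ik); rewrite /below.
by case: ifP => // _; rewrite lee_wpmul2l // lee_fin (reg_ge0 _ reg_w1).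
Qed.

Lemma Iop_add n G H : nonneg G -> nonneg H ->
  Iop n (fun k => G k + H k) <= Iop n G + Iop n H.
Proof.
move=> G0 H0; have g0 := wt_ge0 reg_w0 G0; have h0 := wt_ge0 reg_w0 H0.
have gh0 : nonneg (wt w0 (fun k => G k + H k)).
  by apply: wt_ge0 reg_w0 _ => k; rewrite adde_ge0.
apply: (sn_add_le hn0) (lexx _) (lexx _); [exact/Iop_arg_ge0/above_ge0..|move=> m].
rewrite -ge0_muleDr ?psum_ge0 //; [|exact: above_ge0..].
apply: lee_wpmul2l => //; rewrite /psum -big_split /=; apply: lee_sum => k _.
rewrite /above; case: ifP => // _; last by rewrite adde0.
by rewrite /wt ge0_muleDr.
Qed.

Lemma Jop_add n G H : nonneg G -> nonneg H ->
  Jop n (fun k => G k + H k) <= Jop n G + Jop n H.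
Proof.
move=> G0 H0; have g0 := wt_ge0 reg_w1 G0; have h0 := wt_ge0 reg_w1 H0.
have gh0 : nonneg (wt w1 (fun k => G k + H k)).
  by apply: wt_ge0 reg_w1 _ => k; rewrite adde_ge0.
apply: (sn_add_le hn1) (lexx _) (lexx _); [exact/tsup_ge0/below_ge0..|move=> m].
apply: tsup_le => k mk; apply: (@le_trans _ _ (below n (wt w1 G) k + below n (wt w1 H) k)).
  rewrite /below; case: ifP => // _; last by rewrite adde0.
  by rewrite /wt ge0_muleDr.
by apply: leeD; exact: le_tsup.
Qed.

Lemma IopZ n (c : R) G : (0 <= c)%R -> nonneg G ->
  Iop n (fun k => c%:E * G k) = c%:E * Iop n G.
Proof.
move=> c0 G0; have g0 := wt_ge0 reg_w0 G0.
rewrite -(sn_scale hn0) //; last exact/Iop_arg_ge0/above_ge0.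
rewrite /Iop; apply: eq_sn => m; rewrite muleCA; congr (_ * _).
rewrite /psum ge0_sume_distrr => [|k _]; last exact: above_ge0.
apply: eq_bigr => k _; rewrite /above; case: ifP => _; last by rewrite mule0.
by rewrite /wt muleCA.
Qed.

Lemma JopZ_le n (c : R) G : (0 <= c)%R -> nonneg G ->
  Jop n (fun k => c%:E * G k) <= c%:E * Jop n G.
Proof.
move=> c0 G0; have g0 := wt_ge0 reg_w1 G0.
have cg0 : nonneg (wt w1 (fun k => c%:E * G k)).
  by apply: wt_ge0 reg_w1 _ => k; rewrite mule_ge0.
apply: (sn_le hn1) => // [||m]; [exact/tsup_ge0/below_ge0..|].
apply: tsup_le => k mk; apply: (@le_trans _ _ (c%:E * below n (wt w1 G) k)).
  rewrite /below; case: ifP => _; last by rewrite mule0.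
  by rewrite /wt muleCA.
by apply: lee_wpmul2l => //; exact: le_tsup.
Qed.

(** Every index [m > n] sees the single term [wt w0 G n], and the tail beyond [n] has norm
    [wA n.+1], of the order of [wA n]. *)
Lemma le_Iop_point : exists2 C : R, (0 < C)%R & forall G n, nonneg G ->
  (wA n * w0 n)%:E * G n <= C%:E * Iop n G.
Proof.
have [C C0 H] := reg_step reg_wA; exists C => // G n G0.
have g0 := wt_ge0 reg_w0 G0.
apply: (@le_trans _ _ (C%:E * ((wA n.+1)%:E * wt w0 G n))).
  rewrite /wt !muleA -!EFinM lee_wpM2r // ler_wpM2r ?(reg_ge0 _ reg_w0) //.
  by case: (H n).
apply: lee_wpmul2l; first by rewrite lee_fin ltW.
rewrite -wA_E muleC -(sn_scalee hn0) // => [|m]; last by case: ifP.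
apply: (sn_mono hn0) => [m||m].
- by rewrite mule_ge0 //; case: ifP.
- exact/Iop_arg_ge0/above_ge0.
case: ltnP => nm; last by rewrite mule0 (Iop_arg_ge0 (above_ge0 n g0)).
rewrite muleC; apply: lee_wpmul2l => //.
apply: le_trans (psum_term (above_ge0 n g0) nm).
by rewrite /above leqnn.
Qed.

(** The term [n.+1] is seen by every [m <= n], a block of norm [wP n]. That term has to pass the
    cut, whence [n.+2]; monotonicity replaces [G n] by [G n.+1]. *)
Lemma le_Jop_point : exists2 C : R, (0 < C)%R & forall G n, nonneg G ->
  {homo G : i j / (i <= j)%N >-> i <= j} ->
  (wP n * w1 n)%:E * G n <= C%:E * Jop n.+2 G.
Proof.
have [C C0 H] := reg_step reg_w1; exists C => // G n G0 Gnd.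
have g0 := wt_ge0 reg_w1 G0.
apply: (@le_trans _ _ (C%:E * ((wP n)%:E * wt w1 G n.+1))).
  rewrite /wt !muleA -!EFinM.
  apply: (@le_trans _ _ ((wP n * w1 n)%:E * G n.+1)).
    by rewrite lee_wpmul2l ?Gnd // lee_fin mulr_ge0 ?(reg_ge0 _ reg_wP) ?(reg_ge0 _ reg_w1).
  rewrite lee_wpM2r // mulrAC (mulrC (wP n)) ler_wpM2r ?(reg_ge0 _ reg_wP) //.
  by case: (H n).
apply: lee_wpmul2l; first by rewrite lee_fin ltW.
rewrite -wP_E muleC -(sn_scalee hn1) // => [|m]; last by case: ifP.
apply: (sn_mono hn1) => [m||m].
- by rewrite mule_ge0 //; case: ifP.
- exact/tsup_ge0/below_ge0.
case: ltnP => nm; last by rewrite mule0; exact/tsup_ge0/below_ge0.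
rewrite mule1; apply: le_trans (le_tsup _ nm).
by rewrite /below ltnS leqnn.
Qed.

Lemma Jop_le_normB n G : nonneg G -> Jop n G <= normB G.
Proof.
move=> G0; have g0 := wt_ge0 reg_w1 G0.
apply: (sn_mono hn1) => [|| m]; [exact/tsup_ge0/below_ge0|exact/tsup_ge0|].
apply: tsup_le => k mk; apply: le_trans (le_tsup _ mk); rewrite /below.
by case: ifP.
Qed.

(** An element of B tested by A beyond [n]: [le_Jop_point] bounds each [G k] through [normB G], and
    the tail sum of [wrho] is left, of order [wrho n]. *)
Lemma Iop_le_normB : exists2 C : R, (0 < C)%R & forall G n, nonneg G ->
  {homo G : i j / (i <= j)%N >-> i <= j} ->
  Iop n G <= (C * wrho n)%:E * normB G.
Proof.
have [C1 C10 H1] := le_Jop_point.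
have [|C2 C20 H2] := reg_sum_above _ reg_wrho; first by rewrite subr_gt0.
exists (C1 * C2)%R => [|G n G0 Gnd]; first exact: mulr_gt0.
have N0 := normB_ge0 G0.
have pw k : (0 < wP k * w1 k)%R by rewrite mulr_gt0 ?(reg_gt0 _ reg_wP) ?(reg_gt0 _ reg_w1).
have Hk k : (wA k * w0 k)%:E * G k <= (wrho k)%:E * (C1%:E * normB G).
  have -> : (wA k * w0 k = wrho k * (wP k * w1 k))%R by rewrite divfK // gt_eqF.
  rewrite EFinM -muleA; apply: lee_wpmul2l; first by rewrite lee_fin (reg_ge0 _ reg_wrho).
  apply: (le_trans (H1 G k G0 Gnd)); apply: lee_wpmul2l; first by rewrite lee_fin ltW.
  exact: Jop_le_normB.
apply: (le_trans (Iop_le_series n G0)).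
have rp j : 0 <= (wrho (n + j)%N)%:E by rewrite lee_fin (reg_ge0 _ reg_wrho).
apply: (@le_trans _ _ (\sum_(j <oo) (wrho (n + j)%N)%:E * (C1%:E * normB G))).
  apply: lee_nneseries => j _ => [_|]; last exact: Hk.
  by rewrite mule_ge0 // lee_fin mulr_ge0 ?(reg_ge0 _ reg_wA) ?(reg_ge0 _ reg_w0).
have -> : (C1 * C2 * wrho n)%:E * normB G = (C2 * wrho n)%:E * (C1%:E * normB G).
  by rewrite muleA -EFinM; congr (_%:E * _); ring.
apply: series_le_scale (H2 n) => [|j|].
- by rewrite mulr_gt0 // (reg_gt0 _ reg_wrho).
- exact: (reg_ge0 _ reg_wrho).
- by rewrite mule_ge0 // lee_fin ltW.
Qed.

(** Mirror image of [Iop_le_normB]: [le_Iop_point] bounds each [G i], and the partial sum of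
    [1 / wrho] is left, of order [1 / wrho n]. *)
Lemma Jop_le_Iop0 : exists2 C : R, (0 < C)%R & forall G n, nonneg G ->
  (wrho n)%:E * Jop n G <= C%:E * Iop 0 G.
Proof.
have [C1 C10 H1] := le_Iop_point.
have [|C2 C20 H2] := reg_sum_below _ (regV reg_wrho); first by rewrite oppr_lt0 subr_gt0.
exists (C2 * C1)%R => [|G n G0]; first exact: mulr_gt0.
have rn := reg_gt0 n reg_wrho.
have I0 := Iop_ge0 0 G0.
apply: (@le_trans _ _ ((wrho n)%:E * ((C2 * (wrho n)^-1)%:E * (C1%:E * Iop 0 G)))); last first.
  rewrite !muleA -!EFinM (_ : wrho n * (C2 / wrho n) * C1 = C2 * C1)%R //.
  by field; rewrite gt_eqF.
apply: lee_wpmul2l; first by rewrite lee_fin ltW.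
apply: (le_trans (Jop_le_sum n G0)).
apply: (@le_trans _ _ ((\sum_(i < n) (wrho i)^-1)%:E * (C1%:E * Iop 0 G))); last first.
  by apply: lee_wpM2r => //; rewrite mule_ge0 // lee_fin ltW.
rewrite -sumEFin ge0_sume_distrl => [|i _]; last first.
  by rewrite lee_fin invr_ge0 (reg_ge0 _ reg_wrho).
apply: lee_sum => i _.
have aw : (0 < wA i * w0 i)%R by rewrite mulr_gt0 ?(reg_gt0 _ reg_wA) ?(reg_gt0 _ reg_w0).
have -> : (wP i * w1 i = (wrho i)^-1 * (wA i * w0 i))%R.
  by rewrite /wrho invf_div divfK // gt_eqF.
rewrite EFinM -muleA; apply: lee_wpmul2l.
  by rewrite lee_fin invr_ge0 (reg_ge0 _ reg_wrho).
apply: (le_trans (H1 G i G0)); apply: lee_wpmul2l; first by rewrite lee_fin ltW.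
by apply: Iop_ni.
Qed.

(* [F'] comes from the part of a function above the level [F n]; in
   [normB_lower_part] it comes from the part below that level. *)
Lemma Iop0_upper_part : exists2 C : R, (0 < C)%R & forall F F' n, nonneg F -> nonneg F' ->
  (forall k, F' k <= F k) -> (forall k, (k <= n)%N -> F' k = 0) ->
  Iop 0 (avg F') <= C%:E * Iop n (avg F).
Proof.
have [C1 C10 H1] := le_Iop_point.
(* The factor exp(k) comes from the growth of [avg F'] before [n]. The index k0 - 1 is negative, so
   the partial sums of [v] are of the order of [v n]. *)
pose v k := (wA k * w0 k * expR (- (- 1 * k%:R)))%R.
have rv : reg (k0 - 1) v.
  by apply: eq_reg (regM (regM reg_wA reg_w0) (reg_expR (-1))) => //; ring.
have [|C2 C20 H2] := reg_sum_below _ rv; first by rewrite subr_lt0.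
exists (1 + C2 * C1)%R => [|F F' n F0 F'0 F'F F'z]; first by rewrite addr_gt0 // mulr_gt0.
have A0 := avg_ge0 F0; have A'0 := avg_ge0 F'0.
have g0 := wt_ge0 reg_w0 A0; have g'0 := wt_ge0 reg_w0 A'0.
have AA k : avg F' k <= avg F k.
  apply: lee_nneseries => j _ => [_|]; first by rewrite mule_ge0 ?expE_ge0.
  by rewrite lee_wpmul2l ?expE_ge0.
(* As [F'] vanishes up to [n], its average before [n] is exp(k - n) times its average at [n]. *)
have Ak k : (k < n)%N -> avg F' k <= (expR (- n%:R) * expR k%:R)%:E * avg F n.
  move=> kn; rewrite (avg_split k (n - k)) // big1 ?add0e => [|j _]; last first.
    by rewrite F'z ?mule0 //; have := ltn_ord j; rewrite ltn_subRL => /ltnW.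
  rewrite subnKC ?(ltnW kn) // -expRD natrB ?(ltnW kn) // opprB addrC.
  by apply: lee_wpmul2l; rewrite ?expE_ge0.
have An0 : 0 <= avg F n by [].
pose y k := below n (wt w0 (fun k => (expR (- n%:R) * expR k%:R)%:E * avg F n)) k.
have y0 : nonneg y.
  apply: below_ge0; apply: wt_ge0 reg_w0 _ => k.
  by rewrite mule_ge0 // lee_fin mulr_ge0 // expR_ge0.
rewrite EFinD ge0_muleDl ?lee_fin ?mulr_ge0 ?(ltW C10) ?(ltW C20) // mul1e.
apply: (@sn_add_le _ _ hn0 _ (fun m => (a m)%:E * psum (above n (wt w0 (avg F))) m)
   (fun m => (a m)%:E * psum y m)); last 2 first.
- exact: lexx.
- apply: (le_trans (psum_norm_le y0)).
  have E k : (wA k)%:E * y k = below n (fun k => (expR (- n%:R) * v k)%:E * avg F n) k.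
    rewrite /y /below; case: ifP => _; last by rewrite mule0.
    rewrite /wt !muleA -!EFinM; congr (_%:E * _); rewrite /v mulN1r opprK; ring.
  under eq_eseriesr do rewrite E.
  have v0 k : 0 <= (expR (- n%:R) * v k)%:E by rewrite lee_fin mulr_ge0 ?expR_ge0 ?(reg_ge0 _ rv).
  rewrite series_below; last by move=> k; rewrite mule_ge0.
  rewrite -ge0_sume_distrl // sumEFin -mulr_sumr.
  apply: (@le_trans _ _ ((C2 * (wA n * w0 n))%:E * avg F n)).
    apply: lee_wpM2r => //.
    apply: (@le_trans _ _ (expR (- n%:R) * (C2 * v n))%R).
      by rewrite ler_wpM2l ?expR_ge0 // H2.
    rewrite /v mulN1r opprK le_eqVlt; apply/orP; left; apply/eqP.
    have -> : (expR (- n%:R) * (C2 * (wA n * w0 n * expR n%:R)) =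
       C2 * (wA n * w0 n) * (expR (- n%:R) * expR n%:R))%R by ring.
    by rewrite -expRD addNr expR0 mulr1.
  rewrite [in leLHS]EFinM [in leRHS]EFinM -!muleA; apply: lee_wpmul2l; first by rewrite lee_fin ltW.
  exact: H1.
- by apply/Iop_arg_ge0/above_ge0.
- by apply/Iop_arg_ge0/above_ge0.
- exact/Iop_arg_ge0.
- move=> m; rewrite -ge0_muleDr ?psum_ge0 //; last exact: above_ge0.
  apply: lee_wpmul2l => //; rewrite /psum -big_split /=; apply: lee_sum => k _.
  rewrite {1}/above leq0n /above /y /below; case: ltnP => nk.
    rewrite add0e /wt; apply: lee_wpmul2l; last exact: Ak.
    by rewrite lee_fin (reg_ge0 _ reg_w0).
  rewrite adde0 /wt; apply: lee_wpmul2l => //.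
  by rewrite lee_fin (reg_ge0 _ reg_w0).
Qed.

Lemma avg_le_const F n (x : \bar R) : nonneg F -> (forall k, F k <= x) ->
  avg F n <= (geo 1)%:E * x.
Proof.
move=> F0 Fx; have x0 : 0 <= x by apply: le_trans (Fx 0%N).
apply: (@le_trans _ _ (\sum_(j <oo) (expR (- j%:R))%:E * x)).
  apply: lee_nneseries => j _ => [_|]; first by rewrite mule_ge0 ?expE_ge0.
  by rewrite lee_wpmul2l ?expE_ge0.
apply: series_le_scale x0 _ => [|j|]; [exact: geo_gt0|exact: expR_ge0|].
by have := @geo_sum R 1%R ltr01; under eq_eseriesr do rewrite mul1r.
Qed.

(** Before [n] the average of [F'] is at most that of [F]. From [n] on, [F'] is at most the constant
    [F n], and the sum of [wP k * w1 k] is geometric since 1/p1 > 0. *)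
Lemma normB_lower_part : exists2 C : R, (0 < C)%R & forall F F' n, nonneg F -> nonneg F' ->
  (forall k, F' k <= F k) -> (forall k, F' k <= F n) ->
  normB (avg F') <= Jop n (avg F) + C%:E * ((wP n * w1 n)%:E * F n).
Proof.
have rPw : reg k1 (fun k => wP k * w1 k)%R.
  by apply: eq_reg (regM reg_wP reg_w1) => //; rewrite add0r.
have [C1 C10 H1] := reg_sum_above k1_gt0 rPw.
have g1 : (0 < geo 1 :> R)%R by apply: geo_gt0.
exists (C1 * geo 1)%R => [|F F' n F0 F'0 F'F F'n]; first by rewrite mulr_gt0.
have A0 := avg_ge0 F0; have A'0 := avg_ge0 F'0.
have w1g0 := wt_ge0 reg_w1 A0; have w1g'0 := wt_ge0 reg_w1 A'0.
have AA k : avg F' k <= avg F k.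
  apply: lee_nneseries => j _ => [_|]; first by rewrite mule_ge0 ?expE_ge0.
  by rewrite lee_wpmul2l ?expE_ge0.
pose X := (geo 1)%:E * F n.
have X0 : 0 <= X by rewrite mule_ge0 // lee_fin ltW.
have y0 : nonneg (above n (wt w1 (fun=> X))).
  by apply: above_ge0; apply: wt_ge0 reg_w1 _ => k.
have Pw0 k : (0 <= wP k * w1 k)%R by rewrite mulr_ge0 ?(reg_ge0 _ reg_wP) ?(reg_ge0 _ reg_w1).
apply: (@sn_add_le _ _ hn1 _ (tsup (below n (wt w1 (avg F)))) (tsup (above n (wt w1 (fun=> X)))));
  [exact: tsup_ge0|exact/tsup_ge0/below_ge0|exact: tsup_ge0| |exact: lexx|].
  move=> m; apply: tsup_le => k mk.
  apply: (@le_trans _ _ (below n (wt w1 (avg F)) k + above n (wt w1 (fun=> X)) k)); last first.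
    by apply: leeD; exact: le_tsup.
  rewrite /below /above; case: ltnP => nk.
    rewrite adde0 /wt; apply: lee_wpmul2l => //.
    by rewrite lee_fin (reg_ge0 _ reg_w1).
  rewrite add0e /wt; apply: lee_wpmul2l; first by rewrite lee_fin (reg_ge0 _ reg_w1).
  exact: avg_le_const.
apply: (le_trans (tsup_norm_le y0)).
have E k : (wP k)%:E * above n (wt w1 (fun=> X)) k = above n (fun k => (wP k * w1 k)%:E * X) k.
  rewrite /above; case: ifP => _; last by rewrite mule0.
  by rewrite /wt muleA -EFinM.
under eq_eseriesr do rewrite E.
rewrite series_above; last by move=> k; rewrite mule_ge0 // lee_fin.
have -> : (C1 * geo 1)%:E * ((wP n * w1 n)%:E * F n) = (C1 * (wP n * w1 n))%:E * X.
  by rewrite /X !muleA -!EFinM; congr (_%:E * _); ring.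
by apply: series_le_scale (H1 n) => //; rewrite mulr_gt0 // (reg_gt0 _ rPw).
Qed.

(** Needed at theta = 0, where the outer weight provides no decay. The [j]-th term of the average is
    the operator applied to [F], moved by [j.+1], with the factor exp(- j) against exp(k0 j). Half
    of the surplus (1 - k0) j pays for moving [a]; the other half is summed. *)
Lemma Iop_avg_le : exists2 C : R, (0 < C)%R & forall F n, nonneg F ->
  {homo F : i j / (i <= j)%N >-> i <= j} ->
  Iop n (avg F) <= C%:E * Iop n.+1 F.
Proof.
pose c := ((1 - k0) / 2)%R; have c0 : (0 < c)%R by rewrite divr_gt0 // subr_gt0.
have [C C0 H] := reg_growth c0 ha.
(* The shift is by [j.+1] and not [j], in order to reach [Iop n.+1]; the additional unit costs exp(c
   + k0). *)
pose K := (C * expR (c + k0))%R; have K0 : (0 < K)%R by rewrite mulr_gt0 // expR_gt0.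
exists (geo c * K)%R => [|F n F0 Fnd]; first by rewrite mulr_gt0 // geo_gt0.
have f0 := wt_ge0 reg_w0 F0.
have A0 := avg_ge0 F0; have g0 := wt_ge0 reg_w0 A0.
pose U m := (a m)%:E * psum (above n.+1 (wt w0 F)) m.
have U0 : nonneg U by apply/Iop_arg_ge0/above_ge0.
have KU0 j : nonneg (fun m => K%:E * U (m + j.+1)%N).
  by move=> m; rewrite mule_ge0 // lee_fin ltW.
rewrite EFinM -muleA.
apply: le_trans (sn_conv hn0 c0 KU0 (x := K%:E * Iop n.+1 F) _); last first.
  move=> j; rewrite (sn_scale hn0 (ltW K0) (fun m => U0 (m + j.+1)%N)).
  apply: lee_wpmul2l; first by rewrite lee_fin ltW.
  exact: (sn_shift hn0 j.+1 U0).
apply: (sn_mono hn0) => [|m|m].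
- exact/Iop_arg_ge0/above_ge0.
- by apply: nneseries_ge0 => j _ _; rewrite mule_ge0 ?expE_ge0 ?KU0.
(* Exchanging the sum over [k] with the series of the average isolates one shifted copy of the
   operator for each [j]. *)
have -> : psum (above n (wt w0 (avg F))) m =
    \sum_(j <oo) (expR (- j%:R))%:E *
      (\sum_(k < m) if (n <= k)%N then (w0 k)%:E * F (k + j)%N else 0).
  have z0 j k : 0 <= (if (n <= k)%N then (w0 k)%:E * F (k + j)%N else 0).
    by case: ifP => // _; rewrite mule_ge0 // lee_fin (reg_ge0 _ reg_w0).
  under [RHS]eq_eseriesr do rewrite ge0_sume_distrr //.
  rewrite nneseries_sum => [|i j _]; last by rewrite mule_ge0 ?expE_ge0.
  rewrite /psum; apply: eq_bigr => k _; rewrite /above; case: ifP => nk; last first.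
    by rewrite eseries0 // => i _ _; rewrite mule0.
  rewrite /wt /avg -nneseriesZl => [|i _]; last by rewrite mule_ge0 ?expE_ge0.
  by apply: eq_eseriesr => i _; rewrite muleCA.
rewrite -nneseriesZl => [|j _]; last first.
  rewrite mule_ge0 ?expE_ge0 // sume_ge0 // => k _; case: ifP => // _.
  by rewrite mule_ge0 // lee_fin (reg_ge0 _ reg_w0).
apply: lee_nneseries => j _ => [_|].
  rewrite !mule_ge0 ?expE_ge0 // sume_ge0 // => k _; case: ifP => // _.
  by rewrite mule_ge0 // lee_fin (reg_ge0 _ reg_w0).
apply: (@le_trans _ _ ((C * expR (c * j.+1%:R))%:E * (a (m + j.+1)%N)%:E *
   ((expR (- j%:R))%:E * ((expR (k0 * j.+1%:R))%:E * psum (above n.+1 (wt w0 F)) (m + j.+1)%N)))).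
  apply: lee_pmul => //.
  - rewrite mule_ge0 ?expE_ge0 // sume_ge0 // => k _; case: ifP => // _.
    by rewrite mule_ge0 // lee_fin (reg_ge0 _ reg_w0).
  - by rewrite -EFinM lee_fin H.
  apply: lee_wpmul2l; first exact: expE_ge0.
  apply: (@le_trans _ _ ((expR (k0 * j.+1%:R))%:E *
      psum (fun k => above n.+1 (wt w0 F) (k + j.+1)%N) m)); last first.
    by apply: lee_wpmul2l; [exact: expE_ge0|apply/psum_shift/above_ge0].
  rewrite /psum ge0_sume_distrr => [|k _]; last exact: above_ge0.
  apply: lee_sum => k _; case: ifP => nk; last first.
    by rewrite mule_ge0 ?expE_ge0 //; exact: above_ge0.
  rewrite /above addnS ltnS (leq_trans nk (leq_addr _ _)) /wt muleA -EFinM.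
  rewrite /w0 -expRD.
  have -> : (k0 * j.+1%:R + - (k0 * (k + j).+1%:R) = - (k0 * k%:R))%R.
    by rewrite -!natr1 natrD; ring.
  apply: lee_wpmul2l; first exact: expE_ge0.
  exact: Fnd.
rewrite /U !muleA -!EFinM le_eqVlt; apply/orP; left; apply/eqP.
congr (_%:E * _).
have -> : (C * expR (c * j.+1%:R) * a (m + j.+1) * expR (- j%:R) * expR (k0 * j.+1%:R) =
  C * a (m + j.+1) * (expR (c * j.+1%:R) * expR (- j%:R) * expR (k0 * j.+1%:R)))%R by ring.
rewrite -!expRD.
have -> : (c * j.+1%:R + - j%:R + k0 * j.+1%:R = - (c * j%:R) + (c + k0))%R.
  by rewrite -!natr1 /c; field.
by rewrite expRD /K; ring.
Qed.

(** The average at [k < n] is cut at [n]. The terms before [n] stay under the supremum defining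
    [Jop n F], with geometric factors. The rest is exp(k - n) times [avg F n]: after weighting it is
    bounded by a constant on a block of norm [wP n]. *)
Lemma Jop_avg_le : exists2 C : R, (0 < C)%R & forall F n, nonneg F ->
  Jop n (avg F) <= C%:E * (Jop n F + (wP n * w1 n)%:E * avg F n).
Proof.
have k1_lt1 : (k1 < 1)%R by exact: lt_trans k0_lt1.
pose c := ((1 - k1) / 2)%R; have c0 : (0 < c)%R by rewrite divr_gt0 // subr_gt0.
(* The exponent 1 - c is the midpoint of k1 and 1: above the index of [w1], and short by [c] of the
   decay exp(- j) of the average. *)
have [|C C0 H] := reg_growth (c := (1 - c)%R) _ reg_w1; first by rewrite /c; lra.
pose K := (C * geo c)%R; have K0 : (0 < K)%R by rewrite mulr_gt0 // geo_gt0.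
exists (K + C)%R => [|F n F0]; first by rewrite addr_gt0.
have f0 := wt_ge0 reg_w1 F0.
have A0 := avg_ge0 F0; have g0 := wt_ge0 reg_w1 A0.
have Pn0 : (0 <= wP n)%R by exact: (reg_ge0 _ reg_wP).
have w1n0 i : (0 <= w1 i)%R by exact: (reg_ge0 _ reg_w1).
have Z0 : 0 <= (wP n * w1 n)%:E * avg F n by rewrite mule_ge0 // lee_fin mulr_ge0.
have J0 := Jop_ge0 n F0.
apply: (@le_trans _ _ (K%:E * Jop n F + C%:E * ((wP n * w1 n)%:E * avg F n))); last first.
  rewrite EFinD ge0_muleDl ?lee_fin ?(ltW K0) ?(ltW C0) // !ge0_muleDr //.
  apply: leeD; first by rewrite leeDl // mule_ge0 // lee_fin ltW.
  by rewrite leeDr // mule_ge0 // lee_fin ltW.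
pose T m := tsup (below n (wt w1 F)) m.
have T0 : nonneg T by apply/tsup_ge0/below_ge0.
pose X := C%:E * ((w1 n)%:E * avg F n).
have X0 : 0 <= X by rewrite !mule_ge0 ?lee_fin // ltW.
apply: (sn_add_le hn1 (v := fun m => K%:E * T m) (w := fun m => X * (if (m < n.+1)%N then 1 else 0))).
- exact/tsup_ge0/below_ge0.
- by move=> m; rewrite mule_ge0 // lee_fin ltW.
- by move=> m; rewrite mule_ge0 //; case: ifP.
- move=> m; apply: tsup_le => k mk; rewrite {1}/below; case: ifP => kn; last first.
    apply: adde_ge0; apply: mule_ge0 => //; first by rewrite lee_fin ltW.
    by case: ifP.
  rewrite (ltn_trans mk (ltnW (kn : k.+1 < n.+1)%N)) mule1 /wt (avg_split k (n - k)) //.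
  rewrite ge0_muleDr ?sume_ge0 ?mule_ge0 ?expE_ge0 // => [|j _]; last by rewrite mule_ge0 ?expE_ge0.
  apply: leeD.
    rewrite ge0_sume_distrr => [|j _]; last by rewrite mule_ge0 ?expE_ge0.
    apply: (@le_trans _ _ (\sum_(j < n - k) (C * expR (- (c * j%:R)))%:E * T m)).
      apply: lee_sum => j _.
      have kjn : (k + j < n)%N by have := ltn_ord j; rewrite ltn_subRL.
      apply: (@le_trans _ _ ((C * expR (- (c * j%:R)))%:E * wt w1 F (k + j)%N)).
        rewrite /wt !muleA -!EFinM; apply: lee_wpM2r => //.
        rewrite mulrC; apply: le_trans (ler_wpM2l (expR_ge0 _) (H k j)) _.
        rewrite (_ : expR (- j%:R) * (C * expR ((1 - c) * j%:R) * w1 (k + j)) =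
          C * (expR (- j%:R) * expR ((1 - c) * j%:R)) * w1 (k + j))%R; last by ring.
        rewrite -expRD (_ : - j%:R + (1 - c) * j%:R = - (c * j%:R))%R //; last by ring.
      apply: lee_wpmul2l; first by rewrite lee_fin mulr_ge0 ?expR_ge0 // ltW.
      have := le_tsup (below n (wt w1 F)) (ltn_addr j mk).
      by rewrite {1}/below kjn.
    rewrite -ge0_sume_distrl => [|j _]; last by rewrite lee_fin mulr_ge0 ?expR_ge0 // ltW.
    rewrite sumEFin -mulr_sumr; apply: lee_wpM2r => //.
    by rewrite ler_pM2l // geo_partial.
  rewrite subnKC ?(ltnW kn) // /X !muleA -!EFinM; apply: lee_wpM2r => //.
  have := H k (n - k)%N; rewrite subnKC ?(ltnW kn) // => h.
  rewrite mulrC; apply: le_trans (ler_wpM2l (expR_ge0 _) h) _.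
  rewrite (_ : expR (- (n - k)%:R) * (C * expR ((1 - c) * (n - k)%:R) * w1 n) =
     (expR (- (n - k)%:R) * expR ((1 - c) * (n - k)%:R)) * (C * w1 n))%R; last by ring.
  rewrite -expRD (_ : - (n - k)%:R + (1 - c) * (n - k)%:R = - (c * (n - k)%:R))%R; last by ring.
  apply: ler_piMl; first by rewrite mulr_ge0 // ltW.
  by rewrite expR_le1 oppr_le0 mulr_ge0 // ltW.
- by rewrite (sn_scale hn1) // ltW.
- rewrite (sn_scalee hn1) // => [|m]; last by case: ifP.
  rewrite -/(initnorm nu1 n.+1) wP_E /X muleC !muleA -!EFinM.
  by rewrite (_ : wP n * C * w1 n = C * (wP n * w1 n))%R //; ring.
Qed.

Variable nu : (nat -> \bar R) -> \bar R.
Hypothesis hn : seq_norm nu.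

(** Hardy's inequality for the average: an index below 1 lets exp(- j) win over the change of the
    weight from [n] to [n + j]. *)
Lemma norm_avg_le k w : (k < 1)%R -> reg k w -> exists2 C : R, (0 < C)%R &
  forall F, nonneg F -> nu (wt w (avg F)) <= C%:E * nu (wt w F).
Proof.
move=> k_lt1 rw; pose c := ((1 - k) / 2)%R; have c0 : (0 < c)%R by rewrite divr_gt0 // subr_gt0.
have [|C C0 H] := reg_growth (c := (1 - c)%R) _ rw; first by rewrite /c; lra.
exists (geo c * C)%R => [|F F0]; first by rewrite mulr_gt0 // geo_gt0.
have f0 := wt_ge0 rw F0; have g0 := wt_ge0 rw (avg_ge0 F0).
rewrite EFinM -muleA -(sn_scale hn) ?(ltW C0) //.
apply: (sn_conv_fwd hn c0) => // [n|n]; first by rewrite mule_ge0 // lee_fin ltW.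
rewrite {1}/wt /avg -nneseriesZl => [|j _]; last by rewrite mule_ge0 ?expE_ge0.
apply: lee_nneseries => j _ => [_|].
  by rewrite !mule_ge0 ?expE_ge0 // lee_fin (reg_ge0 _ rw).
rewrite /wt !muleA -!EFinM; apply: lee_wpM2r => //.
rewrite mulrC; apply: le_trans (ler_wpM2l (expR_ge0 _) (H n j)) _.
rewrite (_ : expR (- j%:R) * (C * expR ((1 - c) * j%:R) * w (n + j)) =
  (expR (- j%:R) * expR ((1 - c) * j%:R)) * C * w (n + j))%R; last by ring.
by rewrite -expRD (_ : - j%:R + (1 - c) * j%:R = - (c * j%:R))%R //; ring.
Qed.

(** Moving [w] from [n] to [n + j] gains exp(- c j) when its index is negative, so the series
    bounding [Iop] becomes a convolution. In [norm_Jop_le] a positive index does the same for the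
    indices before [n]. *)
Lemma norm_Iop_le k w : (k < 0)%R -> reg k w -> exists2 C : R, (0 < C)%R &
  forall G, nonneg G -> nu (wt w (Iop ^~ G)) <= C%:E * nu (wt (fun n => w n * wA n * w0 n)%R G).
Proof.
move=> k_lt0 rw; pose c := (- k / 2)%R; have c0 : (0 < c)%R by rewrite divr_gt0 // oppr_gt0.
have [|C C0 H] := reg_growth (c := (- c)%R) _ rw; first by rewrite /c; lra.
exists (geo c * C)%R => [|G G0]; first by rewrite mulr_gt0 // geo_gt0.
have I0 : nonneg (Iop ^~ G) by move=> n; exact: Iop_ge0.
have v0 : nonneg (wt (fun n => w n * wA n * w0 n)%R G).
  by apply: wt_ge0 (regM (regM rw reg_wA) reg_w0) _.
have Aw0 i : (0 <= wA i * w0 i)%R by rewrite mulr_ge0 ?(reg_ge0 _ reg_wA) ?(reg_ge0 _ reg_w0).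
rewrite EFinM -muleA -(sn_scale hn) ?(ltW C0) //.
apply: (sn_conv_fwd hn c0) => // [||n]; [exact: wt_ge0 rw _|by move=> n; rewrite mule_ge0 // lee_fin ltW|].
rewrite {1}/wt; apply: (@le_trans _ _ ((w n)%:E * \sum_(j <oo) (wA (n + j)%N * w0 (n + j)%N)%:E * G (n + j)%N)).
  by apply: lee_wpmul2l; [rewrite lee_fin (reg_ge0 _ rw)|exact: Iop_le_series].
rewrite -nneseriesZl => [|j _]; last by rewrite mule_ge0 // lee_fin.
apply: lee_nneseries => j _ => [_|].
  by rewrite !mule_ge0 ?lee_fin ?(reg_ge0 _ rw).
rewrite /wt !muleA -!EFinM; apply: lee_wpM2r => //.
have := ler_wpM2r (Aw0 (n + j)%N) (H n j); rewrite !mulNr.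
by move=> h; apply: (le_trans h); rewrite le_eqVlt; apply/orP; left; apply/eqP; ring.
Qed.

Lemma norm_Jop_le k w : (0 < k)%R -> reg k w -> exists2 C : R, (0 < C)%R &
  forall G, nonneg G -> nu (wt w (Jop ^~ G)) <= C%:E * nu (wt (fun n => w n * wP n * w1 n)%R G).
Proof.
move=> k_gt0 rw; pose c := (k / 2)%R; have c0 : (0 < c)%R by rewrite divr_gt0.
have [|C C0 H] := reg_decay (c := c) _ rw; first by rewrite /c; lra.
exists (geo c * C)%R => [|G G0]; first by rewrite mulr_gt0 // geo_gt0.
have J0 : nonneg (Jop ^~ G) by move=> n; exact: Jop_ge0.
have v0 : nonneg (wt (fun n => w n * wP n * w1 n)%R G).
  by apply: wt_ge0 (regM (regM rw reg_wP) reg_w1) _.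
have Pw0 i : (0 <= wP i * w1 i)%R by rewrite mulr_ge0 ?(reg_ge0 _ reg_wP) ?(reg_ge0 _ reg_w1).
pose V n := C%:E * wt (fun n => w n * wP n * w1 n)%R G n.
have V0 : nonneg V by move=> n; rewrite mule_ge0 // lee_fin ltW.
rewrite EFinM -muleA -(sn_scale hn) ?(ltW C0) //.
apply: (sn_conv_bwd hn c0 _ V0) => [|n]; first exact: wt_ge0 rw _.
rewrite {1}/wt; apply: (@le_trans _ _ ((w n)%:E * \sum_(i < n) (wP i * w1 i)%:E * G i)).
  by apply: lee_wpmul2l; [rewrite lee_fin (reg_ge0 _ rw)|exact: Jop_le_sum].
rewrite ge0_sume_distrr => [|j _]; last by rewrite mule_ge0 // lee_fin.
have t0 j : 0 <= (expR (- (c * j%:R)))%:E * (if (j <= n)%N then V (n - j)%N else 0).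
  by rewrite mule_ge0 ?expE_ge0 //; case: ifP.
(* The indices i < n are n - j with 1 <= j <= n: the series is cut after [n.+1] terms and its term j
   = 0 is discarded. *)
apply: le_trans (nneseries_lim_ge (m := 0) n.+1 (fun j _ _ => t0 j)).
rewrite big_mkord big_ord_recl; apply: le_trans (leeDr _ (t0 0%N)).
rewrite (reindex_inj rev_ord_inj) /=; apply: lee_sum => i _.
rewrite /bump leq0n add1n ltn_ord /V /wt !muleA -!EFinM; apply: lee_wpM2r => //.
have := ler_wpM2r (Pw0 (n - i.+1)%N) (H (n - i.+1)%N i.+1).
rewrite subnK ?ltn_ord //.
by move=> h; apply: (le_trans h); rewrite le_eqVlt; apply/orP; left; apply/eqP; ring.
Qed.

End discrete_inequalities.

(** * Discretisation of rearrangement invariant norms *)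

Section integral_facts.
Local Open Scope ereal_scope.
Variable R : realType.
Local Notation mu := (@lebesgue_measure R).

(* No measurability is required: the integral of a nonnegative function is a
   supremum over the simple functions below it. *)
Lemma le_integral_patch (A B : set R) (f g : R -> \bar R) :
  (forall x, A x -> 0 <= f x) -> (forall x, B x -> 0 <= g x) ->
  (forall x, (f \_ A) x <= (g \_ B) x) ->
  \int[mu]_(x in A) f x <= \int[mu]_(x in B) g x.
Proof.
move=> f0 g0 fg; rewrite integral_mkcond [leRHS]integral_mkcond.
rewrite !ge0_integralTE; last 2 first.
- by move=> x; exact: erestrict_ge0.
- by move=> x; exact: erestrict_ge0.
apply: ereal_sup_le => _ [h hf <-]; exists h => // x.
exact: le_trans (hf x) (fg x).
Qed.

Lemma dtt_le (A B : set R) : B `<=` `]0%R, +oo[ -> A `<=` B -> dtt A <= dtt B.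
Proof.
move=> B0 AB; have p x : B x -> (0 : \bar R) <= (x^-1)%:E.
  by move=> /B0 /=; rewrite in_itv /= andbT lee_fin invr_ge0 => /ltW.
apply: le_integral_patch => [x /AB /p|x /p|x] //.
rewrite !patchE; case: ifPn => xA; first by rewrite mem_set //; apply: AB; rewrite inE in xA.
by case: ifPn => // xB; apply: p; rewrite inE in xB.
Qed.

Lemma dtt_itv (n : nat) b0 b1 :
  dtt [set` Interval (BSide b0 (expR (- n.+1%:R))) (BSide b1 (expR (- n%:R)))] = 1 :> \bar R.
Proof.
have ab : (expR (- n.+1%:R) < expR (- n%:R) :> R)%R by rewrite ltr_expR ltrN2 ltr_nat.
have a0 : (0 < expR (- n.+1%:R) :> R)%R := expR_gt0 _.
have mi : measurable_fun `]expR (- n.+1%:R), expR (- n%:R)[%classic (fun x : R => (x^-1)%:E).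
  apply/measurable_EFinP; apply: open_continuous_measurable_fun => [|x].
    exact: interval_open.
  rewrite inE /= in_itv /= => /andP[ax _].
  by apply: inv_continuous; rewrite gt_eqF // (lt_trans a0 ax).
rewrite /dtt integral_itv_bndoo // -(@integral_itv_bndoo _ _ _ _ true false) //.
rewrite (@continuous_FTC2 R (fun x => x^-1)%R (@ln R)) //.
- by rewrite !expRK -EFinB opprK addrC -natr1; congr EFin; ring.
- apply: continuous_in_subspaceT => x; rewrite inE /= in_itv /= => /andP[ax _].
  by apply: inv_continuous; rewrite gt_eqF // (lt_le_trans a0 ax).
- split.
  + move=> x; rewrite in_itv /= => /andP[ax _].
    by apply: ex_derive; exact: is_derive1_ln (lt_trans a0 ax).
  + exact/cvg_at_right_filter/continuous_ln.
  + apply/cvg_at_left_filter/continuous_ln; exact: lt_trans ab.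
- move=> x; rewrite in_itv /= => /andP[ax _]; rewrite derive1E.
  by have h := is_derive1_ln (lt_trans a0 ax); rewrite derive_val.
Qed.

(** Preimages of upper rays are intervals. Hence every rearrangement is admissible in the axioms of
    r.i. spaces, even that of a nonmeasurable function. *)
Lemma nonincreasing_emeasurable (D : set R) (h : R -> \bar R) : measurable D ->
  (forall x y, (x <= y)%R -> h y <= h x) -> measurable_fun D h.
Proof.
move=> mD h_ni; apply: (measurability _ (ErealGenOInfty.measurableE R)) => //.
move=> _ [_ [r ->] <-]; apply: measurableI => //; apply: is_interval_measurable.
move=> s t /=; rewrite !in_itv /= !andbT => _ ht u /andP[_ ut].
by rewrite in_itv /= andbT (lt_le_trans ht) // h_ni.
Qed.

(** Layer cake formula, by Tonelli for the indicator of the subgraph. It shows that the norm of L_1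
    depends only on the distribution function. *)
Lemma integral_layers (f : R -> \bar R) : Mplus f ->
  \int[mu]_(x in `]0%R, +oo[) f x =
  \int[mu]_(l in `]0%R, +oo[) mu [set x | (0 < x)%R /\ l%:E < f x].
Proof.
move=> [mf f0]; pose D := (`]0%R, +oo[ : set R)%classic.
have mD : measurable D by exact: measurable_itv.
pose g : R -> \bar R := f \_ D.
have mg : measurable_fun setT g by apply/(measurable_restrictT _ _).1.
have g0 x : 0 <= g x.
  by apply: erestrict_ge0 => y; rewrite /D /= in_itv /= andbT => /f0.
pose P := [set p : R * R | (p.2%:E < g p.1) /\ (0 < p.2)%R].
have mP : measurable P.
  apply: measurableI.
    rewrite -[X in measurable X]setTI; apply: measurable_lte => //.
      by apply/measurable_EFinP; exact: measurable_snd.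
    exact: measurableT_comp mg (@measurable_fst _ _ _ _).
  rewrite [X in measurable X](_ : _ = snd @^-1` D).
    by rewrite -[X in measurable X]setTI; exact: measurable_snd.
  by apply/seteqP; split => p; rewrite /D /= in_itv /= andbT.
pose H (p : R * R) := (\1_P p)%:E : \bar R.
have mH : measurable_fun setT H by exact/measurable_EFinP/measurable_indic.
have H0 p : 0 <= H p by rewrite lee_fin.
have := @fubini_tonelli _ _ _ _ R mu mu H mH H0.
have -> : \int[mu]_x \int[mu]_y H (x, y) = \int[mu]_(x in D) f x.
  rewrite [RHS]integral_mkcond; apply: eq_integral => x _.
  have -> : (fun y => H (x, y)) = (fun y : R => (\1_[set y' : R | (y'%:E < g x)%E /\ (0 < y')%R] y)%:E).
    by apply/funext => y; rewrite /H !indicE; congr ((_ : nat)%:R%:E); apply/idP/idP; rewrite !inE.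
  rewrite integral_indic // ?setIT; last first.
    rewrite (_ : [set y : R | _] = D `&` [set y | y%:E < g x]); last first.
      by apply/seteqP; split=> y; rewrite /D /= in_itv /= andbT; tauto.
    by apply: emeasurable_fun_infty_o => //; exact: EFin_measurable.
  rewrite -/(g x); case E : (g x) => [r||].
  - rewrite (_ : [set y : R | _] = `]0%R, r[%classic); last first.
      by apply/seteqP; split=> y /=; rewrite in_itv /= lte_fin; [move=> [-> ->]|move=> /andP[-> ->]].
    transitivity (mu `]0%R, r[%classic); first by [].
    rewrite lebesgue_measure_itv /= lte_fin; case: ltP => r0; first by rewrite oppr0 adde0.
    have := g0 x; rewrite E lee_fin => r1.
    by congr EFin; apply/eqP; rewrite eq_le r0 r1.
  - rewrite (_ : [set y : R | _] = D); last first.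
      by apply/seteqP; split=> y; rewrite /D /= in_itv /= andbT ltry; [case|].
    transitivity (mu `]0%R, +oo[%classic); first by [].
    by rewrite lebesgue_measure_itv /= ltry.
  - by have := g0 x; rewrite E.
move=> ->; rewrite [RHS]integral_mkcond; apply: eq_integral => l _.
have -> : (fun x => H (x, l)) = (fun x : R => (\1_[set x' : R | (l%:E < g x')%E /\ (0 < l)%R] x)%:E).
  by apply/funext => y; rewrite /H !indicE; congr ((_ : nat)%:R%:E); apply/idP/idP; rewrite !inE.
rewrite integral_indic // ?setIT; last first.
  rewrite (_ : [set x : R | _] = (fun x => (x, l)) @^-1` P) //.
  by rewrite -[X in measurable X]setTI; exact: pair2_measurable.
rewrite patchE; case: ifPn => lD.
  have l0 : (0 < l)%R by move: lD; rewrite inE /= in_itv /= andbT.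
  congr (mu _); apply/seteqP; split => x /= => [[+ _]|[x0 xl]].
    rewrite /g patchE; case: ifPn => xD; last by rewrite lte_fin ltNge (ltW l0).
    by move=> ?; split=> //; move: xD; rewrite inE /D /= in_itv /= andbT.
  by split=> //; rewrite /g patchE ifT // inE /D /= in_itv /= andbT.
have l0 : ~~ (0 < l)%R.
  by apply: contra lD => l0; rewrite inE /= in_itv /= andbT.
by rewrite (_ : [set x : R | _] = set0) ?measure0 //; apply/seteqP; split => x //= -[_]; rewrite (negbTE l0).
Qed.

(** The sets h > l + 1/(k + 1) increase to the set h > l. This is the right continuity required by
    [rearr_gt]. *)
Lemma measure_right_continuous (D : set R) (h : R -> \bar R) (l : R) (s : \bar R) :
  measurable D -> measurable_fun D h ->
  s < mu (D `&` [set x | l%:E < h x]) ->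
  exists2 l', (l < l')%R & s < mu (D `&` [set x | l'%:E < h x]).
Proof.
move=> mD mh sl.
pose F (k : nat) := D `&` [set x | (l + k.+1%:R^-1)%:E < h x].
have mF k : measurable (F k) by exact: emeasurable_fun_o_infty.
have FE : \bigcup_k F k = D `&` [set x | l%:E < h x].
  apply/seteqP; split => x /=.
    move=> [k _ [Dx /=]] lt; split=> //; apply: lt_trans lt.
    by rewrite lte_fin ltrDl invr_gt0.
  move=> [Dx]; case E : (h x) => [r||//] lt.
    move: lt; rewrite lte_fin => /ltr_add_invr[k hk].
    by exists k => //; split => //=; rewrite E lte_fin.
  by exists 0%N => //; split => //=; rewrite E ltry.
have ndF : nondecreasing_seq F.
  move=> i j ij; rewrite subsetEset => x [Dx /= lt]; split=> //=.
  apply: le_lt_trans lt; rewrite lee_fin lerD2l lef_pV2 ?posrE ?ltr0n //.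
  by rewrite ler_nat ltnS.
have mU : measurable (\bigcup_k F k) by exact: bigcupT_measurable.
have cv := @nondecreasing_cvg_mu _ _ _ mu F mF mU ndF.
have nd : nondecreasing_seq (mu \o F).
  move=> i j ij; have hF : F i `<=` F j by have := ndF i j ij; rewrite subsetEset.
  exact: (le_measure mu (mem_set (mF i)) (mem_set (mF j)) hF).
have := ereal_nondecreasing_cvgn nd => cv2.
have E : mu (\bigcup_k F k) = ereal_sup (range (mu \o F)).
  exact: (cvg_unique _ cv cv2).
move: sl; rewrite -FE E => /ereal_sup_gt[_ [k _ <-] sk].
by exists (l + k.+1%:R^-1)%R; rewrite ?ltrDl ?invr_gt0.
Qed.

End integral_facts.

(** * Rearrangements and step functions on the cells *)

Section rearrangements.
Local Open Scope ereal_scope.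
Variable R : realType.
Local Notation mu := (@lebesgue_measure R).
Implicit Types (v : nat -> \bar R) (g h : R -> \bar R) (I J : set R).

Lemma rearr_ge0 m (D : set R) g s : 0 <= rearr m D g s.
Proof. by apply: le_ereal_inf_tmp => _ [l [l0 _] <-]; rewrite lee_fin. Qed.

Lemma rearr_ni m (D : set R) g s t : (s <= t)%R -> rearr m D g t <= rearr m D g s.
Proof.
move=> st; apply: ereal_inf_le_tmp => _ [l [l0 hl] <-]; exists l => //; split=> //.
by apply: (le_trans hl); rewrite lee_fin.
Qed.

Lemma Mplus_rearr m (D : set R) g : Mplus (rearr m D g).
Proof.
split=> [|x _]; last exact: rearr_ge0.
apply: nonincreasing_emeasurable; first exact: measurable_itv.
exact: rearr_ni.
Qed.

(* The generalised inverse relation, for a right continuous distribution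
   function. *)
Lemma rearr_gt (m : set R -> \bar R) (D : set R) g (l s : R) : (0 <= l)%R ->
  (forall x y : R, (x <= y)%R -> m (D `&` [set t | y%:E < `|g t|]) <=
                                m (D `&` [set t | x%:E < `|g t|])) ->
  (s%:E < m (D `&` [set t | l%:E < `|g t|]) ->
   exists2 l', (l < l')%R & s%:E < m (D `&` [set t | l'%:E < `|g t|])) ->
  (l%:E < rearr m D g s) = (s%:E < m (D `&` [set t | l%:E < `|g t|])).
Proof.
move=> l0 mono rc; apply/idP/idP.
  apply: contraTT; rewrite -!leNgt => h; apply: ereal_inf_lbound.
  by exists l.
move=> /rc[l' ll' sl']; apply: (@lt_le_trans _ _ l'%:E); first by rewrite lte_fin.
apply: le_ereal_inf_tmp => _ [x [x0 hx] <-]; rewrite lee_fin leNgt.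
apply/negP => /ltW xl'; have := mono _ _ xl'.
by move=> /le_trans /(_ hx); rewrite leNgt sl'.
Qed.

(** [emono] and [eequi] isolate what the squeeze by step functions uses, so that it applies to L_1
    and L_oo as well without the full list of axioms. *)
Definition emono (E : function_norm R) := forall f g, Mplus f -> Mplus g ->
  (forall x, (0 < x)%R -> f x <= g x) -> E f <= E g.

Definition eequi (E : function_norm R) := forall f g, Mplus f -> Mplus g ->
  (forall l : R, (0 <= l)%R -> mu [set x : R | (0 < x)%R /\ l%:E < f x] =
                               mu [set x : R | (0 < x)%R /\ l%:E < g x]) ->
  E f = E g.

Lemma tnorm_le E I J g h : emono E ->
  (forall t, (0 < t)%R -> `|(g \_ I) t| <= `|(h \_ J) t|) ->
  tnorm E I g <= tnorm E J h.
Proof.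
move=> mE gh; apply: mE => [||s s0]; [exact: Mplus_rearr..|].
apply: ereal_inf_le_tmp => _ [l [l0 hl] <-]; exists l => //; split=> //.
apply: le_trans hl; apply: dtt_le; first by move=> x [].
move=> t [t0 /= lt]; split=> //=; apply: (lt_le_trans lt); apply: gh.
by move: t0; rewrite /= in_itv /= andbT.
Qed.

(* The cells [e^-(n+1) < t <= e^-n] of (0, 1) have measure 1 for [dt / t]. *)
Definition tindex (t : R) : nat := Num.truncn (- ln t).

(** The sequence is spread over the intervals [n, n + 1[ of Lebesgue measure 1, the counterpart of
    the cells of (0, 1) for dt/t. *)
Definition nu (E : function_norm R) v := E (fun x => v (Num.truncn x)).

Lemma tindex_itv t : (0 < t < 1)%R ->
  (expR (- (tindex t).+1%:R) < t <= expR (- (tindex t)%:R))%R.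
Proof.
move=> /andP[t0 t1]; have l0 : (0 <= - ln t)%R by rewrite oppr_ge0 ln_le0 // ltW.
have /andP[a b] := truncn_itv l0.
rewrite -[X in (_ < X <= _)%R]lnK ?posrE // ltr_expR ler_expR.
by rewrite /tindex; lra.
Qed.

Lemma tindexE (n : nat) t : (expR (- n.+1%:R) < t <= expR (- n%:R))%R -> tindex t = n.
Proof.
move=> /andP[a b]; have t0 : (0 < t)%R by apply: lt_trans a; exact: expR_gt0.
move: a b; rewrite -{1 2}(lnK (t0 : t \is Num.pos)) ltr_expR ler_expR => a b.
by apply: truncn_def; lra.
Qed.

Definition tcell (n : nat) := [set t : R | (0 < t < 1)%R /\ tindex t = n].
Definition xcell (n : nat) := [set x : R | (0 < x)%R /\ Num.truncn x = n].

Lemma tcellE n : tcell n =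
  `]0%R, 1%R[ `&` `]expR (- n.+1%:R), expR (- n%:R)]%classic.
Proof.
apply/seteqP; split=> t /=; rewrite !in_itv /=.
  by move=> [t01 tn]; split=> //; rewrite -tn; exact: tindex_itv.
by move=> [t01 h]; split=> //; exact: tindexE.
Qed.

Lemma xcellE n : xcell n = `]0%R, +oo[ `&` `[n%:R, n.+1%:R[%classic.
Proof.
apply/seteqP; split=> t /=; rewrite !in_itv /= andbT.
  by move=> [t0 <-]; split=> //; apply: truncn_itv; exact: ltW.
by move=> [t0 h]; split=> //; exact: truncn_def.
Qed.

Lemma measurable_tcell n : measurable (tcell n).
Proof. by rewrite tcellE; apply: measurableI; exact: measurable_itv. Qed.

Lemma measurable_xcell n : measurable (xcell n).
Proof. by rewrite xcellE; apply: measurableI; exact: measurable_itv. Qed.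

Lemma expRNn_le1 (n : nat) : (expR (- n%:R) <= 1 :> R)%R.
Proof. by rewrite expR_le1 oppr_le0. Qed.

Lemma open_sub_tcell n :
  `]expR (- n.+1%:R), expR (- n%:R)[%classic `<=` (tcell n : set R).
Proof.
move=> t /=; rewrite in_itv /= => /andP[a b]; rewrite tcellE; split; last first.
  by rewrite /= in_itv /= a ltW.
rewrite /= in_itv /= (lt_trans (expR_gt0 _) a) /=.
exact: lt_le_trans b (expRNn_le1 n).
Qed.

Lemma dtt_tcell n : dtt (tcell n) = 1.
Proof.
apply/eqP; rewrite eq_le; apply/andP; split.
  rewrite -(@dtt_itv R n false false); apply: dtt_le => t.
    by rewrite /= !in_itv /= andbT => /andP[a _]; exact: lt_trans (expR_gt0 _) a.
  by rewrite tcellE => -[_].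
rewrite -(@dtt_itv R n false true); apply: dtt_le; last exact: open_sub_tcell.
by rewrite tcellE => t [+ _]; rewrite /= !in_itv /= andbT => /andP[].
Qed.

Lemma mu_xcell n : mu (xcell n) = 1.
Proof.
have E b : mu [set` Interval (BSide b (n%:R : R)) (BSide true n.+1%:R)] = 1.
  rewrite lebesgue_measure_itv /= lte_fin ltr_nat ltnSn -EFinB -natr1.
  by congr EFin; ring.
have mx := @measurable_xcell n.
apply/eqP; rewrite eq_le; apply/andP; split.
  rewrite -(E true); apply: le_measure; rewrite ?inE //.
  by rewrite xcellE => t [].
rewrite -(E false); apply: le_measure; rewrite ?inE //.
rewrite xcellE => t /=; rewrite !in_itv /= andbT => /andP[a b]; split.
  exact: le_lt_trans a.
by rewrite ltW.
Qed.

(** The common value of both measures on the union of the cells selected by [P]. *)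
Definition count (P : pred nat) : \bar R := \sum_(n <oo | P n) 1.

Lemma bigcup_index (D : set R) (ix : R -> nat) (P : pred nat) :
  [set x | D x /\ P (ix x)] = \bigcup_(n in [set n | P n]) [set x | D x /\ ix x = n].
Proof.
apply/seteqP; split=> x /= => [[Dx Px]|]; first by exists (ix x).
by move=> [n Pn [Dx e]]; split=> //; rewrite e.
Qed.

Lemma trivIset_index (D : set R) (ix : R -> nat) (P : set nat) :
  trivIset P (fun n => [set x | D x /\ ix x = n]).
Proof. by move=> i j _ _ [x [[_ <-] [_ <-]]]. Qed.

Lemma mu_count (P : pred nat) : mu [set x | (0 < x)%R /\ P (Num.truncn x)] = count P.
Proof.
rewrite (bigcup_index (fun x => (0 < x)%R)) measure_bigcup /=; last 2 first.
- by move=> n _; exact: measurable_xcell.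
- exact: (@trivIset_index (fun x => (0 < x)%R)).
rewrite /count [LHS]eseries_mkcond [RHS]eseries_mkcond; apply: eq_eseriesr => n _.
rewrite (_ : (n \in _) = P n); last by apply/idP/idP; rewrite inE.
by case: ifP => // _; exact: mu_xcell.
Qed.

Lemma dtt_count (P : pred nat) : dtt [set x | (0 < x < 1)%R /\ P (tindex x)] = count P.
Proof.
pose F n : set R := if P n then tcell n else set0.
have UE : [set x | (0 < x < 1)%R /\ P (tindex x)] = \bigcup_n F n.
  apply/seteqP; split=> x /=.
    by move=> [x01 Px]; exists (tindex x) => //; rewrite /F Px.
  by move=> [n _]; rewrite /F; case: ifP => // Pn [x01 e]; split=> //; rewrite e.
have mF n : measurable (F n).
  by rewrite /F; case: ifP => _; [exact: measurable_tcell|].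
have F01 n : F n `<=` `]0%R, 1%R[.
  by rewrite /F; case: ifP => _ t; [rewrite tcellE => -[]|].
have mi : measurable_fun (`]0%R, 1%R[%classic : set R) (fun x : R => (x^-1)%:E).
  apply/measurable_EFinP; apply: open_continuous_measurable_fun => [|x].
    exact: interval_open.
  rewrite inE /= in_itv /= => /andP[ax _].
  by apply: inv_continuous; rewrite gt_eqF.
rewrite UE /dtt ge0_integral_bigcup //; last 3 first.
- by apply: measurable_funS mi => // t [n _ /F01].
- by move=> t [n _ /F01 /=]; rewrite in_itv /= => /andP[t0 _]; rewrite lee_fin invr_ge0 ltW.
- move=> i j _ _ [x []]; rewrite /F; case: ifP => // _ [_ <-]; case: ifP => // _ [_ <-] //.
rewrite /count [RHS]eseries_mkcond; apply: eq_eseriesr => n _.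
rewrite /F; case: ifP => _; last by rewrite integral_set0.
exact: dtt_tcell.
Qed.

Lemma measurable_step (D : set R) (ix : R -> nat) v : measurable D ->
  (forall n, measurable [set x | D x /\ ix x = n]) ->
  measurable_fun D (fun x => v (ix x)).
Proof.
move=> mD mc _ Y mY.
have -> : D `&` (fun x => v (ix x)) @^-1` Y = [set x | D x /\ `[< Y (v (ix x)) >]].
  by apply/seteqP; split=> x /= [Dx h]; split=> //; apply/asboolP.
rewrite (bigcup_index D ix (fun n => `[< Y (v n) >])).
by apply: bigcup_measurable => n _; exact: mc.
Qed.

Lemma Mplus_step v : nonneg v -> Mplus (fun x : R => v (Num.truncn x)).
Proof.
move=> v0; split=> [|x _]; last exact: v0.
apply: measurable_step => [|n]; first exact: measurable_itv.
have -> : [set x : R | (`]0%R, +oo[%classic x) /\ Num.truncn x = n] = xcell n.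
  by apply/seteqP; split=> x /=; rewrite in_itv /= andbT.
exact: measurable_xcell.
Qed.

Lemma mu_below (m : \bar R) : 0 <= m -> mu [set s | (0 < s)%R /\ s%:E < m] = m.
Proof.
case: m => [r||] //; rewrite ?lee_fin => r0.
  have -> : [set s : R | (0 < s)%R /\ s%:E < r%:E] = `]0%R, r[%classic.
    by apply/seteqP; split=> s /=; rewrite in_itv /= lte_fin; [move=> [-> ->]|move=> /andP[-> ->]].
  rewrite lebesgue_measure_itv /= lte_fin; case: ltP => r1; first by rewrite oppr0 adde0.
  by congr EFin; apply/eqP; rewrite eq_le r0.
have -> : [set s : R | (0 < s)%R /\ s%:E < +oo] = `]0%R, +oo[%classic.
  by apply/seteqP; split=> s /=; rewrite in_itv /= andbT ltry; [case|].
by rewrite lebesgue_measure_itv /= ltry.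
Qed.

(** Both sides are norms of equimeasurable functions: the step functions have matching cells of
    measure 1, and rearranging preserves the distribution function. *)
Lemma tnorm_step E v : eequi E -> nonneg v ->
  tnorm E `]0%R, 1%R[ (fun t => v (tindex t)) = nu E v.
Proof.
move=> eE v0; apply: eE => [||l l0]; [exact: Mplus_rearr|exact: Mplus_step|].
pose g := (fun t => v (tindex t)) \_ `]0%R, 1%R[.
have gl (x : R) : (0 <= x)%R ->
    `]0%R, +oo[ `&` [set t | x%:E < `|g t|] = [set t | (0 < t < 1)%R /\ x%:E < v (tindex t)].
  move=> x0; apply/seteqP; split=> t /=; rewrite in_itv /= andbT /g patchE.
    move=> [t0]; case: ifPn => [|_]; last by rewrite abse0 lte_fin ltNge x0.
    by rewrite inE /= in_itv /= gee0_abs.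
  move=> [t01 h]; split; first by case/andP: t01.
  by rewrite ifT ?gee0_abs // inE /= in_itv.
have gc (x : R) : (0 <= x)%R ->
    dtt (`]0%R, +oo[ `&` [set t | x%:E < `|g t|]) =
    mu (`]0%R, +oo[ `&` [set t | x%:E < v (Num.truncn t)]).
  move=> x0; rewrite gl // (dtt_count (fun n => x%:E < v n)).
  rewrite -(mu_count (fun n => x%:E < v n)); congr (mu _).
  by apply/seteqP; split=> t /=; rewrite in_itv /= andbT.
(* By [rearr_gt], the level set of the rearrangement is an initial interval whose length is the
   measure of the level set of [g]. *)
have -> : [set x | (0 < x)%R /\ l%:E < rearr (@dtt R) `]0%R, +oo[ g x] =
    [set s | (0 < s)%R /\ s%:E < dtt (`]0%R, +oo[ `&` [set t | l%:E < `|g t|])].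
  have key (s : R) : (l%:E < rearr (@dtt R) `]0%R, +oo[ g s) =
     (s%:E < dtt (`]0%R, +oo[ `&` [set t | l%:E < `|g t|])).
    apply: rearr_gt => // [x y xy|].
      apply: dtt_le; first by move=> t [].
      move=> t [t0 /= h]; split=> //=; apply: le_lt_trans h; by rewrite lee_fin.
    rewrite gc // => /measure_right_continuous[||l' ll' h].
    - exact: measurable_itv.
    - exact: (Mplus_step v0).1.
    - by exists l' => //; rewrite gc // (le_trans l0) // ltW.
  by apply/seteqP; split=> s /= [s0]; rewrite key.
rewrite mu_below gc //.
  by congr (mu _); apply/seteqP; split=> t /=; rewrite in_itv /= andbT.
Qed.

Lemma tnorm_le_nu E I g v : emono E -> eequi E -> I `<=` `]0%R, 1%R[ -> nonneg v ->
  (forall t, I t -> `|g t| <= v (tindex t)) -> tnorm E I g <= nu E v.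
Proof.
move=> mE eE I01 v0 gv; rewrite -(tnorm_step eE v0); apply: tnorm_le => // t t0.
rewrite !patchE; case: ifPn => tI; last by rewrite abse0 abse_ge0.
rewrite inE in tI; rewrite mem_set; last exact: I01.
by rewrite [leRHS]gee0_abs // gv.
Qed.

(** Cells where [v] vanishes are exempt from the condition, so that [v] can be supported on the
    cells contained in [I]. *)
Lemma nu_le_tnorm E I g v : emono E -> eequi E -> nonneg v ->
  (forall t, (0 < t < 1)%R -> v (tindex t) != 0 -> I t /\ v (tindex t) <= `|g t|) ->
  nu E v <= tnorm E I g.
Proof.
move=> mE eE v0 gv; rewrite -(tnorm_step eE v0); apply: tnorm_le => // t t0.
rewrite patchE; case: ifPn => t1; last by rewrite abse0.
rewrite inE /= in_itv /= in t1; rewrite gee0_abs //.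
have [->|vn] := eqVneq (v (tindex t)) 0; first by [].
by have [tI h] := gv t t1 vn; rewrite patchE mem_set.
Qed.

End rearrangements.

(** * The sequence norms of r.i. spaces, of L_1 and of L_oo *)

Section concrete_norms.
Local Open Scope ereal_scope.
Variable R : realType.
Local Notation mu := (@lebesgue_measure R).
Implicit Types (v : nat -> \bar R) (E : function_norm R).

Lemma ri_emono E : ri_space E -> emono E.
Proof. by move=> hE f g Mf Mg fg; apply: (ri_mono hE) => //; apply: aeW => x; exact: fg. Qed.

Lemma ri_eequi E : ri_space E -> eequi E.
Proof. by move=> hE f g Mf Mg fg; apply: (ri_equimeasurable hE). Qed.

Lemma Mplus_patch (f : R -> \bar R) : Mplus f ->
  measurable_fun setT (f \_ `]0%R, +oo[) /\ forall x, 0 <= (f \_ `]0%R, +oo[) x.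
Proof.
move=> [mf f0]; split.
  by apply/(measurable_restrictT _ _).1 => //; exact: measurable_itv.
move=> x; apply: erestrict_ge0 => y; rewrite /= in_itv /= andbT; exact: f0.
Qed.

Lemma Lq1E (f : R -> \bar R) : Mplus f -> Lq 1%E f = \int[mu]_(x in `]0%R, +oo[) f x.
Proof.
move=> Mf; have [_ f0] := Mplus_patch Mf.
rewrite /Lq Lnorm1 [RHS]integral_mkcond; apply: eq_integral => x _.
by rewrite gee0_abs.
Qed.

Lemma Lq1_emono : emono (@Lq R 1%E).
Proof.
move=> f g Mf Mg fg; rewrite !Lq1E //; have [_ f0] := Mf; have [_ g0] := Mg.
apply: le_integral_patch => [x|x|x]; rewrite ?patchE /= ?in_itv /= ?andbT.
- exact: f0.
- exact: g0.
- by case: ifPn => //; rewrite inE /= in_itv /= andbT; exact: fg.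
Qed.

Lemma Lq1_eequi : eequi (@Lq R 1%E).
Proof.
move=> f g Mf Mg fg; rewrite !Lq1E // (integral_layers Mf) (integral_layers Mg).
by apply: eq_integral => l; rewrite inE /= in_itv /= andbT => /ltW /fg.
Qed.

Lemma nu_Lq1 v : nonneg v -> nu (Lq 1%E) v = \sum_(n <oo) v n.
Proof.
move=> v0; have Mv := Mplus_step v0; rewrite /nu Lq1E //.
pose F n := @xcell R n.
have UE : (`]0%R, +oo[ : set R)%classic = \bigcup_n F n.
  apply/seteqP; split=> x /=; rewrite in_itv /= andbT.
    by move=> x0; exists (Num.truncn x).
  by move=> [n _ []].
rewrite UE ge0_integral_bigcup //; last 3 first.
- by move=> n; exact: measurable_xcell.
- by rewrite -UE; exact: Mv.1.
- exact: (@trivIset_index _ (fun x => (0 < x)%R)).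
apply: eq_eseriesr => n _.
transitivity (\int[mu]_(x in F n) (cst (v n) x)).
  by apply: eq_integral => x; rewrite inE => -[_ <-].
transitivity (v n * mu (@xcell R n)); last by rewrite mu_xcell mule1.
by apply: integral_cst; exact: measurable_xcell.
Qed.

Lemma muT_gt0 : 0 < mu [set: R].
Proof.
apply: (@lt_le_trans _ _ (mu `]0%R, 1%R[%classic)).
  by rewrite lebesgue_measure_itv /= lte_fin ltr01 sube0 lte_fin.
by apply: le_measure; rewrite ?inE.
Qed.

Lemma LqyE (f : R -> \bar R) : Mplus f ->
  Lq +oo%E f = ess_sup mu (f \_ `]0%R, +oo[).
Proof.
move=> Mf; have [_ f0] := Mplus_patch Mf.
rewrite /Lq unlock muT_gt0; congr (ess_sup _ _); apply/funext => x /=.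
by rewrite gee0_abs.
Qed.

Lemma Lqy_emono : emono (@Lq R +oo%E).
Proof.
move=> f g Mf Mg fg; rewrite !LqyE //; apply: le_ess_sup; apply: aeW => x.
by rewrite !patchE; case: ifPn => //; rewrite inE /= in_itv /= andbT; exact: fg.
Qed.

Lemma Lqy_eequi : eequi (@Lq R +oo%E).
Proof.
move=> f g Mf Mg fg; rewrite !LqyE // !ess_supEmu0; try by case: (Mplus_patch Mf); try by case: (Mplus_patch Mg).
  suff H y : mu ((f \_ `]0%R, +oo[) @^-1` `]y, +oo[) = mu ((g \_ `]0%R, +oo[) @^-1` `]y, +oo[).
    by congr ereal_inf; apply/seteqP; split=> y /=; rewrite H.
  have E (h : R -> \bar R) (r : R) : (0 <= r)%R ->
      (h \_ `]0%R, +oo[) @^-1` `]r%:E, +oo[ = [set x : R | (0 < x)%R /\ r%:E < h x].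
    move=> r0; apply/seteqP; split=> x /=; rewrite in_itv /= andbT patchE.
      case: ifPn => [|_]; last by rewrite lte_fin ltNge r0.
      by rewrite inE /= in_itv /= andbT.
    by move=> [x0 h1]; rewrite ifT // inE /= in_itv /= andbT.
  have N (h : R -> \bar R) : Mplus h -> forall y, y < 0 ->
      (h \_ `]0%R, +oo[) @^-1` `]y, +oo[ = setT.
    move=> Mh y' y0; have [_ h0] := Mplus_patch Mh.
    apply/seteqP; split=> x //= _; rewrite in_itv /= andbT.
    exact: lt_le_trans (h0 x).
  case: (ltP y 0) => y0; first by rewrite !N.
  case: y y0 => [r| |] // r0; first by rewrite !E // fg.
  have Z (h : R -> \bar R) : h @^-1` `]+oo, +oo[ = set0.
    by apply/seteqP; split=> x //=; rewrite in_itv /= andbT ltNge leey.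
  by rewrite !Z.
Qed.

Lemma nu_Lqy_ge v n : nonneg v -> v n <= nu (Lq +oo%E) v.
Proof.
move=> v0; have Mv := Mplus_step v0; rewrite /nu LqyE //.
rewrite leNgt; apply/negP => lt.
have := @ess_sup_ge _ _ _ mu ((fun x : R => v (Num.truncn x)) \_ `]0%R, +oo[).
move=> [N [mN N0 sub]].
have : mu (@xcell R n) <= mu N.
  apply: le_measure; rewrite ?inE //; first exact: measurable_xcell.
  move=> x [x0 xn]; apply: sub => /=; apply/negP; rewrite -ltNge.
  by rewrite patchE ifT ?xn // inE /= in_itv /= andbT.
by rewrite mu_xcell N0 leNgt lte_fin ltr01.
Qed.

Lemma nu_Lqy_le v M : nonneg v -> (forall n, v n <= M) -> nu (Lq +oo%E) v <= M.
Proof.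
move=> v0 vM; have Mv := Mplus_step v0; rewrite /nu LqyE //.
apply/ess_supP; apply: aeW => x; rewrite patchE; case: ifP => _ //.
exact: le_trans (v0 0%N) (vM 0%N).
Qed.

Section ri_nu.
Variable E : function_norm R.
Hypothesis hE : ri_space E.

Lemma nu_mono u v : nonneg u -> nonneg v -> (forall n, u n <= v n) -> nu E u <= nu E v.
Proof. by move=> u0 v0 uv; apply: (ri_emono hE) => [||x _]; [exact: Mplus_step..|]. Qed.

Lemma nu_add u v : nonneg u -> nonneg v -> nu E (fun n => u n + v n) <= nu E u + nu E v.
Proof. by move=> u0 v0; apply: (ri_triangle hE); exact: Mplus_step. Qed.

Lemma nu_zero : nu E (fun=> 0) = 0.
Proof.
have := @ri_scale _ _ hE 0%R (fun=> 0) (lexx _) (Mplus_step (v := fun=> 0) (fun=> lexx 0)).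
by under eq_fun do rewrite mul0e; rewrite mul0e.
Qed.

(** The Fatou property enters here: partial sums increase to the series, and finite subadditivity
    bounds each of them. *)
Lemma nu_sigma (u : nat -> nat -> \bar R) : (forall j, nonneg (u j)) ->
  nu E (fun n => \sum_(j <oo) u j n) <= \sum_(j <oo) nu E (u j).
Proof.
move=> u0; pose f k n := \sum_(0 <= j < k) u j n.
have f0 k : nonneg (f k) by move=> n; apply: sume_ge0 => j _; exact: u0.
have s0 : nonneg (fun n => \sum_(j <oo) u j n).
  by move=> n; apply: nneseries_ge0 => j _ _; exact: u0.
have nd n : nondecreasing_seq (f ^~ n).
  by apply/nondecreasing_seqP => k; rewrite /f big_nat_recr //= leeDl //; exact: u0.
have cv := @ri_fatou _ _ hE (fun k x => f k (Num.truncn x))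
  (fun x => \sum_(j <oo) u j (Num.truncn x)) (fun k => Mplus_step (f0 k)) (Mplus_step s0).
have {cv} : (fun k => E (fun x => f k (Num.truncn x))) @ \oo --> nu E (fun n => \sum_(j <oo) u j n).
  apply: cv => [k|]; apply: aeW => x _; first exact: nd.
  by apply: is_cvg_nneseries => j _ _; exact: u0.
move=> cv; rewrite -(cvg_lim _ cv) //; apply: lime_le.
  by apply/cvg_ex; eexists; exact: cv.
apply: nearW => k; apply: (@le_trans _ _ (\sum_(0 <= j < k) nu E (u j))); last first.
  by apply: nneseries_lim_ge => j _ _; apply: (ri_ge0 hE); exact: Mplus_step.
elim: k => [|k IH].
  rewrite big_geq // (_ : E _ = 0) //; rewrite -nu_zero; congr (E _).
  by apply/funext => x; rewrite /f big_geq.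
rewrite big_nat_recr //=; apply: le_trans (leeD IH (lexx _)).
have -> : (fun x : R => f k.+1 (Num.truncn x)) = (fun x : R => f k (Num.truncn x) + u k (Num.truncn x)).
  by apply/funext => x; rewrite /f big_nat_recr.
exact: nu_add.
Qed.

(** The left sequence is equimeasurable with [w], the restriction of [u] to the image of [P] under
    [r], since [r] is a bijection between their level sets. *)
Lemma nu_inj (P : pred nat) (r : nat -> nat) u : nonneg u -> {in P &, injective r} ->
  nu E (fun n => if P n then u (r n) else 0) <= nu E u.
Proof.
move=> u0 inj; pose w m := if `[< exists2 n, P n & r n = m >] then u m else 0.
have w0 : nonneg w by move=> m; rewrite /w; case: ifP.
have u'0 : nonneg (fun n => if P n then u (r n) else 0) by move=> n; case: ifP.
apply: (@le_trans _ _ (nu E w)); last first.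
  by apply: nu_mono => // m; rewrite /w; case: ifP.
rewrite le_eqVlt; apply/orP; left; apply/eqP.
apply: (ri_equimeasurable hE (Mplus_step u'0) (Mplus_step w0)) => l l0.
rewrite (mu_count R (fun n => l%:E < (if P n then u (r n) else 0))).
rewrite (mu_count R (fun m => l%:E < w m)) /count !nneseries_esum //.
rewrite (reindex_esum [set n | l%:E < (if P n then u (r n) else 0)]
  [set m | l%:E < w m] r) //.
have lP n : l%:E < (if P n then u (r n) else 0) -> P n.
  by case: ifP => // _; rewrite lte_fin ltNge l0.
split=> [n /= h|n m|m /=].
- have Pn := lP n h; rewrite Pn in h; rewrite /w ifT //.
  by apply/asboolP; exists n.
- rewrite !inE /= => /lP Pn /lP Pm; apply: inj => //.
- rewrite /w; case: ifP => [/asboolP[n Pn <-] h|_]; last by rewrite lte_fin ltNge l0.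
  by exists n => //=; rewrite Pn.
Qed.

Lemma ri_seq_norm : seq_norm (nu E).
Proof.
have d0 : nonneg (fun n => if n == 0%N then 1 else 0 : \bar R) by move=> n; case: ifP.
split.
- exact: nu_mono.
- by move=> c u c0 u0; apply: (ri_scale hE) => //; exact: Mplus_step.
- by move=> u u0; apply: (ri_ge0 hE); exact: Mplus_step.
- exact: nu_sigma.
- exact: nu_inj.
- rewrite lt_neqAle (ri_ge0 hE (Mplus_step d0)) andbT.
  apply/negP => /eqP/esym /(ri_eq0 hE (Mplus_step d0))[N [mN N0 sub]].
  have : mu (@xcell R 0) <= mu N.
    apply: le_measure; rewrite ?inE //; first exact: measurable_xcell.
    move=> x [x0 xn]; apply: sub => /= /(_ x0); rewrite xn eqxx => /eqP.
    by rewrite onee_eq0.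
  by rewrite mu_xcell N0 leNgt lte_fin ltr01.
- apply: le_lt_trans (ri_indic hE (measurable_itv `]0%R, 1%R]) _ _); last 2 first.
  + by move=> x /=; rewrite !in_itv /= andbT => /andP[].
  + by rewrite lebesgue_measure_itv /= lte_fin ltr01 sube0 ltry.
  apply: (ri_emono hE) => [||x x0]; first exact: (Mplus_step d0).
  + split=> [|x _]; last by rewrite lee_fin.
    by apply/measurable_EFinP; exact: measurable_indic.
  + case: eqP => [h|_]; last by rewrite lee_fin.
    have /andP[_] := truncn_itv (ltW x0); rewrite h => x1.
    by rewrite indicE mem_set //= in_itv /= x0 ltW.
Qed.

End ri_nu.
End concrete_norms.

(** * Rearrangements along the powers of 1/e *)

Section decreasing_rearrangement.
Local Open Scope ereal_scope.
Variable R : realType.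
Local Notation mu := (@lebesgue_measure R).
Local Notation U := (`]0%R, 1%R[%classic : set R).
Implicit Types f g : R -> R.

Definition Fs f (n : nat) : \bar R := fstar f (expR (- n%:R)).

Let dist_eq f (l : R) : U `&` [set x | l%:E < `|(EFin \o f) x|] =
  U `&` [set x | l%:E < (EFin \o (fun x => `|f x|%R)) x].
Proof. by []. Qed.

Let mabs f : measurable_fun U f -> measurable_fun U (EFin \o (fun x => `|f x|%R)).
Proof. by move=> mf; apply/measurable_EFinP; exact: measurableT_comp. Qed.

Lemma measurable_dist f l : measurable_fun U f ->
  measurable (U `&` [set x | l%:E < `|(EFin \o f) x|]).
Proof.
move=> mf; rewrite dist_eq; apply: emeasurable_fun_o_infty; last exact: mabs.
exact: measurable_itv.
Qed.

Lemma fstar_ge0 f s : 0 <= fstar f s. Proof. exact: rearr_ge0. Qed.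

Lemma fstar_ni f s t : (s <= t)%R -> fstar f t <= fstar f s.
Proof. exact: rearr_ni. Qed.

Lemma Fs_ge0 f : nonneg (Fs f). Proof. by move=> n; exact: fstar_ge0. Qed.

Lemma Fs_nd f : {homo Fs f : n m / (n <= m)%N >-> n <= m}.
Proof. by move=> n m nm; apply: fstar_ni; rewrite ler_expR lerN2 ler_nat. Qed.

(** The successor in the upper bound is one origin of the index shifts in the discrete norms. *)
Lemma fstar_cell f t : (0 < t < 1)%R ->
  Fs f (tindex t) <= fstar f t /\ fstar f t <= Fs f (tindex t).+1.
Proof. by move=> /tindex_itv/andP[a b]; split; apply: fstar_ni => //; exact: ltW. Qed.

Lemma fstar_gt f l s : measurable_fun U f -> (0 <= l)%R ->
  (l%:E < fstar f s) = (s%:E < mu (U `&` [set x | l%:E < `|(EFin \o f) x|])).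
Proof.
move=> mf l0; apply: rearr_gt => // [x y xy|].
  apply: le_measure; rewrite ?inE; try exact: measurable_dist.
  by move=> t [Ut /= h]; split=> //=; apply: le_lt_trans h; rewrite lee_fin.
rewrite dist_eq => /measure_right_continuous; apply; last exact: mabs.
exact: measurable_itv.
Qed.

Lemma fstar_le f g s : measurable_fun U f -> measurable_fun U g ->
  (forall x, U x -> `|f x| <= `|g x|)%R -> fstar f s <= fstar g s.
Proof.
move=> mf mg fg; apply: ereal_inf_le_tmp => _ [l [l0 hl] <-]; exists l => //; split=> //.
apply: le_trans hl; apply: le_measure; rewrite ?inE; try exact: measurable_dist.
move=> x [Ux /= h]; split=> //=; apply: lt_le_trans h _.
by rewrite lee_fin; exact: fg.
Qed.

(** As f is real valued and (0, 1) has finite measure, the sets |f| > k decrease to the empty set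
    and their measures tend to 0. *)
Lemma fstar_lty f s : measurable_fun U f -> (0 < s)%R -> fstar f s < +oo.
Proof.
move=> mf s0; pose G (k : nat) := U `&` [set x | (k%:R : R)%:E < `|(EFin \o f) x|].
have mG k : measurable (G k) by exact: measurable_dist.
have GE : \bigcap_k G k = set0.
  apply/seteqP; split=> x //= Gx.
  have [_ /=] := Gx (Num.truncn `|f x|%R).+1 I; rewrite lte_fin.
  have /andP[_ h] := truncn_itv (normr_ge0 (f x)).
  by rewrite ltNge ltW.
have cv : mu \o G @ \oo --> mu (\bigcap_k G k).
  apply: nonincreasing_cvg_mu => //.
  - apply: (@le_lt_trans _ _ (mu U)).
      have sU : G 0%N `<=` U by move=> x [].
      exact: (le_measure mu (mem_set (mG 0%N)) (mem_set (measurable_itv _)) sU).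
    by rewrite lebesgue_measure_itv /= lte_fin ltr01 sube0 ltry.
  - by rewrite GE.
  - move=> i j ij; rewrite subsetEset => x [Ux /= h]; split=> //=.
    by apply: le_lt_trans h; rewrite lee_fin ler_nat.
rewrite GE measure0 in cv.
have [k hk] : exists k, mu (G k) <= s%:E.
  apply: contrapT => ne; have : s%:E <= (0 : \bar R); last by rewrite lee_fin leNgt s0.
  have cl : lim ((mu \o G) k @[k --> \oo]) = 0 by exact: cvg_lim cv.
  rewrite -cl; apply: lime_ge; first by apply/cvg_ex; exists 0; exact: cv.
  apply: nearW => k; apply/ltW; rewrite ltNge; apply/negP => h; apply: ne.
  by exists k.
apply: (@le_lt_trans _ _ (k%:R)%:E); last exact: ltry.
by apply: ereal_inf_lbound; exists k%:R.
Qed.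

Lemma Fs_fin f n : measurable_fun U f -> Fs f n \is a fin_num.
Proof. by move=> mf; rewrite ge0_fin_numE ?fstar_ge0 // fstar_lty // expR_gt0. Qed.

(** Outside a null set, |f| > l0 + l1 forces |f0| > l0 or |f1| > l1. The levels are the values of
    the two rearrangements, hence their finiteness at the start. *)
Lemma fstar_add f f0 f1 s0 s1 :
  measurable_fun U f -> measurable_fun U f0 -> measurable_fun U f1 ->
  {ae mu, forall x : R, (0 < x < 1)%R -> f x = (f0 x + f1 x)%R} ->
  (0 < s0)%R -> (0 < s1)%R ->
  fstar f (s0 + s1) <= fstar f0 s0 + fstar f1 s1.
Proof.
move=> mf m0 m1 [N [mN N0 sub]] s00 s10.
have d0 : fstar f0 s0 \is a fin_num by rewrite ge0_fin_numE ?fstar_ge0 // fstar_lty.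
have d1 : fstar f1 s1 \is a fin_num by rewrite ge0_fin_numE ?fstar_ge0 // fstar_lty.
pose l0 := fine (fstar f0 s0); pose l1 := fine (fstar f1 s1).
have p0 : (0 <= l0)%R by rewrite fine_ge0 // fstar_ge0.
have p1 : (0 <= l1)%R by rewrite fine_ge0 // fstar_ge0.
have h0 : mu (U `&` [set x | l0%:E < `|(EFin \o f0) x|]) <= s0%:E.
  by rewrite leNgt -fstar_gt // fineK // ltxx.
have h1 : mu (U `&` [set x | l1%:E < `|(EFin \o f1) x|]) <= s1%:E.
  by rewrite leNgt -fstar_gt // fineK // ltxx.
rewrite -(fineK d0) -(fineK d1) -EFinD.
apply: ereal_inf_lbound; exists (l0 + l1)%R => //; split; first exact: addr_ge0.
rewrite EFinD; apply: le_trans (leeD h0 h1).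
pose A0 := U `&` [set x | l0%:E < `|(EFin \o f0) x|].
pose A1 := U `&` [set x | l1%:E < `|(EFin \o f1) x|].
rewrite -/A0 -/A1.
have mA0 : measurable A0 by exact: measurable_dist.
have mA1 : measurable A1 by exact: measurable_dist.
apply: (@le_trans _ _ (mu ((A0 `|` A1) `|` N))).
  apply: le_measure; rewrite ?inE; first exact: measurable_dist.
    by apply: measurableU => //; exact: measurableU.
  move=> x [Ux /= hx]; have [xN|xN] := pselect (N x); first by right.
  left; have fx : f x = (f0 x + f1 x)%R.
    apply: contrapT => ne; apply: xN; apply: sub => /= H; apply: ne; apply: H.
    by move: Ux; rewrite /= in_itv.
  have [a0|a0] := ltP l0 `|f0 x|%R; first by left; split.
  right; split=> //=; rewrite lte_fin ltNge; apply/negP => a1.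
  move: hx; rewrite lte_fin fx ltNge => /negP; apply.
  by apply: le_trans (ler_normD _ _) _; exact: lerD.
apply: le_trans (measureU2 _ _ _) _ => //; first exact: measurableU.
by rewrite [X in _ + X]N0 adde0; exact: measureU2.
Qed.

Lemma expR1_ge2 : (2 <= expR 1 :> R)%R.
Proof. by have := @expR_ge1Dx R 1%R. Qed.

(** Since e >= 2, two copies of e^-(n + 1) fit into e^-n; [avg_Fs_add] pays for the shift by the
    factor e of [avg_step]. *)
Lemma Fs_add f f0 f1 n :
  measurable_fun U f -> measurable_fun U f0 -> measurable_fun U f1 ->
  {ae mu, forall x : R, (0 < x < 1)%R -> f x = (f0 x + f1 x)%R} ->
  Fs f n <= Fs f0 n.+1 + Fs f1 n.+1.
Proof.
move=> mf m0 m1 fE; have e0 : (0 < expR (- n.+1%:R) :> R)%R := expR_gt0 _.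
apply: le_trans (fstar_add mf m0 m1 fE e0 e0); apply: fstar_ni.
have -> : (- n%:R = - n.+1%:R + 1 :> R)%R by rewrite -natr1; ring.
by rewrite expRD; have := expR1_ge2; nra.
Qed.

Lemma avg_Fs_add f f0 f1 n :
  measurable_fun U f -> measurable_fun U f0 -> measurable_fun U f1 ->
  {ae mu, forall x : R, (0 < x < 1)%R -> f x = (f0 x + f1 x)%R} ->
  avg (Fs f) n <= (expR 1)%:E * (avg (Fs f0) n + avg (Fs f1) n).
Proof.
move=> mf m0 m1 fE; have Z g i : 0 <= avg (Fs g) i by apply/avg_ge0/Fs_ge0.
rewrite ge0_muleDr //; apply: le_trans (leeD (avg_step n (Fs_ge0 f0)) (avg_step n (Fs_ge0 f1))).
have T g j i : 0 <= (expR (- j%:R))%:E * Fs g i by rewrite mule_ge0 ?expE_ge0 ?Fs_ge0.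
rewrite /avg -nneseriesD => [|i _ _|i _ _]; [|exact: T..].
apply: lee_nneseries => j _ => [_|]; first exact: T.
rewrite -ge0_muleDr ?Fs_ge0 //; apply: lee_wpmul2l; first exact: expE_ge0.
by rewrite !addSn; exact: Fs_add.
Qed.

Definition cellmass : R := (1 - expR (-1))%R.

Lemma cellmass_gt0 : (0 < cellmass)%R.
Proof. by rewrite subr_gt0 expR_lt1 oppr_lt0. Qed.

Lemma mu_tcell n : mu (@tcell R n) = (cellmass * expR (- n%:R))%:E.
Proof.
have E b : mu [set` Interval (BSide false (expR (- n.+1%:R) : R)) (BSide b (expR (- n%:R)))] =
    (cellmass * expR (- n%:R))%:E.
  rewrite lebesgue_measure_itv /= lte_fin ltr_expR ltrN2 ltr_nat ltnSn -EFinB.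
  by congr EFin; rewrite -natr1 opprD expRD /cellmass; ring.
have mt := @measurable_tcell R n.
apply/eqP; rewrite eq_le; apply/andP; split.
  by rewrite -(E false); apply: le_measure; rewrite ?inE // tcellE => t [].
by rewrite -(E true); apply: le_measure; rewrite ?inE //; exact: open_sub_tcell.
Qed.

Lemma integral_tstep (v : nat -> \bar R) : nonneg v ->
  \int[mu]_(t in U) v (tindex t) = \sum_(n <oo) (cellmass * expR (- n%:R))%:E * v n.
Proof.
move=> v0; have UE : U = \bigcup_n (@tcell R n).
  apply/seteqP; split=> x /=; rewrite in_itv /=.
    by move=> x0; exists (tindex x).
  by move=> [n _ []].
rewrite UE ge0_integral_bigcup //; last 3 first.
- by move=> n; exact: measurable_tcell.
- rewrite -UE; apply: measurable_step; first exact: measurable_itv.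
  move=> n; have -> : [set x : R | U x /\ tindex x = n] = tcell n.
    by apply/seteqP; split=> x /=; rewrite in_itv.
  exact: measurable_tcell.
- exact: (@trivIset_index _ (fun x : R => (0 < x < 1)%R)).
apply: eq_eseriesr => n _.
transitivity (\int[mu]_(x in @tcell R n) (cst (v n) x)).
  by apply: eq_integral => x; rewrite inE => -[_ <-].
transitivity (v n * mu (@tcell R n)); last by rewrite mu_tcell muleC.
by apply: integral_cst; exact: measurable_tcell.
Qed.

Lemma integral_le_series (D : set R) (g : R -> \bar R) v : D `<=` U -> nonneg v ->
  (forall t, D t -> 0 <= g t) -> (forall t, D t -> g t <= v (tindex t)) ->
  \int[mu]_(t in D) g t <= \sum_(n <oo) (cellmass * expR (- n%:R))%:E * v n.
Proof.
move=> DU v0 g0 gv; rewrite -integral_tstep //; apply: le_integral_patch => // t.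
rewrite !patchE; case: ifPn => tD; last by case: ifP.
by rewrite inE in tD; rewrite mem_set ?gv //; exact: DU.
Qed.

Lemma series_le_integral (D : set R) (g : R -> \bar R) v : nonneg v ->
  (forall t, D t -> 0 <= g t) ->
  (forall t, (0 < t < 1)%R -> v (tindex t) != 0 -> D t /\ v (tindex t) <= g t) ->
  \sum_(n <oo) (cellmass * expR (- n%:R))%:E * v n <= \int[mu]_(t in D) g t.
Proof.
move=> v0 g0 gv; rewrite -integral_tstep //; apply: le_integral_patch => // t.
rewrite patchE; case: ifPn => t1; last exact: erestrict_ge0.
rewrite inE /= in_itv /= in t1.
have [->|vn] := eqVneq (v (tindex t)) 0; first exact: erestrict_ge0.
by have [tI h] := gv t t1 vn; rewrite patchE mem_set.
Qed.

Lemma tindex_ni (s t : R) : (0 < s)%R -> (s <= t)%R -> (t < 1)%R -> (tindex t <= tindex s)%N.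
Proof.
by move=> s0 st t1; apply: le_truncn; rewrite lerN2 ler_ln ?posrE // (lt_le_trans s0).
Qed.

Lemma lt_tindex (s t : R) : (0 < s < 1)%R -> (0 < t < 1)%R -> (tindex t < tindex s)%N -> (s < t)%R.
Proof.
move=> s01 /andP[t0 t1] h; rewrite ltNge; apply/negP => ts.
by have /andP[_ s1] := s01; have := tindex_ni t0 ts s1; rewrite leqNgt h.
Qed.

Lemma fstarstar_ge0 f t : (0 < t)%R -> 0 <= fstarstar f t.
Proof.
move=> t0; apply: mule_ge0; first by rewrite lee_fin invr_ge0 ltW.
by apply: integral_ge0 => s _; exact: fstar_ge0.
Qed.

(** One factor e comes from 1/t < e^(k + 1) against e^-k, the other from the successor in
    [fstar_cell], removed by [avg_step]. *)
Lemma fstarstar_le f t : (0 < t < 1)%R ->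
  fstarstar f t <= (expR 2)%:E * avg (Fs f) (tindex t).
Proof.
move=> t01; have /andP[t0 t1] := t01; have /andP[a b] := tindex_itv t01.
set k := tindex t in a b *; have F0 := Fs_ge0 f.
have v0 : nonneg (above k (fun n => Fs f n.+1)) by apply: above_ge0 => n; exact: Fs_ge0.
have h : \int[mu]_(s in `]0%R, t[) fstar f s <= (expR (- k%:R))%:E * avg (Fs f) k.+1.
  apply: le_trans (integral_le_series _ v0 _ _) _.
  - by move=> s /=; rewrite !in_itv /= => /andP[-> st]; exact: lt_trans st t1.
  - by move=> s _; exact: fstar_ge0.
  - move=> s /=; rewrite in_itv /= => /andP[s0 st].
    have s01 : (0 < s < 1)%R by rewrite s0 (lt_trans st).
    by rewrite /above (tindex_ni s0 (ltW st) t1); case: (fstar_cell f s01).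
  have -> : \sum_(n <oo) (cellmass * expR (- n%:R))%:E * above k (fun n => Fs f n.+1) n =
     \sum_(n <oo) above k (fun n => (cellmass * expR (- n%:R))%:E * Fs f n.+1) n.
    by apply: eq_eseriesr => n _; rewrite /above; case: ifP => // _; rewrite mule0.
  rewrite series_above; last first.
    by move=> n; rewrite mule_ge0 // lee_fin mulr_ge0 ?expR_ge0 // ltW // cellmass_gt0.
  rewrite /avg -nneseriesZl => [|j _]; last by rewrite mule_ge0 ?expE_ge0.
  apply: lee_nneseries => j _ => [_|].
    by rewrite mule_ge0 // lee_fin mulr_ge0 ?expR_ge0 // ltW // cellmass_gt0.
  rewrite muleA -EFinM -expRD addSn; apply: lee_wpM2r => //.
  rewrite natrD opprD; apply: ler_piMl; first exact: expR_ge0.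
  by rewrite /cellmass gerBl expR_ge0.
apply: (@le_trans _ _ ((expR k.+1%:R)%:E * ((expR (- k%:R))%:E * ((expR 1)%:E * avg (Fs f) k)))).
  apply: lee_pmul.
  - by rewrite lee_fin invr_ge0 ltW.
  - by apply: integral_ge0 => s _; exact: fstar_ge0.
  - rewrite lee_fin -[leRHS]invrK lef_pV2 ?posrE ?invr_gt0 ?expR_gt0 //.
    by rewrite -expRN ltW.
  - apply: (le_trans h); apply: lee_wpmul2l; first exact: expE_ge0.
    exact: avg_step.
rewrite !muleA -!EFinM -!expRD; apply: lee_wpM2r; last exact: avg_ge0.
by rewrite ler_expR -natr1 le_eqVlt; apply/orP; left; apply/eqP; ring.
Qed.

(** Only the cells after that of t lie inside (0, t) for certain. Omitting the cell of t costs
    exp(-1), and monotonicity of the average leads back from [k.+1] to [k]. *)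
Lemma le_fstarstar f t : (0 < t < 1)%R ->
  (cellmass * expR (-1))%:E * avg (Fs f) (tindex t) <= fstarstar f t.
Proof.
move=> t01; have /andP[t0 t1] := t01; have /andP[a b] := tindex_itv t01.
set k := tindex t in a b *; have F0 := Fs_ge0 f.
have c0 : (0 <= cellmass)%R by apply/ltW/cellmass_gt0.
have v0 : nonneg (above k.+1 (Fs f)) by exact: above_ge0.
have h : (cellmass * expR (- k.+1%:R))%:E * avg (Fs f) k.+1 <= \int[mu]_(s in `]0%R, t[) fstar f s.
  apply: le_trans _ (series_le_integral v0 _ _); last 2 first.
  - by move=> s _; exact: fstar_ge0.
  - move=> s s01; rewrite /above; case: ifP => ks; last by rewrite eqxx.
    move=> _; split; last by case: (fstar_cell f s01).
    by rewrite /= in_itv /= (lt_tindex s01 t01 ks) andbT; case/andP: s01.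
  have -> : \sum_(n <oo) (cellmass * expR (- n%:R))%:E * above k.+1 (Fs f) n =
     \sum_(n <oo) above k.+1 (fun n => (cellmass * expR (- n%:R))%:E * Fs f n) n.
    by apply: eq_eseriesr => n _; rewrite /above; case: ifP => // _; rewrite mule0.
  rewrite series_above; last first.
    by move=> n; rewrite mule_ge0 // lee_fin mulr_ge0 ?expR_ge0.
  rewrite /avg -nneseriesZl => [|j _]; last by rewrite mule_ge0 ?expE_ge0.
  apply: lee_nneseries => j _ => [_|].
    by rewrite !mule_ge0 ?expE_ge0 // lee_fin mulr_ge0 ?expR_ge0.
  by rewrite muleA -EFinM -mulrA -expRD natrD opprD.
apply: (@le_trans _ _ ((expR k%:R)%:E * ((cellmass * expR (- k.+1%:R))%:E * avg (Fs f) k))).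
  rewrite !muleA -!EFinM; apply: lee_wpM2r; last exact: avg_ge0.
  rewrite mulrCA -expRD (_ : k%:R + - k.+1%:R = -1)%R //.
  by rewrite -natr1; ring.
apply: lee_pmul.
- exact: expE_ge0.
- by apply: mule_ge0; [rewrite lee_fin mulr_ge0 ?expR_ge0|exact: avg_ge0].
- rewrite lee_fin -[leLHS]invrK lef_pV2 ?posrE ?invr_gt0 ?expR_gt0 //.
  by rewrite -expRN.
apply: le_trans h; apply: lee_wpmul2l; first by rewrite lee_fin mulr_ge0 ?expR_ge0.
by apply: avg_nd => //; exact: Fs_nd.
Qed.

(** [f1] is f clipped to [-c, c] with c = [Fs f n], and [f0] is the excess. The latter lives where
    |f| > c, a set of measure at most e^-n, so its rearrangement vanishes from e^-n on. *)
Lemma truncation f n : measurable_fun U f -> exists f0 f1 : R -> R,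
  [/\ measurable_fun U f0, measurable_fun U f1, forall x, f x = (f0 x + f1 x)%R &
   [/\ forall k, Fs f0 k <= Fs f k, forall k, (k <= n)%N -> Fs f0 k = 0,
       forall k, Fs f1 k <= Fs f k & forall k, Fs f1 k <= Fs f n]].
Proof.
move=> mf; have df := Fs_fin n mf; pose c := fine (Fs f n).
have c0 : (0 <= c)%R by rewrite fine_ge0 // Fs_ge0.
pose f1 x : R := Num.max (- c)%R (Num.min (f x) c).
pose f0 x := (f x - f1 x)%R.
have m1 : measurable_fun U f1 by apply: measurable_maxr => //; exact: measurable_minr.
have m0 : measurable_fun U f0 by exact: measurable_funB.
have b1 x : (`|f1 x| <= c)%R.
  rewrite ler_norml /f1 le_max lexx /= ge_max ge_min lexx orbT andbT.
  by rewrite -subr_ge0 opprK addr_ge0.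
have b1f x : (`|f1 x| <= `|f x|)%R.
  rewrite /f1; case: (leP (f x) c) => h1; case: (leP (- c)%R _) => h2 //.
  - by rewrite normrN (ger0_norm c0) ler0_norm; lra.
  - by rewrite (ger0_norm c0); apply: le_trans (ltW h1) (ler_norm _).
  - by exfalso; lra.
have b0f x : (`|f0 x| <= `|f x|)%R.
  rewrite /f0 /f1; case: (leP (f x) c) => h1; case: (leP (- c)%R _) => h2.
  - by rewrite subrr normr0.
  - by rewrite !ler0_norm; lra.
  - by rewrite !ger0_norm; lra.
  - by exfalso; lra.
have f0z x : (0 < `|f0 x|)%R -> (c < `|f x|)%R.
  rewrite /f0 /f1; case: (leP (f x) c) => h1; case: (leP (- c)%R _) => h2.
  - by rewrite subrr normr0 ltxx.
  - by move=> _; rewrite ler0_norm; lra.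
  - by move=> _; rewrite ger0_norm; lra.
  - by exfalso; lra.
exists f0, f1; split=> //; first by move=> x; rewrite /f0 subrK.
split=> k.
- by apply: fstar_le.
- move=> kn; apply/eqP; rewrite eq_le Fs_ge0 andbT.
  apply: ereal_inf_lbound; exists 0%R => //; split=> //.
  have h : mu (U `&` [set x | c%:E < `|(EFin \o f) x|]) <= (expR (- n%:R))%:E.
    by rewrite leNgt -fstar_gt // fineK // ltxx.
  apply: (@le_trans _ _ (expR (- n%:R))%:E); last by rewrite lee_fin ler_expR lerN2 ler_nat.
  apply: le_trans h; apply: le_measure; rewrite ?inE; try exact: measurable_dist.
  by move=> x [Ux /= h]; split=> //=; move: h; rewrite !lte_fin; exact: f0z.
- by apply: fstar_le.
- rewrite -(fineK df); apply: ereal_inf_lbound; exists c => //; split=> //.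
  rewrite (_ : _ `&` _ = set0) ?measure0 ?expE_ge0 //.
  by apply/seteqP; split=> x //= -[_]; rewrite lte_fin ltNge b1.
Qed.

End decreasing_rearrangement.

(** * Weights on cells *)

Section cell_weights.
Variable R : realType.
Implicit Types (W V : R -> R) (w v : nat -> R).

(** Stable under products, inverses and powers of positive functions, so that the weights of the
    theorem are treated factor by factor. *)
Definition cellcmp W w := exists2 C : R, 0 < C & forall t, 0 < t < 1 ->
  W t <= C * w (tindex t) /\ w (tindex t) <= C * W t.

Definition cellpos W w := (forall t, 0 < t < 1 -> 0 < W t) /\ (forall n, 0 < w n).

Lemma cellcmpM W V w v : cellpos W w -> cellpos V v -> cellcmp W w -> cellcmp V v ->
  cellcmp (fun t => W t * V t) (fun n => w n * v n).
Proof.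
move=> [W0 w0] [V0 v0] [C C0 H] [D D0 K]; exists (C * D); first exact: mulr_gt0.
move=> t t01; have [a b] := H t t01; have [c d] := K t t01.
have := W0 t t01; have := V0 t t01; have := w0 (tindex t); have := v0 (tindex t).
move=> *; split.
- by rewrite mulrACA; apply: ler_pM => //; exact: ltW.
- by rewrite mulrACA; apply: ler_pM => //; exact: ltW.
Qed.

Lemma cellposM W V w v : cellpos W w -> cellpos V v ->
  cellpos (fun t => W t * V t) (fun n => w n * v n).
Proof.
by move=> [W0 w0] [V0 v0]; split=> [t t01|n]; rewrite mulr_gt0 ?W0 ?V0.
Qed.

Lemma cellcmpV W w : cellpos W w -> cellcmp W w ->
  cellcmp (fun t => (W t)^-1) (fun n => (w n)^-1).
Proof.
move=> [W0 w0] [C C0 H]; exists C => // t t01; have [a b] := H t t01.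
have W0t := W0 t t01; have w0t := w0 (tindex t).
by split; rewrite ler_pdivlMr // mulrC ler_pdivrMr.
Qed.

Lemma cellposV W w : cellpos W w -> cellpos (fun t => (W t)^-1) (fun n => (w n)^-1).
Proof. by move=> [W0 w0]; split=> [t t01|n]; rewrite invr_gt0 ?W0. Qed.

Lemma cellcmp_powR W w a : 0 <= a -> cellpos W w -> cellcmp W w ->
  cellcmp (fun t => W t `^ a) (fun n => w n `^ a).
Proof.
move=> a0 [W0 w0] [C C0 H]; exists (C `^ a); first exact: powR_gt0.
have L (x y : R) : 0 < x -> 0 < y -> x <= C * y -> x `^ a <= C `^ a * y `^ a.
  move=> x0 y0 xy; rewrite -powRM; [|exact: ltW..]; apply: ge0_ler_powR => //.
  - by rewrite nnegrE ltW.
  - by rewrite nnegrE mulr_ge0 // ltW.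
move=> t t01; have [x y] := H t t01.
by split; apply: L => //; exact: W0.
Qed.

Lemma cellpos_powR W w a : cellpos W w -> cellpos (fun t => W t `^ a) (fun n => w n `^ a).
Proof. by move=> [W0 w0]; split=> [t t01|n]; rewrite powR_gt0 ?W0. Qed.

Lemma eq_cellcmp W W' w w' : (forall t, 0 < t < 1 -> W t = W' t) -> w =1 w' ->
  cellcmp W w -> cellcmp W' w'.
Proof.
move=> WW' ww' [C C0 H]; exists C => // t t01.
by rewrite -WW' // -ww'; exact: H.
Qed.

Lemma cellcmp_id : cellcmp id (fun n => expR (- n%:R)).
Proof.
exists (expR 1); first exact: expR_gt0.
move=> t t01; have /andP[a b] := tindex_itv t01.
have e0 := @expR_gt0 R (- (tindex t)%:R); have e1 := @expR1_ge2 R.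
split; first by nra.
have : expR 1 * expR (- (tindex t).+1%:R) = expR (- (tindex t)%:R) :> R.
  by rewrite -expRD -natr1; congr expR; ring.
move=> <-; rewrite ler_pM2l ?expR_gt0 //; exact: ltW.
Qed.

Lemma cellpos_id : cellpos id (fun n => expR (- n%:R)).
Proof. by split=> [t /andP[]|n] //; exact: expR_gt0. Qed.

Lemma cellcmp_pow k : 0 <= k -> cellcmp (fun t => t `^ k) (fun n => expR (- (k * n%:R))).
Proof.
move=> k0; apply: eq_cellcmp (cellcmp_powR k0 cellpos_id cellcmp_id) => // n.
by rewrite -expRM; congr expR; ring.
Qed.

Lemma cellpos_pow k : cellpos (fun t => t `^ k) (fun n => expR (- (k * n%:R))).
Proof. by split=> [t /andP[t0 _]|n]; [exact: powR_gt0|exact: expR_gt0]. Qed.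

Lemma ell_cell (t : R) : 0 < t < 1 -> 1 + (tindex t)%:R <= ell t < 2 + (tindex t)%:R.
Proof.
move=> t01; have /andP[t0 t1] := t01.
have l0 : 0 <= - ln t by rewrite oppr_ge0 ln_le0 // ltW.
have /andP[] := truncn_itv l0; rewrite -/(tindex t) -natr1 => a b.
by rewrite /ell ler0_norm; [lra|rewrite -oppr_ge0].
Qed.

Lemma ell_gt0 (t : R) : 0 < ell t.
Proof. by rewrite /ell; have := normr_ge0 (ln t); lra. Qed.

Lemma cellcmp_ell : cellcmp (@ell R) (fun n => 1 + n%:R).
Proof.
exists 2 => // t t01; have /andP[a b] := ell_cell t01.
have : (0 : R) <= (tindex t)%:R by [].
by split; lra.
Qed.

Lemma cellpos_ell : cellpos (@ell R) (fun n => 1 + n%:R).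
Proof. by split=> [t _|n]; [exact: ell_gt0|rewrite ltr_wpDr]. Qed.

Lemma cellcmp_ell_powR a : cellcmp (fun t => ell t `^ a) (fun n => (1 + n%:R) `^ a).
Proof.
have [a0|a0] := leP 0 a; first exact: cellcmp_powR a0 cellpos_ell cellcmp_ell.
have a1 : 0 <= - a by lra.
apply: eq_cellcmp (cellcmpV (cellpos_powR _ cellpos_ell) (cellcmp_powR a1 cellpos_ell cellcmp_ell)).
- by move=> t _; rewrite -powRN opprK.
- by move=> n; rewrite -powRN opprK.
Qed.

Lemma cellpos_ell_powR a : cellpos (fun t => ell t `^ a) (fun n => (1 + n%:R) `^ a).
Proof. exact: cellpos_powR cellpos_ell. Qed.

End cell_weights.

(** * Slowly varying functions in the logarithmic variable *)

Section slowly_varying.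
Variables (R : realType) (b : R -> R).
Hypothesis hb : SV b.

(** With x = - ln t, slow variation becomes a bound of quotients by exp(e |x - y|), for which
    increments of [- ln (wrho n)] are convenient. The extension by 1 concerns x <= 0. *)
Definition logb (x : R) := sv_ext b (expR (- x)).

Lemma logb_gt0 x : 0 < logb x.
Proof.
rewrite /logb /sv_ext; case: ifP => // h; case: hb => _ b0 _; apply: b0.
by rewrite expR_gt0.
Qed.

(** Each of the two monotone equivalents [g] and [h] yields one of the inequalities, with the square
    of its constant. *)
Lemma logb_pos (e : R) : 0 < e -> exists2 C : R, 1 <= C & forall x y, 0 < y -> y <= x ->
  logb x <= C * expR (e * (x - y)) * logb y /\ logb y <= C * expR (e * (x - y)) * logb x.
Proof.
move=> e0; case: hb => _ b0 /(_ e e0)[[g gnd [C1 C10 H1]] [h hni [C2 C20 H2]]].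
exists (1 + C1 * C1 + C2 * C2) => [|x y y0 yx]; first by nra.
have lt1 z : 0 < z -> expR (- z) < 1 :> R by rewrite expR_lt1 oppr_lt0.
have x0 : 0 < x by exact: lt_le_trans yx.
have s01 : 0 < expR (- x) < 1 by rewrite expR_gt0 lt1.
have t01 : 0 < expR (- y) < 1 by rewrite expR_gt0 lt1.
rewrite /logb /sv_ext !lt1 //.
have st : expR (- x) <= expR (- y) by rewrite ler_expR lerN2.
have [_ a1] := H1 _ s01; have [a2 _] := H1 _ t01.
have [c1 _] := H2 _ s01; have [_ c2] := H2 _ t01.
have gst := gnd _ _ (expR_gt0 _) st (lt1 _ y0).
have hst := hni _ _ (expR_gt0 _) st (lt1 _ y0).
move: a1 a2 c1 c2 gst hst (b0 _ s01) (b0 _ t01); rewrite -!expRM.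
have -> : - x * - e = e * x by ring.
have -> : - y * - e = e * y by ring.
have -> : - x * e = - (e * x) by ring.
have -> : - y * e = - (e * y) by ring.
set bs := b (expR (- x)); set bt := b (expR (- y)).
rewrite !(mulrC C1^-1) !(mulrC C2^-1) !ler_pdivrMr // => a1 a2 c1 c2 gst hst bs0 bt0.
have E : expR (e * (x - y)) = expR (e * x) * expR (- (e * y)) by rewrite -expRD; congr expR; ring.
have q0 : 0 < expR (e * (x - y)) := expR_gt0 _.
have Ex : expR (e * x) * expR (- (e * x)) = 1 by rewrite -expRD subrr expR0.
have Ey : expR (e * y) * expR (- (e * y)) = 1 by rewrite -expRD subrr expR0.
have ex := expR_gt0 (e * x); have ey := expR_gt0 (- (e * y)).
split.
- apply: (@le_trans _ _ (C1 * C1 * expR (e * (x - y)) * bt)); last first.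
    rewrite ler_pM2r // ler_pM2r //; nra.
  have -> : bs = expR (e * x) * (expR (- (e * x)) * bs) by rewrite mulrA Ex mul1r.
  have -> : C1 * C1 * expR (e * (x - y)) * bt =
    expR (e * x) * (C1 * (expR (- (e * y)) * bt * C1)) by rewrite E; ring.
  rewrite ler_pM2l //; apply: (le_trans a1); rewrite ler_pM2l //.
  exact: le_trans gst a2.
- apply: (@le_trans _ _ (C2 * C2 * expR (e * (x - y)) * bs)); last first.
    rewrite ler_pM2r // ler_pM2r //; nra.
  have -> : bt = expR (- (e * y)) * (expR (e * y) * bt) by rewrite mulrA (mulrC (expR (- _))) Ey mul1r.
  have -> : C2 * C2 * expR (e * (x - y)) * bs =
    expR (- (e * y)) * (C2 * (expR (e * x) * bs * C2)) by rewrite E; ring.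
  rewrite ler_pM2l //; apply: (le_trans c2); rewrite ler_pM2l //.
  exact: le_trans hst c1.
Qed.

(** The extension may jump at x = 0. A pair on both sides of 0 is compared through the value [B] at
    x = 1, which explains the terms with [B] and its inverse. *)
Lemma logb_slow (e : R) : 0 < e -> exists2 C : R, 0 < C & forall x y,
  logb x <= C * expR (e * `|x - y|) * logb y.
Proof.
move=> e0; have [C C1 H] := logb_pos e0.
have C0 : 0 < C by exact: lt_le_trans C1.
have L0 := logb_gt0.
have H2 x y : 0 < x -> 0 < y -> logb x <= C * expR (e * `|x - y|) * logb y.
  move=> x0 y0; case: (leP y x) => xy.
    by rewrite ger0_norm ?subr_ge0 //; case: (H x y y0 xy).
  by rewrite distrC gtr0_norm ?subr_gt0 //; case: (H y x x0 (ltW xy)).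
have Z x : x <= 0 -> logb x = 1.
  by move=> x0; rewrite /logb /sv_ext ltNge -[X in X <= _](@expR0 R) ler_expR oppr_ge0 x0.
pose B := logb 1; have B0 : 0 < B by exact: L0.
exists (C + C * expR e * B + C * expR e * B^-1) => [|x y].
  by rewrite !addr_gt0 // ?mulr_gt0 ?expR_gt0 ?invr_gt0.
have q0 : 0 < C * expR e by rewrite mulr_gt0 ?expR_gt0.
have qB : 0 < C * expR e * B by rewrite mulr_gt0.
have qV : 0 < C * expR e * B^-1 by rewrite mulr_gt0 ?invr_gt0.
have n0 := normr_ge0 (x - y).
have E1 : 1 <= expR (e * `|x - y|) by rewrite -[leLHS](@expR0 R) ler_expR mulr_ge0 // ltW.
have up K : 0 <= K -> K <= C + C * expR e * B + C * expR e * B^-1 -> forall z, 0 < z ->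
   K * expR (e * `|x - y|) * z <= (C + C * expR e * B + C * expR e * B^-1) * expR (e * `|x - y|) * z.
  by move=> _ KK z z0; rewrite ler_pM2r // ler_pM2r // expR_gt0.
have N z : 0 < z -> expR (e * `|z - 1|) <= expR e * expR (e * z).
  move=> z0; rewrite -expRD ler_expR (_ : e + e * z = e * (1 + z)); last by ring.
  rewrite ler_pM2l //.
  by rewrite ler_norml; apply/andP; split; lra.
case: (leP x 0) => x0; case: (leP y 0) => y0.
- rewrite !Z // mulr1; apply: (@le_trans _ _ (C * expR (e * `|x - y|))); first by nra.
  by rewrite ler_pM2r ?expR_gt0 //; lra.
- rewrite (Z x) //; apply: le_trans (up (C * expR e * B^-1) _ _ _ (L0 y)) => //; try lra.
  have h := H2 1 y ltr01 y0; rewrite distrC in h.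
  rewrite -[leLHS](mulVf (lt0r_neq0 B0)).
  have -> : C * expR e / B * expR (e * `|x - y|) * logb y = B^-1 * (C * (expR e * expR (e * `|x - y|)) * logb y) by ring.
  rewrite ler_pM2l ?invr_gt0 //; apply: (le_trans h).
  rewrite ler_pM2r // ler_pM2l //; apply: (le_trans (N y y0)).
  rewrite ler_pM2l ?expR_gt0 // ler_expR ler_pM2l // distrC.
  by apply: le_trans (ler_norm _); lra.
- rewrite (Z y) // mulr1; apply: (@le_trans _ _ (C * expR e * B * expR (e * `|x - y|))); last first.
    by rewrite ler_pM2r ?expR_gt0 //; lra.
  apply: (le_trans (H2 x 1 x0 ltr01)).
  have -> : C * expR e * B * expR (e * `|x - y|) = C * (expR e * expR (e * `|x - y|)) * B by ring.
  rewrite ler_pM2r // ler_pM2l //; apply: (le_trans (N x x0)).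
  rewrite ler_pM2l ?expR_gt0 // ler_expR ler_pM2l //.
  by apply: le_trans (ler_norm _); lra.
- apply: (le_trans (H2 x y x0 y0)); apply: up => //; lra.
Qed.

End slowly_varying.

(** * Change of variable along a regularly varying sequence *)

Section reparametrisation.
Local Open Scope ereal_scope.
Variables (R : realType) (nu : (nat -> \bar R) -> \bar R) (w : nat -> R) (dl c K : R).
Hypotheses (hn : seq_norm nu) (dl0 : (0 < dl)%R) (rw : reg dl w) (c0 : (0 <= c)%R) (K0 : (0 < K)%R).

Let sg n : R := (- ln (w n))%R.

(** Regular variation with the loss dl / 2, which keeps the lower slope of [sg] positive. *)
Let sg_bounds : exists2 L : R, (0 <= L)%R & forall n j,
  (sg n + dl / 2 * j%:R - L <= sg (n + j)%N)%R /\
  (sg (n + j)%N <= sg n + 3 / 2 * dl * j%:R + L)%R.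
Proof.
have e0 : (0 < dl / 2)%R by rewrite divr_gt0.
have [_ /(_ _ e0)[C C0 H]] := rw.
exists `|ln C|%R => // n j; have [a b] := H n j.
have l1 := ler_norm (ln C).
have wp i := reg_gt0 i rw.
have LM (x y z : R) : (0 < z)%R -> (0 < x)%R -> (x <= C * expR y * z)%R -> (ln x <= ln C + y + ln z)%R.
  move=> z0 x0 h; rewrite -[X in (_ <= _ + X + _)%R]expRK -!lnM ?posrE ?mulr_gt0 ?expR_gt0 //.
  by rewrite ler_ln ?posrE // ?mulr_gt0 ?expR_gt0.
have := LM _ _ _ (wp n) (wp (n + j)%N) a; have := LM _ _ _ (wp (n + j)%N) (wp n) b.
rewrite /sg => *; split; lra.
Qed.

Lemma truncn_near (x y : R) : (0 <= x)%R -> (0 <= y)%R ->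
  Num.truncn x = Num.truncn y -> (`|x - y| < 1)%R.
Proof.
move=> /truncn_itv/andP[a b] /truncn_itv/andP[a' b'] e.
by rewrite e -natr1 in a b; rewrite -natr1 in b'; rewrite ltr_norml; apply/andP; split; lra.
Qed.

Lemma lt_truncnS (x : R) (n : nat) : (n%:R < x)%R -> (n < (Num.truncn x).+1)%N.
Proof.
move=> nx; have x0 : (0 <= x)%R by apply: le_trans (ltW nx).
have /andP[_ h] := truncn_itv x0.
by rewrite -(ltr_nat R); exact: lt_trans h.
Qed.

Section one_function.
Variable k : R -> \bar R.
Hypothesis k0 : forall x, 0 <= k x.
Hypothesis kc : forall x y, k x <= (K * expR (c * `|x - y|))%:E * k y.

Let kc_le (x y B : R) : (`|x - y| <= B)%R -> k x <= (K * expR (c * B))%:E * k y.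
Proof.
move=> h; apply: (le_trans (kc x y)); apply: lee_wpM2r => //.
by rewrite ler_pM2l // ler_expR ler_wpM2l.
Qed.

(* If [k (x n) <= k (r n)] up to constants and the fibres of [r] are short,
   then [sn_quasi_inj] applies. *)
Lemma sn_resample (x y : nat -> R) (r : nat -> nat) (B : R) (M : nat) :
  (forall n, (`|x n - y (r n)| <= B)%R) ->
  (forall n m, r n = r m -> (n <= m)%N -> (m - n < M)%N) ->
  nu (k \o x) <= (K * expR (c * B) * M%:R)%:E * nu (k \o y).
Proof.
move=> hB hM; have KB : (0 <= K * expR (c * B))%R by rewrite mulr_ge0 ?expR_ge0 // ltW.
have ky0 : nonneg (k \o y) by move=> n; exact: k0.
apply: (@le_trans _ _ ((K * expR (c * B))%:E * nu ((k \o y) \o r))).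
  have kx0 : nonneg (k \o x) by move=> n; exact: k0.
  by apply: (sn_le hn KB kx0 (fun n => ky0 (r n))) => n; exact: (kc_le (hB n)).
rewrite [in leRHS]EFinM -muleA; apply: lee_wpmul2l => //.
exact: (sn_quasi_inj hn ky0 hM).
Qed.

End one_function.

(** The points [sg n] have bounded gaps and bounded multiplicity, as the integers do. [r1] sends [n]
    to an integer near [sg n], and [r2] sends an integer to the first index whose point reaches it;
    [sn_resample] applies to both. *)
Lemma reparam : exists2 C : R, (0 < C)%R & forall k : R -> \bar R,
  (forall x, 0 <= k x) -> (forall x y, k x <= (K * expR (c * `|x - y|))%:E * k y) ->
  nu (fun n => k (- ln (w n))%R) <= C%:E * nu (fun n => k n%:R) /\
  nu (fun n => k n%:R) <= C%:E * nu (fun n => k (- ln (w n))%R).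
Proof.
have [L L0 H] := sg_bounds.
(* Makes [sg n + L1] nonnegative, so that its truncation is its integer part. *)
pose L1 : R := (L + `|sg 0|)%R.
have s0 := ler_norm (sg 0); have s0' := ler_normr (- sg 0) (sg 0).
have s00 : (- `|sg 0| <= sg 0)%R by rewrite lerNl -normrN ler_norm.
have nn := normr_ge0 (sg 0).
have lb n : (0 <= sg n + L1)%R.
  have [h _] := H 0%N n; rewrite add0n in h.
  have : (0 <= dl / 2 * n%:R)%R by rewrite mulr_ge0 // divr_ge0 // ltW.
  by rewrite /L1; lra.
have d2 : (0 < dl / 2)%R by rewrite divr_gt0.
pose r1 n := Num.truncn (sg n + L1).
(* If two truncations agree, the points differ by less than 1, and the lower slope gives (dl / 2) (m
   - n) < 1 + L. *)
pose M1 := (Num.truncn ((1 + L) / (dl / 2))).+1.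
have r1B n : (`|sg n - (r1 n)%:R| <= L1 + 1)%R.
  have /andP[] := truncn_itv (lb n); rewrite -/(r1 n) -natr1 => a b.
  by rewrite ler_norml; apply/andP; split; rewrite /L1 in a b *; lra.
have r1M n m : r1 n = r1 m -> (n <= m)%N -> (m - n < M1)%N.
  move=> /(truncn_near (lb n) (lb m)); rewrite ltr_norml => /andP[h1 h2] nm.
  apply: lt_truncnS; rewrite ltr_pdivlMr //.
  have [h _] := H n (m - n)%N; rewrite subnKC // in h; lra.
(* Bounds the overshoot at the first crossing: one step of [sg], or |sg 0| when the first index is
   0. *)
pose L2 : R := (`|sg 0| + 3 / 2 * dl + L)%R.
have ex n : exists r, (n%:R <= sg r)%R.
  exists (Num.truncn ((n%:R + L1) / (dl / 2))).+1.
  have [h _] := H 0%N (Num.truncn ((n%:R + L1) / (dl / 2))).+1; rewrite add0n in h.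
  have z0 : (0 <= (n%:R + L1) / (dl / 2))%R.
    by rewrite divr_ge0 ?addr_ge0 // ltW.
  have /andP[_] := truncn_itv z0; rewrite ltr_pdivrMr // mulrC => h2.
  by rewrite /L1 in h h2; lra.
pose r2 n := ex_minn (ex n).
have r2B n : (`|n%:R - sg (r2 n)| <= L2)%R.
  rewrite /r2; case: ex_minnP => -[|r] nr min.
    rewrite distrC ger0_norm ?subr_ge0 //.
    have : (0 <= n%:R :> R)%R by []. by rewrite /L2; lra.
  rewrite distrC ger0_norm ?subr_ge0 //.
  have lt : (sg r < n%:R)%R.
    by rewrite ltNge; apply/negP => /min; rewrite ltnn.
  have [_] := H r 1%N; rewrite addn1 mulr1 => h2.
  by rewrite /L2; lra.
pose M2 := (Num.truncn (L2 + L2 + 1)).+1.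
have r2M n m : r2 n = r2 m -> (n <= m)%N -> (m - n < M2)%N.
  move=> e nm; apply: lt_truncnS; rewrite natrB //.
  have := r2B n; have := r2B m; rewrite e !ler_norml => /andP[a b'] /andP[a' b''].
  by lra.
pose C1 := (K * expR (c * (L1 + 1)) * M1%:R)%R.
pose C2 := (K * expR (c * L2) * M2%:R)%R.
have C10 : (0 < C1)%R by rewrite !mulr_gt0 ?expR_gt0 // ltr0n.
have C20 : (0 < C2)%R by rewrite !mulr_gt0 ?expR_gt0 // ltr0n.
exists (C1 + C2)%R => [|k k0 kc]; first by rewrite addr_gt0.
split.
- apply: le_trans (sn_resample k0 kc r1B r1M) _; apply: lee_wpM2r; first by rewrite lerDl ltW.
  by apply: (sn_ge0 hn) => n; exact: k0.
- apply: le_trans (@sn_resample k k0 kc (fun n => n%:R) sg r2 _ _ r2B r2M) _.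
  apply: lee_wpM2r; first by rewrite lerDr ltW.
  by apply: (sn_ge0 hn) => n; exact: k0.
Qed.

End reparametrisation.

(** * Discrete forms of the norms of the spaces *)

Section sandwich.
Local Open Scope ereal_scope.
Variable R : realType.
Local Notation mu := (@lebesgue_measure R).
Local Notation U := (`]0%R, 1%R[%classic : set R).
Implicit Types (v g : nat -> \bar R).

Lemma tnorm_upper (E : function_norm R) (I : set R) (G : R -> \bar R) v (C : R) :
  ri_space E -> (0 < C)%R -> I `<=` U -> nonneg v ->
  (forall t, I t -> `|G t| <= C%:E * v (tindex t)) ->
  tnorm E I G <= C%:E * nu E v.
Proof.
move=> hE C0 IU v0 h; rewrite -(sn_scale (ri_seq_norm hE)) ?(ltW C0) //.
apply: tnorm_le_nu => //; [exact: ri_emono|exact: ri_eequi|].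
by move=> n; rewrite mule_ge0 // lee_fin ltW.
Qed.

Lemma tnorm_lower (E : function_norm R) (I : set R) (G : R -> \bar R) v (C : R) :
  ri_space E -> (0 < C)%R -> nonneg v ->
  (forall t, (0 < t < 1)%R -> v (tindex t) != 0 -> I t /\ v (tindex t) <= C%:E * `|G t|) ->
  nu E v <= C%:E * tnorm E I G.
Proof.
move=> hE C0 v0 h; rewrite -lee_pdivrMl // -(sn_scale (ri_seq_norm hE)) ?invr_ge0 ?(ltW C0) //.
apply: nu_le_tnorm; [exact: ri_emono|exact: ri_eequi| |move=> t t01 vn].
  by move=> n; rewrite mule_ge0 // lee_fin invr_ge0 ltW.
have {}vn : v (tindex t) != 0 by apply: contraNneq vn => ->; rewrite mule0.
by have [It hv] := h t t01 vn; split=> //; rewrite lee_pdivrMl.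
Qed.

Lemma psumZ (c : R) g m : (0 <= c)%R -> nonneg g ->
  psum (fun k => c%:E * g k) m = c%:E * psum g m.
Proof. by move=> c0 g0; rewrite /psum ge0_sume_distrr. Qed.

Lemma above0 g : above 0 g = g.
Proof. by apply/funext => k; rewrite /above leq0n. Qed.

Section weighted_integral.
Variable k : R.
Hypothesis k0 : (0 <= k)%R.

(** The factor 1/s will cancel against the Lebesgue measure of the cell, leaving the weight [w0 k]
    in both series. *)
Let cw : cellcmp (fun s => s `^ k / s)%R (fun n => w0 k n / expR (- n%:R))%R.
Proof.
apply: cellcmpM (cellpos_pow k) (cellposV (@cellpos_id R)) _ _; first exact: cellcmp_pow.
exact: cellcmpV (@cellpos_id R) (@cellcmp_id R).
Qed.

Let w0_ge0 n : (0 <= w0 k n)%R. Proof. exact: expR_ge0. Qed.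

Let s0 (s : R) : (0 < s)%R -> (0 <= s `^ k / s)%R.
Proof. by move=> s0; rewrite divr_ge0 ?powR_ge0 // ltW. Qed.

Lemma integral_upper : exists2 C : R, (0 < C)%R & forall (D : set R) (G : R -> \bar R) v,
  D `<=` U -> nonneg v -> (forall s, D s -> 0 <= G s) -> (forall s, D s -> G s <= v (tindex s)) ->
  \int[mu]_(s in D) ((s `^ k / s)%:E * G s) <= C%:E * \sum_(n <oo) (w0 k n)%:E * v n.
Proof.
have [C C0 H] := cw; have cm := cellmass_gt0 R.
exists (cellmass R * C)%R => [|D G v DU v0 G0 Gv]; first by rewrite mulr_gt0.
have U0 s : D s -> (0 < s < 1)%R by move=> /DU; rewrite /= in_itv.
pose v' n := (C * (w0 k n / expR (- n%:R)))%:E * v n.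
have v'0 : nonneg v'.
  by move=> n; rewrite mule_ge0 // lee_fin mulr_ge0 ?divr_ge0 ?expR_ge0 // ltW.
apply: le_trans (integral_le_series DU v'0 _ _) _.
- by move=> s Ds; rewrite mule_ge0 ?G0 // lee_fin s0 //; case/andP: (U0 s Ds).
- move=> s Ds; have [a _] := H s (U0 s Ds); apply: lee_pmul; rewrite ?G0 ?Gv ?lee_fin //.
  by apply: s0; case/andP: (U0 s Ds).
rewrite -nneseriesZl => [|n _]; last by rewrite mule_ge0 // lee_fin.
rewrite le_eqVlt; apply/orP; left; apply/eqP; apply: eq_eseriesr => n _.
rewrite !muleA -!EFinM; congr (_%:E * _).
by field; rewrite gt_eqF // expR_gt0.
Qed.

Lemma integral_lower : exists2 C : R, (0 < C)%R & forall (D : set R) (G : R -> \bar R) v,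
  D `<=` U -> nonneg v -> (forall s, D s -> 0 <= G s) ->
  (forall s, (0 < s < 1)%R -> v (tindex s) != 0 -> D s /\ v (tindex s) <= G s) ->
  \sum_(n <oo) (w0 k n)%:E * v n <= C%:E * \int[mu]_(s in D) ((s `^ k / s)%:E * G s).
Proof.
have [C C0 H] := cw; have cm := cellmass_gt0 R.
exists (C / cellmass R)%R => [|D G v DU v0 G0 Gv]; first by rewrite divr_gt0.
have U0 s : D s -> (0 < s < 1)%R by move=> /DU; rewrite /= in_itv.
pose v' n := (C^-1 * (w0 k n / expR (- n%:R)))%:E * v n.
have v'0 : nonneg v'.
  by move=> n; rewrite mule_ge0 // lee_fin mulr_ge0 ?divr_ge0 ?expR_ge0 ?invr_ge0 // ltW.
rewrite -lee_pdivrMl ?divr_gt0 //; apply: le_trans _ (series_le_integral (D := D) v'0 _ _); last 2 first.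
- by move=> s Ds; rewrite mule_ge0 ?G0 // lee_fin s0 //; case/andP: (U0 s Ds).
- move=> s s01 vn; have {}vn : v (tindex s) != 0 by apply: contraNneq vn => e; rewrite /v' e mule0.
  have [Ds h] := Gv s s01 vn; have [_ a] := H s s01; split=> //.
  apply: lee_pmul; rewrite ?lee_fin //.
    by rewrite mulr_ge0 ?divr_ge0 ?expR_ge0 ?invr_ge0 // ltW.
  by rewrite ler_pdivrMl.
rewrite -nneseriesZl => [|n _]; last by rewrite mule_ge0 // lee_fin.
rewrite le_eqVlt; apply/orP; left; apply/eqP; apply: eq_eseriesr => n _.
rewrite !muleA -!EFinM; congr (_%:E * _); rewrite invf_div.
by field; rewrite ?gt_eqF // expR_gt0.
Qed.

End weighted_integral.

Lemma series_wt_below k v n : nonneg v ->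
  \sum_(i <oo) (w0 k i : R)%:E * below n v i = psum (wt (w0 k) v) n.
Proof.
move=> v0; have w0v : nonneg (wt (w0 k) v) by move=> i; rewrite mule_ge0 ?expE_ge0.
rewrite /psum -(series_below n w0v); apply: eq_eseriesr => i _.
by rewrite /below; case: ifP => // _; rewrite mule0.
Qed.

Section A_and_B.
Variables (E0 : function_norm R) (p alpha : R).
Hypotheses (hE0 : ri_space E0) (p0 : (0 < p)%R).

Definition slow (g : R) (n : nat) : R := ((1 + n%:R) `^ (g - 1))%R.

Lemma reg_slow (e : R) : reg 0 (slow e). Proof. exact: reg0_succ_powR. Qed.

Let kp : (0 <= p^-1)%R. Proof. by rewrite invr_ge0 ltW. Qed.
Let slow_ge0 (e : R) n : (0 <= slow e n)%R. Proof. exact: (reg_ge0 _ (reg_slow e)). Qed.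
Let ell_ge0 (e t : R) : (0 <= ell t `^ e)%R. Proof. exact: powR_ge0. Qed.

Lemma psum_wt_ge0 k G m : nonneg G -> 0 <= psum (wt (w0 k) G) m :> \bar R.
Proof. by move=> G0; apply: psum_ge0 => i; rewrite mule_ge0 ?expE_ge0. Qed.

(** For t in cell [n], the integral over (t, 1) lies, up to constants, between the sums over k < n
    and over k <= n. The upper bound is brought back by a shift, at the cost of one step of the slow
    weight. *)
Lemma A_norm_bridge : exists2 C : R, (0 < C)%R & forall f : R -> R,
  fnorm (A_space p alpha E0) f <= C%:E * Iop (nu E0) (slow alpha) p^-1 0 (avg (Fs f)) /\
  Iop (nu E0) (slow alpha) p^-1 0 (avg (Fs f)) <= C%:E * fnorm (A_space p alpha E0) f.
Proof.
have hn := ri_seq_norm hE0.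
have [Cl Cl0 Hl] := cellcmp_ell_powR (alpha - 1)%R.
have [Cu Cu0 Hu] := integral_upper kp; have [Cd Cd0 Hd] := integral_lower kp.
have [Cs Cs0 Hs] := reg_step (reg_slow alpha).
have e20 : (0 < expR 2 :> R)%R := expR_gt0 _.
have ce0 : (0 < cellmass R * expR (-1) :> R)%R by rewrite mulr_gt0 ?cellmass_gt0 ?expR_gt0.
pose C1 : R := (Cl * Cu * expR 2)%R; pose C2 : R := (Cl * Cd / (cellmass R * expR (-1)))%R.
have C10 : (0 < C1)%R by rewrite !mulr_gt0.
have C20 : (0 < C2)%R by apply: divr_gt0 => //; exact: mulr_gt0.
exists (C1 * Cs + C2)%R => [|f]; first by apply: addr_gt0 => //; exact: mulr_gt0.
set S := avg (Fs f); have S0 : nonneg S by apply/avg_ge0/Fs_ge0.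
have ps0 m := psum_wt_ge0 p^-1 m S0.
have Ig0 : 0 <= Iop (nu E0) (slow alpha) p^-1 0 S.
  by apply: (Iop_ge0 hn) => //; exact: reg_slow.
have int0 t : (0 < t)%R -> 0 <= \int[mu]_(s in `]t, 1%R[) ((s `^ p^-1 / s)%:E * fstarstar f s).
  move=> t0.
  apply: integral_ge0 => s; rewrite /= in_itv /= => /andP[ts _].
  have s0 : (0 < s)%R by exact: lt_trans ts.
  by rewrite mule_ge0 ?fstarstar_ge0 // lee_fin divr_ge0 ?powR_ge0 // ltW.
have ioE : (fun m => (slow alpha m)%:E * psum (above 0 (wt (w0 p^-1) S)) m) =
  (fun m => (slow alpha m)%:E * psum (wt (w0 p^-1) S) m) by rewrite above0.
have fn0 : 0 <= fnorm (A_space p alpha E0) f by apply: (ri_ge0 hE0); exact: Mplus_rearr.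
split.
- apply: (@le_trans _ _ ((C1 * Cs)%:E * Iop (nu E0) (slow alpha) p^-1 0 S)); last first.
    by apply: lee_wpM2r => //; rewrite lerDl ltW.
  apply: le_trans (@tnorm_upper E0 _ _ (fun n => (slow alpha n)%:E * psum (wt (w0 p^-1) S) n.+1) C1 hE0 C10 _ _ _) _ => //.
  + by move=> n; rewrite mule_ge0 // lee_fin.
  + move=> t; rewrite /= in_itv /= => t01; have /andP[t0 t1] := t01.
    have i0 : 0 <= \int[mu]_(s in `]t, 1%R[) ((s `^ p^-1 / s)%:E * fstarstar f s) by exact: int0.
    rewrite gee0_abs ?mule_ge0 ?lee_fin //.
    have tU : `]t, 1%R[ `<=` U.
      by move=> s; rewrite /= !in_itv /= => /andP[ts ->]; rewrite (lt_trans t0 ts).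
    have := Hu (`]t, 1%R[)%classic (fstarstar f) (below (tindex t).+1 (fun k => (expR 2)%:E * S k)) tU.
    rewrite series_wt_below => [|k]; last by rewrite mule_ge0 // lee_fin ltW.
    move=> h; have {}h := h (below_ge0 _ (fun k => mule_ge0 (expE_ge0 _) (S0 k))) _ _.
    apply: (@le_trans _ _ ((Cl * slow alpha (tindex t))%:E * (Cu%:E * ((expR 2)%:E * psum (wt (w0 p^-1) S) (tindex t).+1)))).
      apply: lee_pmul => //; first by rewrite lee_fin.
        by rewrite lee_fin; case: (Hl t t01).
      apply: le_trans (h _ _) _.
      * move=> s; rewrite /= in_itv /= => /andP[ts _]; apply: fstarstar_ge0; exact: lt_trans ts.
      * move=> s; rewrite /= in_itv /= => /andP[ts s1].
        have s01 : (0 < s < 1)%R by rewrite (lt_trans t0 ts).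
        rewrite /below ltnS (tindex_ni t0 (ltW ts) s1); exact: fstarstar_le.
      apply: lee_wpmul2l; first by rewrite lee_fin ltW.
      rewrite -psumZ ?(ltW e20) //; last by move=> i; rewrite mule_ge0 ?expE_ge0.
      by apply: le_psum => i; rewrite /wt muleCA.
    rewrite !muleA -!EFinM; apply: lee_wpM2r => //.
    by rewrite le_eqVlt; apply/orP; left; apply/eqP; rewrite /C1; ring.
  rewrite (EFinM C1 Cs) -muleA; apply: lee_wpmul2l; first by rewrite lee_fin ltW.
  pose V m := (slow alpha m)%:E * psum (wt (w0 p^-1) S) m.
  have V0 : nonneg V by move=> m; rewrite mule_ge0 // lee_fin.
  rewrite /Iop ioE; apply: le_trans (_ : Cs%:E * nu E0 (fun n => V (n + 1)%N) <= _).
    apply: (sn_le hn) => [|n|n|n]; first exact: ltW.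
    + by rewrite mule_ge0 // lee_fin.
    + exact: V0.
    + rewrite addn1 /V muleA -EFinM; apply: lee_wpM2r => //; by case: (Hs n).
  apply: lee_wpmul2l; first by rewrite lee_fin ltW.
  exact: (sn_shift hn 1 V0).
- apply: (@le_trans _ _ (C2%:E * fnorm (A_space p alpha E0) f)); last first.
    by apply: lee_wpM2r => //; rewrite lerDr mulr_ge0 // ltW.
  rewrite /Iop ioE; apply: tnorm_lower => // [n|t t01 _]; first by rewrite mule_ge0 // lee_fin.
  split; first by rewrite /= in_itv.
  have /andP[t0 t1] := t01.
  have i0 : 0 <= \int[mu]_(s in `]t, 1%R[) ((s `^ p^-1 / s)%:E * fstarstar f s) by exact: int0.
  rewrite gee0_abs ?mule_ge0 ?lee_fin //.
  have tU : `]t, 1%R[ `<=` U.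
    by move=> s; rewrite /= !in_itv /= => /andP[ts ->]; rewrite (lt_trans t0 ts).
  pose c := (cellmass R * expR (-1))%R.
  have cS0 : nonneg (fun k => c%:E * S k) by move=> k; rewrite mule_ge0 // lee_fin ltW.
  have := Hd (`]t, 1%R[)%classic (fstarstar f) (below (tindex t) (fun k => c%:E * S k)) tU (below_ge0 _ cS0).
  rewrite series_wt_below // => h.
  have {}h : psum (wt (w0 p^-1) (fun k => c%:E * S k)) (tindex t) <=
     Cd%:E * \int[mu]_(s in `]t, 1%R[) ((s `^ p^-1 / s)%:E * fstarstar f s).
    apply: h => s.
    + rewrite /= in_itv /= => /andP[ts _]; apply: fstarstar_ge0; exact: lt_trans ts.
    + move=> s01; rewrite /below; case: ifP => st; last by rewrite eqxx.
      move=> _; split; last exact: le_fstarstar.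
      by rewrite /= in_itv /= (lt_tindex t01 s01 st); case/andP: s01.
  have {}h : c%:E * psum (wt (w0 p^-1) S) (tindex t) <=
     Cd%:E * \int[mu]_(s in `]t, 1%R[) ((s `^ p^-1 / s)%:E * fstarstar f s).
    apply: le_trans h; rewrite -psumZ ?(ltW ce0) //; last by move=> i; rewrite mule_ge0 ?expE_ge0.
    by apply: le_psum => i; rewrite /wt muleCA.
  apply: (@le_trans _ _ ((Cl * ell t `^ (alpha - 1))%:E * (c^-1%:E * (Cd%:E * \int[mu]_(s in `]t, 1%R[) ((s `^ p^-1 / s)%:E * fstarstar f s))))).
    apply: lee_pmul => //; first by rewrite lee_fin.
      by rewrite lee_fin; case: (Hl t t01).
    by rewrite -lee_pdivrMl ?invr_gt0 // invrK.
  rewrite !muleA -!EFinM; apply: lee_wpM2r => //.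
  by rewrite le_eqVlt; apply/orP; left; apply/eqP; rewrite /C2 -/c; ring.
Qed.

End A_and_B.
End sandwich.

(** * Discrete norms of B, of the Lorentz spaces and of the spaces R,L *)

Section bridges.
Local Open Scope ereal_scope.
Variable R : realType.
Local Notation U := (`]0%R, 1%R[%classic : set R).
Implicit Types (f : R -> R).

Lemma slow_ge0 (e : R) n : (0 <= slow e n)%R. Proof. exact: (reg_ge0 _ (reg_slow e)). Qed.

Lemma reg_w1s (e k : R) : reg k (w1 (slow e) k).
Proof. exact: reg_w1 (reg_slow e). Qed.

Lemma w1s_ge0 (e k : R) n : (0 <= w1 (slow e) k n)%R.
Proof. exact: (reg_ge0 _ (reg_w1s e k)). Qed.

Lemma cellcmp_w1 (e k : R) : (0 <= k)%R ->
  cellcmp (fun s => s `^ k * ell s `^ (e - 1))%R (w1 (slow e) k).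
Proof.
move=> k0; apply: cellcmpM (cellpos_pow k) (cellpos_powR _ (cellpos_ell R)) _ _.
  exact: cellcmp_pow.
exact: cellcmp_ell_powR.
Qed.

Lemma w1E_ge0 (k e s : R) : (0 <= s `^ k * ell s `^ (e - 1))%R.
Proof. by rewrite mulr_ge0 // powR_ge0. Qed.

(** The squeeze of f* pairs a weight at [n] with a value at [n.+1]; this turns the product into a
    single term at [n.+1]. *)
Lemma wt_step (k : R) (w : nat -> R) : reg k w -> exists2 C : R, (0 < C)%R &
  forall G, nonneg G -> {homo G : i j / (i <= j)%N >-> i <= j} ->
    forall n, (w n)%:E * G n.+1 <= C%:E * wt w G n.+1 /\ wt w G n <= C%:E * wt w G n.+1.
Proof.
move=> rw; have [C C0 H] := reg_step rw; exists C => // G G0 Gnd n.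
have h : (w n)%:E * G n.+1 <= C%:E * wt w G n.+1.
  by rewrite /wt muleA -EFinM; apply: lee_wpM2r => //; case: (H n).
split=> //; apply: le_trans h; apply: lee_wpmul2l; last exact: Gnd.
by rewrite lee_fin (reg_ge0 _ rw).
Qed.

Lemma wt_nonneg (w : nat -> R) G : (forall n, 0 <= w n)%R -> nonneg G -> nonneg (wt w G).
Proof. by move=> w0' G0 n; rewrite mule_ge0 // lee_fin. Qed.

Section B_space_bridge.
Variables (E1 : function_norm R) (p beta : R).
Hypotheses (hE1 : ri_space E1) (p0 : (0 < p)%R).

Let kp : (0 <= p^-1)%R. Proof. by rewrite invr_ge0 ltW. Qed.
Let w := w1 (slow beta) p^-1.

Let val f s : \bar R := (s `^ p^-1 * ell s `^ (beta - 1))%:E * fstarstar f s.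

Let val_ge0 f s : (0 < s)%R -> 0 <= val f s.
Proof. by move=> s0; rewrite mule_ge0 ?fstarstar_ge0 // lee_fin w1E_ge0. Qed.

(** The interval (0, t) also meets the cell of t, which [tsup] excludes; [wt_step] moves each term
    to the next index. *)
Lemma B_norm_upper : exists2 C : R, (0 < C)%R & forall f,
  fnorm (B_space p beta E1) f <= C%:E * normB (nu E1) (slow beta) p^-1 (avg (Fs f)).
Proof.
have [C1 C10 H1] := cellcmp_w1 beta kp.
have [C2 C20 H2] := wt_step (reg_w1s beta p^-1).
have e20 : (0 < expR 2 :> R)%R := expR_gt0 _.
exists (C1 * expR 2 * C2)%R => [|f]; first by rewrite !mulr_gt0.
set S := avg (Fs f); have S0 : nonneg S by apply/avg_ge0/Fs_ge0.
have Snd : {homo S : i j / (i <= j)%N >-> i <= j} by apply: avg_nd; [exact: Fs_nd|exact: Fs_ge0].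
have wS0 : nonneg (wt w S) by apply: wt_nonneg => // n; exact: w1s_ge0.
apply: tnorm_upper => //; [by rewrite !mulr_gt0|exact: tsup_ge0|].
move=> t; rewrite /= in_itv /= => t01; have /andP[t0 t1] := t01.
rewrite gee0_abs; last first.
  (* A supremum is nonnegative only if its set is nonempty; t / 2 is a witness. *)
  have t2 : (0 < t / 2)%R by rewrite divr_gt0.
  apply: le_trans (val_ge0 f t2) _; apply: ereal_sup_ubound; exists (t / 2)%R => //=.
  by rewrite in_itv /= t2 /= ltr_pdivrMr // ltr_pMr // ltr1n.
apply: ge_ereal_sup => _ [s /= + <-]; rewrite in_itv /= => /andP[s0 st].
have s01 : (0 < s < 1)%R by rewrite s0 (lt_trans st).
apply: (@le_trans _ _ ((C1 * w (tindex s))%:E * ((expR 2)%:E * S (tindex s)))).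
  apply: lee_pmul; rewrite ?fstarstar_ge0 ?lee_fin ?w1E_ge0 //.
    by case: (H1 s s01).
  exact: fstarstar_le.
have -> : (C1 * w (tindex s))%:E * ((expR 2)%:E * S (tindex s)) =
    (C1 * expR 2)%:E * wt w S (tindex s).
  by rewrite /wt !muleA -!EFinM; congr (_%:E * _); ring.
rewrite (EFinM (C1 * expR 2) C2) -muleA; apply: lee_wpmul2l; first by rewrite lee_fin mulr_ge0 // ltW.
apply: le_trans (H2 S S0 Snd (tindex s)).2 _; apply: lee_wpmul2l; first by rewrite lee_fin ltW.
by apply: le_tsup; rewrite ltnS (tindex_ni s0 (ltW st) t1).
Qed.

Lemma expRNn_cell (k : nat) : (0 < k)%N ->
  (0 < (expR (- k%:R) : R) < 1)%R /\ tindex (expR (- k%:R) : R) = k.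
Proof.
move=> k0; split; first by rewrite expR_gt0 expR_lt1 oppr_lt0 ltr0n.
by apply: tindexE; rewrite lexx andbT ltr_expR ltrN2 ltr_nat.
Qed.

Lemma B_norm_lower : exists2 C : R, (0 < C)%R & forall f,
  normB (nu E1) (slow beta) p^-1 (avg (Fs f)) <= C%:E * fnorm (B_space p beta E1) f.
Proof.
have [C1 C10 H1] := cellcmp_w1 beta kp.
have ce0 : (0 < cellmass R * expR (-1) :> R)%R by rewrite mulr_gt0 ?cellmass_gt0 ?expR_gt0.
pose c : R := (cellmass R * expR (-1))%R.
exists (C1 / c)%R => [|f]; first by rewrite divr_gt0.
set S := avg (Fs f); have S0 : nonneg S by apply/avg_ge0/Fs_ge0.
have wS0 : nonneg (wt w S) by apply: wt_nonneg => // n; exact: w1s_ge0.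
apply: tnorm_lower => //; [by rewrite divr_gt0|exact: tsup_ge0|].
move=> t t01 _; split; first by rewrite /= in_itv.
apply: tsup_le => k tk.
(* The term [k] is sampled at s = e^-k, which belongs to its own cell because [k] is positive
   here. *)
have [s01 sk] := expRNn_cell (leq_ltn_trans (leq0n _) tk).
have st : (expR (- k%:R) < t)%R by apply: lt_tindex => //; rewrite sk.
set s := expR (- k%:R) in s01 sk st *; have /andP[s0 s1] := s01.
apply: (@le_trans _ _ ((C1 / c)%:E * val f s)); last first.
  apply: lee_wpmul2l; first by rewrite lee_fin ltW // divr_gt0.
  apply: le_trans (lee_abs _); apply: ereal_sup_ubound; exists s => //=.
  by rewrite in_itv /= s0.
have [_ h1] := H1 s s01; have := le_fstarstar f s01; rewrite sk -/S -/c => h2.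
rewrite /wt -sk; apply: (@le_trans _ _ ((C1 * (s `^ p^-1 * ell s `^ (beta - 1)))%:E * ((c^-1)%:E * fstarstar f s))).
  apply: lee_pmul; rewrite ?lee_fin ?w1s_ge0 //.
  by rewrite sk -lee_pdivrMl ?invr_gt0 // invrK.
rewrite /val; have := fstarstar_ge0 f s0; move: (fstarstar f s) => x x0.
by rewrite !muleA -!EFinM; apply: lee_wpM2r => //; rewrite le_eqVlt; apply/orP; left; apply/eqP; ring.
Qed.

End B_space_bridge.

Section L_space_bridge.
Variables (E : function_norm R) (W : R -> R) (w : nat -> R) (k : R).
Hypotheses (hE : ri_space E) (cWw : cellcmp W w) (pWw : cellpos W w) (rw : reg k w).

Lemma L_norm_upper : exists2 C : R, (0 < C)%R & forall f,
  tnorm E U (fun t => (W t)%:E * fstar f t) <= C%:E * nu E (wt w (Fs f)).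
Proof.
have [C1 C10 H1] := cWw; have [C2 C20 H2] := wt_step rw.
have hn := ri_seq_norm hE.
exists (C1 * C2)%R => [|f]; first by rewrite mulr_gt0.
have F0 := Fs_ge0 f; have wF0 := wt_ge0 rw F0.
apply: (@le_trans _ _ ((C1 * C2)%:E * nu E (fun n => wt w (Fs f) (n + 1)%N))).
  apply: tnorm_upper => // [|t]; first by rewrite mulr_gt0.
  rewrite /= in_itv /= => t01; have W0 : (0 <= W t)%R by apply/ltW/pWw.1.
  rewrite gee0_abs; last by rewrite mule_ge0 ?fstar_ge0 // lee_fin.
  rewrite addn1 EFinM -muleA; apply: (@le_trans _ _ (C1%:E * ((w (tindex t))%:E * Fs f (tindex t).+1))).
    rewrite muleA -EFinM; apply: lee_pmul; rewrite ?lee_fin ?fstar_ge0 //.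
      by case: (H1 t t01).
    by case: (fstar_cell f t01).
  apply: lee_wpmul2l; first by rewrite lee_fin ltW.
  exact: (H2 _ F0 (Fs_nd f) (tindex t)).1.
apply: lee_wpmul2l; first by rewrite lee_fin mulr_ge0 // ltW.
exact: (sn_shift hn 1 wF0).
Qed.

Lemma L_norm_lower : exists2 C : R, (0 < C)%R & forall f,
  nu E (wt w (Fs f)) <= C%:E * tnorm E U (fun t => (W t)%:E * fstar f t).
Proof.
have [C1 C10 H1] := cWw; exists C1 => // f.
have F0 := Fs_ge0 f; have wF0 := wt_ge0 rw F0.
apply: tnorm_lower => // t t01 _; split; first by rewrite /= in_itv.
have W0 : (0 <= W t)%R by apply/ltW/pWw.1.
rewrite gee0_abs; last by rewrite mule_ge0 ?fstar_ge0 // lee_fin.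
rewrite muleA -EFinM; apply: lee_pmul; rewrite ?lee_fin ?(reg_ge0 _ rw) //.
  by case: (H1 t t01).
by case: (fstar_cell f t01).
Qed.

End L_space_bridge.

Section weighted_norm.
Variables (E : function_norm R) (c : R -> R) (cs : nat -> R).
Variables (g : (R -> R) -> R -> \bar R) (v : (R -> R) -> nat -> \bar R) (C1 : R).
Hypotheses (hE : ri_space E) (cc : cellcmp c cs) (pc : cellpos c cs).
Hypotheses (C10 : (0 < C1)%R) (g0 : forall f u, 0 <= g f u) (v0 : forall f, nonneg (v f)).

Let wv0 f : nonneg (wt cs (v f)).
Proof. by move=> n; apply: mule_ge0; rewrite ?lee_fin ?(ltW (pc.2 n)) //; exact: v0. Qed.

Let abs_cg f u : (0 < u < 1)%R -> `|(c u)%:E * g f u| = (c u)%:E * g f u.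
Proof. by move=> u01; rewrite gee0_abs // mule_ge0 // lee_fin ltW // pc.1. Qed.

Lemma weighted_upper :
  (forall f u, (0 < u < 1)%R -> g f u <= C1%:E * v f (tindex u)) ->
  exists2 C : R, (0 < C)%R & forall f,
    tnorm E U (fun u => (c u)%:E * g f u) <= C%:E * nu E (wt cs (v f)).
Proof.
move=> H1; have [C2 C20 H2] := cc; exists (C2 * C1)%R => [|f]; first by rewrite mulr_gt0.
apply: tnorm_upper => //; first by rewrite mulr_gt0.
move=> u; rewrite /= in_itv /= => u01; rewrite abs_cg //.
have -> : (C2 * C1)%:E * wt cs (v f) (tindex u) =
   (C2 * cs (tindex u))%:E * (C1%:E * v f (tindex u)).
  by rewrite /wt !muleA -!EFinM; congr (_%:E * _); ring.
apply: lee_pmul => //; last exact: H1.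
  by rewrite lee_fin ltW // pc.1.
by rewrite lee_fin; case: (H2 u u01).
Qed.

Lemma weighted_lower :
  (forall f u, (0 < u < 1)%R -> v f (tindex u) <= C1%:E * g f u) ->
  exists2 C : R, (0 < C)%R & forall f,
    nu E (wt cs (v f)) <= C%:E * tnorm E U (fun u => (c u)%:E * g f u).
Proof.
move=> H1; have [C2 C20 H2] := cc; exists (C2 * C1)%R => [|f]; first by rewrite mulr_gt0.
apply: tnorm_lower => //; first by rewrite mulr_gt0.
move=> u u01 _; split; first by rewrite /= in_itv.
rewrite abs_cg //.
have -> : (C2 * C1)%:E * ((c u)%:E * g f u) = (C2 * c u)%:E * (C1%:E * g f u).
  by rewrite !muleA -!EFinM; congr (_%:E * _); ring.
apply: lee_pmul; last exact: H1.
- by rewrite lee_fin ltW // pc.2.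
- exact: v0.
- by rewrite lee_fin; case: (H2 u u01).
Qed.

End weighted_norm.

Section LRL_bridge.
Variables (E E0 : function_norm R) (p alpha : R) (c : R -> R) (cs : nat -> R).
Hypotheses (hE : ri_space E) (hE0 : ri_space E0) (p0 : (0 < p)%R).
Hypotheses (cc : cellcmp c cs) (pc : cellpos c cs).

Let kp : (0 <= p^-1)%R. Proof. by rewrite invr_ge0 ltW. Qed.
Let hn0 := ri_seq_norm hE0.
Let hn := ri_seq_norm hE.
Let a := slow alpha.
Let w := w0 p^-1 : nat -> R.
Let rw0 : reg p^-1 w. Proof. exact: reg_w0. Qed.
Let I n G := Iop (nu E0) a p^-1 n G.

Let inner1 f t u := tnorm (Lq 1%E) `]t, u[ (fun s => (s `^ p^-1 * 1)%:E * fstar f s).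
Let inner2 f u := tnorm E0 `]0%R, u[ (fun t => (ell t `^ (alpha - 1))%:E * inner1 f t u).

Let sub_U (t u : R) : (0 <= t)%R -> (u <= 1)%R -> `]t, u[ `<=` U.
Proof.
by move=> t0 u1 s; rewrite /= !in_itv /= => /andP[ts su]; rewrite (le_lt_trans t0 ts) (lt_le_trans su).
Qed.

Let val_ge0 f (s : R) : 0 <= (s `^ p^-1 * 1)%:E * fstar f s.
Proof. by rewrite mule_ge0 ?fstar_ge0 // lee_fin mulr1 powR_ge0. Qed.

Let inner1_ge0 f t u : 0 <= inner1 f t u.
Proof. exact: Lnorm_ge0. Qed.

(** For u in cell [n] and t in cell [m], the indices n < k < m are those of the cells contained in
    (t, u). *)
Let PS f n m := psum (above n.+1 (wt w (Fs f))) m.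

Let PS_ge0 f n m : 0 <= PS f n m.
Proof. by apply/psum_ge0/above_ge0/(wt_ge0 rw0)/Fs_ge0. Qed.

(** The interval (t, u) also meets the cells of u and t. Moving every term to the next index puts
    the cell of u back in range, and the last index becomes [(tindex t).+1], whence the bound
    [.+2]. *)
Let inner1_upper : exists2 C : R, (0 < C)%R & forall f t u, (0 < t < 1)%R -> (0 < u < 1)%R ->
  inner1 f t u <= C%:E * PS f (tindex u) (tindex t).+2.
Proof.
have [C1 C10 H1] := cellcmp_pow kp; have [C2 C20 H2] := wt_step rw0.
exists (C1 * C2)%R => [|f t u t01 u01]; first by rewrite mulr_gt0.
have /andP[t0 t1] := t01; have /andP[u0 u1] := u01.
have F0 := Fs_ge0 f; have wF0 := wt_ge0 rw0 F0.
pose v k := below (tindex t).+1 (above (tindex u) (fun k => (C1 * w k)%:E * Fs f k.+1)) k.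
have z0 k : 0 <= (C1 * w k)%:E * Fs f k.+1.
  by rewrite mule_ge0 // lee_fin mulr_ge0 ?(reg_ge0 _ rw0) // ltW.
have v0 : nonneg v by exact/below_ge0/above_ge0.
apply: (@le_trans _ _ (nu (Lq 1%E) v)).
  apply: tnorm_le_nu => //; [exact: Lq1_emono|exact: Lq1_eequi|exact: sub_U (ltW t0) (ltW u1)|].
  move=> s; rewrite /= in_itv /= => /andP[ts su].
  have s01 : (0 < s < 1)%R by rewrite (lt_trans t0 ts) (lt_trans su u1).
  have /andP[s0 s1] := s01.
  rewrite gee0_abs // /v /below ltnS (tindex_ni t0 (ltW ts) s1) /above (tindex_ni s0 (ltW su) u1).
  rewrite mulr1; apply: lee_pmul; rewrite ?lee_fin ?powR_ge0 ?fstar_ge0 //.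
    by case: (H1 s s01).
  by case: (fstar_cell f s01).
rewrite nu_Lq1 // series_below; last exact: above_ge0.
apply: (@le_trans _ _ ((C1 * C2)%:E * psum (fun k => above (tindex u).+1 (wt w (Fs f)) (k + 1)%N) (tindex t).+1)); last first.
  apply: lee_wpmul2l; first by rewrite lee_fin mulr_ge0 // ltW.
  by rewrite -[X in _ <= PS _ _ X]addn1; apply/psum_shift/above_ge0.
have ab0 : nonneg (fun k => above (tindex u).+1 (wt w (Fs f)) (k + 1)%N).
  by move=> k; exact: above_ge0.
rewrite -psumZ ?mulr_ge0 ?(ltW C10) ?(ltW C20) //; apply: lee_sum => k _.
rewrite /above addn1 ltnS; case: ifP => _; last by rewrite mule0.
rewrite !EFinM -!muleA; apply: lee_wpmul2l; first by rewrite lee_fin ltW.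
exact: (H2 _ F0 (Fs_nd f) k).1.
Qed.

Let inner1_lower : exists2 C : R, (0 < C)%R & forall f t u, (0 < t < 1)%R -> (0 < u < 1)%R ->
  PS f (tindex u) (tindex t) <= C%:E * inner1 f t u.
Proof.
have [C1 C10 H1] := cellcmp_pow kp; exists C1 => // f t u t01 u01.
have F0 := Fs_ge0 f; have wF0 := wt_ge0 rw0 F0.
pose v k := below (tindex t) (above (tindex u).+1 (fun k => (C1^-1 * w k)%:E * Fs f k)) k.
have z0 k : 0 <= (C1^-1 * w k)%:E * Fs f k.
  by rewrite mule_ge0 // lee_fin mulr_ge0 ?(reg_ge0 _ rw0) // invr_ge0 ltW.
have v0 : nonneg v by exact/below_ge0/above_ge0.
rewrite -lee_pdivrMl //; apply: le_trans _ (_ : nu (Lq 1%E) v <= _); last first.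
  apply: nu_le_tnorm => //; [exact: Lq1_emono|exact: Lq1_eequi|].
  move=> s s01; rewrite /v /below /above; case: ifP => st; last by rewrite eqxx.
  case: ifP => us; last by rewrite eqxx.
  move=> _; split.
    by rewrite /= in_itv /= (lt_tindex t01 s01 st) (lt_tindex s01 u01 us).
  rewrite gee0_abs // mulr1; apply: lee_pmul => //.
  - by rewrite lee_fin mulr_ge0 ?(reg_ge0 _ rw0) // invr_ge0 ltW.
  - by rewrite lee_fin ler_pdivrMl //; case: (H1 s s01).
  - by case: (fstar_cell f s01).
rewrite nu_Lq1 // series_below; last exact: above_ge0.
rewrite /PS -psumZ ?invr_ge0 ?(ltW C10) //; last exact: above_ge0.
apply: lee_sum => k _; rewrite /above; case: ifP => _; last by rewrite mule0.
by rewrite /wt muleA -EFinM.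
Qed.

Let inner2_upper : exists2 C : R, (0 < C)%R & forall f u, (0 < u < 1)%R ->
  inner2 f u <= C%:E * I (tindex u).+1 (Fs f).
Proof.
have [C1 C10 H1] := inner1_upper; have [C2 C20 H2] := cellcmp_ell_powR (alpha - 1)%R.
have [C3 C30 H3] := reg_step (reg_slow alpha).
exists (C2 * C1 * (C3 * C3))%R => [|f u u01]; first by rewrite !mulr_gt0.
have V0 : nonneg (fun m => (a m)%:E * PS f (tindex u) m).
  by move=> m; rewrite mule_ge0 // lee_fin slow_ge0.
apply: (@le_trans _ _ ((C2 * C1)%:E * nu E0 (fun m => (a m)%:E * PS f (tindex u) m.+2))).
  have /andP[u0 u1] := u01.
  apply: tnorm_upper => //.
  - by rewrite mulr_gt0.
  - exact: sub_U (lexx _) (ltW u1).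
  - by move=> m; rewrite mule_ge0 // lee_fin slow_ge0.
  - move=> t; rewrite /= in_itv /= => /andP[t0 tu].
    have t01 : (0 < t < 1)%R by rewrite t0 (lt_trans tu).
    rewrite gee0_abs; last by rewrite mule_ge0 // lee_fin powR_ge0.
    have -> : (C2 * C1)%:E * ((a (tindex t))%:E * PS f (tindex u) (tindex t).+2) =
      (C2 * a (tindex t))%:E * (C1%:E * PS f (tindex u) (tindex t).+2).
      by rewrite !muleA -!EFinM; congr (_%:E * _); ring.
    apply: lee_pmul => //; first by rewrite lee_fin powR_ge0.
      by rewrite lee_fin; case: (H2 t t01).
    exact: H1.
rewrite (EFinM (C2 * C1)) -muleA; apply: lee_wpmul2l; first by rewrite lee_fin mulr_ge0 // ltW.
(* The weight follows the partial sum by two indices, so that the shift invariance of the norm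
   removes both. *)
apply: (@le_trans _ _ ((C3 * C3)%:E * nu E0 (fun m => (a (m + 2)%N)%:E * PS f (tindex u) (m + 2)%N))).
  apply: (sn_le hn0) => [|m|m|m].
  - by rewrite mulr_ge0 // ltW.
  - by rewrite mule_ge0 // lee_fin slow_ge0.
  - exact: (V0 (m + 2)%N).
  - rewrite addn2 muleA -EFinM; apply: lee_wpM2r => //.
    have [h1 _] := H3 m; have [h2 _] := H3 m.+1.
    by apply: (le_trans h1); rewrite -mulrA ler_pM2l.
apply: lee_wpmul2l; first by rewrite lee_fin mulr_ge0 // ltW.
exact: (sn_shift hn0 2 V0).
Qed.

Let inner2_lower : exists2 C : R, (0 < C)%R & forall f u, (0 < u < 1)%R ->
  I (tindex u).+1 (Fs f) <= C%:E * inner2 f u.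
Proof.
have [C1 C10 H1] := inner1_lower; have [C2 C20 H2] := cellcmp_ell_powR (alpha - 1)%R.
exists (C2 * C1)%R => [|f u u01]; first by rewrite !mulr_gt0.
apply: tnorm_lower => //; first by rewrite mulr_gt0.
  by move=> m; rewrite mule_ge0 ?lee_fin ?slow_ge0 //; exact: PS_ge0.
move=> t t01 nz.
(* A nonzero partial sum forces t into a cell beyond that of u, hence t < u. *)
have ut : (tindex u < tindex t)%N.
  rewrite ltnNge; apply: contraNN nz => tu.
  rewrite /psum big1 ?mule0 // => k _; rewrite /above; case: ifP => // uk.
  by have := leq_ltn_trans tu uk; rewrite ltnNge ltnW.
split.
  by rewrite /= in_itv /= (lt_tindex t01 u01 ut); case/andP: t01 => ->.
rewrite gee0_abs; last by rewrite mule_ge0 // lee_fin powR_ge0.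
have -> : (C2 * C1)%:E * ((ell t `^ (alpha - 1))%:E * inner1 f t u) =
   (C2 * ell t `^ (alpha - 1))%:E * (C1%:E * inner1 f t u).
  by rewrite !muleA -!EFinM; congr (_%:E * _); ring.
apply: lee_pmul; rewrite ?lee_fin ?slow_ge0 //; first exact: PS_ge0.
  by case: (H2 t t01).
exact: H1.
Qed.

Let inner2_ge0 f u : 0 <= inner2 f u.
Proof. by apply: (ri_ge0 hE0); exact: Mplus_rearr. Qed.

Let I_ge0 n f : 0 <= I n (Fs f).
Proof. by apply: Iop_ge0 => //; [exact: reg_slow|exact: Fs_ge0]. Qed.

Lemma LRL_upper : exists2 C : R, (0 < C)%R & forall f,
  fnorm (LRL_space p c E (fun u => ell u `^ (alpha - 1))%R E0 (fun=> 1%R) (Lq 1%E)) f <=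
  C%:E * nu E (wt cs (fun n => Iop (nu E0) (slow alpha) p^-1 n.+1 (Fs f))).
Proof.
have [C1 C10 H1] := inner2_upper.
exact: (weighted_upper hE cc pc C10 inner2_ge0 (fun f n => I_ge0 n.+1 f) H1).
Qed.

Lemma LRL_lower : exists2 C : R, (0 < C)%R & forall f,
  nu E (wt cs (fun n => Iop (nu E0) (slow alpha) p^-1 n.+1 (Fs f))) <= C%:E *
  fnorm (LRL_space p c E (fun u => ell u `^ (alpha - 1))%R E0 (fun=> 1%R) (Lq 1%E)) f.
Proof.
have [C1 C10 H1] := inner2_lower.
exact: (weighted_lower hE cc pc C10 inner2_ge0 (fun f n => I_ge0 n.+1 f) H1).
Qed.

End LRL_bridge.
End bridges.

(** * Discrete norms of the spaces L,R *)

Section LLR_bridge.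
Local Open Scope ereal_scope.
Variable R : realType.
Local Notation U := (`]0%R, 1%R[%classic : set R).
Implicit Types (f : R -> R).
Variables (E E1 : function_norm R) (p beta : R) (c : R -> R) (cs : nat -> R).
Hypotheses (hE : ri_space E) (hE1 : ri_space E1) (p0 : (0 < p)%R).
Hypotheses (cc : cellcmp c cs) (pc : cellpos c cs).

Let kp : (0 <= p^-1)%R. Proof. by rewrite invr_ge0 ltW. Qed.
Let hn1 := ri_seq_norm hE1.
Let w := w1 (slow beta) p^-1.
Let J n G := Jop (nu E1) (slow beta) p^-1 n G.

Let inner1 f u t :=
  tnorm (Lq +oo%E) `]u, t[ (fun s => (s `^ p^-1 * ell s `^ (beta - 1))%:E * fstar f s).
Let inner2 f u := tnorm E1 `]u, 1%R[ (fun t => 1%:E * inner1 f u t).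

Let val_ge0 f (s : R) : 0 <= (s `^ p^-1 * ell s `^ (beta - 1))%:E * fstar f s.
Proof. by rewrite mule_ge0 ?fstar_ge0 // lee_fin w1E_ge0. Qed.

Let inner1_ge0 f t u : 0 <= inner1 f t u.
Proof. exact: Lnorm_ge0. Qed.

Let wF_ge0 f : nonneg (wt w (Fs f)).
Proof. by apply: wt_nonneg => [n|]; [exact: w1s_ge0|exact: Fs_ge0]. Qed.

Let TS f n m := tsup (below n (wt w (Fs f))) m.

Let TS_ge0 f n m : 0 <= TS f n m.
Proof. exact/tsup_ge0/below_ge0. Qed.

Let inner1_upper : exists2 C : R, (0 < C)%R & forall f t u, (0 < t < 1)%R -> (0 < u < 1)%R ->
  inner1 f u t <= C%:E * TS f (tindex u).+2 (tindex t).
Proof.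
have [C1 C10 H1] := cellcmp_w1 beta kp; have [C2 C20 H2] := wt_step (reg_w1s beta p^-1).
exists (C1 * C2)%R => [|f t u t01 u01]; first by rewrite mulr_gt0.
have /andP[t0 t1] := t01; have /andP[u0 u1] := u01.
set M := (C1 * C2)%:E * _.
have M0 : 0 <= M by rewrite mule_ge0 ?TS_ge0 // lee_fin mulr_ge0 // ltW.
(* A uniform bound suffices for L_oo: a constant sequence has norm at most that constant. *)
apply: (@le_trans _ _ (nu (Lq +oo%E) (fun=> M))); last exact: nu_Lqy_le.
apply: tnorm_le_nu => //; [exact: Lqy_emono|exact: Lqy_eequi| |].
  by move=> s; rewrite /= !in_itv /= => /andP[us st]; rewrite (lt_trans u0 us) (lt_trans st).
move=> s; rewrite /= in_itv /= => /andP[us st].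
have s01 : (0 < s < 1)%R by rewrite (lt_trans u0 us) (lt_trans st t1).
have /andP[s0 s1] := s01.
rewrite gee0_abs //.
apply: (@le_trans _ _ (C1%:E * ((w (tindex s))%:E * Fs f (tindex s).+1))).
  rewrite muleA -EFinM; apply: lee_pmul; rewrite ?lee_fin ?w1E_ge0 ?fstar_ge0 //.
    by case: (H1 s s01).
  by case: (fstar_cell f s01).
rewrite /M (EFinM C1 C2) -muleA; apply: lee_wpmul2l; first by rewrite lee_fin ltW.
apply: le_trans (H2 _ (Fs_ge0 f) (Fs_nd f) (tindex s)).1 _.
apply: lee_wpmul2l; first by rewrite lee_fin ltW.
have b : (wt w (Fs f) (tindex s).+1) = below (tindex u).+2 (wt w (Fs f)) (tindex s).+1.
  by rewrite /below !ltnS (tindex_ni u0 (ltW us) s1).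
rewrite -/w b; apply: le_tsup; rewrite ltnS; exact: tindex_ni s0 (ltW st) t1.
Qed.

Let inner1_lower : exists2 C : R, (0 < C)%R & forall f t u, (0 < t < 1)%R -> (0 < u < 1)%R ->
  TS f (tindex u) (tindex t) <= C%:E * inner1 f u t.
Proof.
have [C1 C10 H1] := cellcmp_w1 beta kp; exists C1 => // f t u t01 u01.
apply: tsup_le => k tk; rewrite /below; case: ifP => ku; last first.
  by rewrite mule_ge0 // lee_fin ltW.
rewrite -lee_pdivrMl //.
(* Each term of the supremum is tested on its single cell, which lies inside (u, t). *)
pose v j := if j == k then (C1^-1)%:E * wt w (Fs f) k else 0.
have v0 : nonneg v.
  by move=> j; rewrite /v; case: eqP => // _; apply: mule_ge0; [rewrite lee_fin invr_ge0 ltW|exact: wF_ge0].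
apply: le_trans (_ : nu (Lq +oo%E) v <= _).
  by have := nu_Lqy_ge k v0; rewrite {1}/v eqxx.
apply: nu_le_tnorm => //; [exact: Lqy_emono|exact: Lqy_eequi|].
move=> s s01; rewrite /v; case: (tindex s =P k) => [sk _|_]; last by rewrite eqxx.
split.
  by rewrite /= in_itv /= (lt_tindex u01 s01) ?sk // (lt_tindex s01 t01) ?sk.
rewrite gee0_abs // -sk /wt muleA -EFinM; apply: lee_pmul.
- by rewrite lee_fin mulr_ge0 ?w1s_ge0 // invr_ge0 ltW.
- exact: Fs_ge0.
- by rewrite lee_fin ler_pdivrMl //; case: (H1 s s01).
- by case: (fstar_cell f s01).
Qed.

Let inner2_upper : exists2 C : R, (0 < C)%R & forall f u, (0 < u < 1)%R ->
  inner2 f u <= C%:E * J (tindex u).+2 (Fs f).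
Proof.
have [C1 C10 H1] := inner1_upper.
exists C1 => // f u u01; have /andP[u0 u1] := u01.
apply: tnorm_upper => // [|m|t]; [|exact: TS_ge0|].
  by move=> s; rewrite /= !in_itv /= => /andP[us ->]; rewrite (lt_trans u0 us).
rewrite /= in_itv /= => /andP[ut t1].
by rewrite mul1e gee0_abs //; apply: H1 => //; rewrite (lt_trans u0 ut).
Qed.

Let inner2_lower : exists2 C : R, (0 < C)%R & forall f u, (0 < u < 1)%R ->
  J (tindex u) (Fs f) <= C%:E * inner2 f u.
Proof.
have [C1 C10 H1] := inner1_lower.
exists C1 => // f u u01.
apply: tnorm_lower => // [m|t t01 nz]; first exact: TS_ge0.
have ut : (tindex t < tindex u)%N.
  rewrite ltnNge; apply: contraNN nz => ut; rewrite eq_le tsup_ge0 ?andbT; last exact: below_ge0.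
  apply: tsup_le => k tk; rewrite /below; case: ifP => // ku.
  by have := leq_trans (ltn_trans tk ku) ut; rewrite ltnn.
split; first by rewrite /= in_itv /= (lt_tindex u01 t01 ut); case/andP: t01 => _ ->.
by rewrite mul1e gee0_abs //; exact: H1.
Qed.

Let inner2_ge0 f u : 0 <= inner2 f u.
Proof. by apply: (ri_ge0 hE1); exact: Mplus_rearr. Qed.

Let J_ge0 n f : 0 <= J n (Fs f).
Proof. by apply: Jop_ge0 => //; [exact: reg_slow|exact: Fs_ge0]. Qed.

(** The index exceeds that of [LLR_lower] by two; [JF_shift] closes the gap. *)
Lemma LLR_upper : exists2 C : R, (0 < C)%R & forall f,
  fnorm (LLR_space p c E (fun=> 1%R) E1 (fun u => ell u `^ (beta - 1))%R (Lq +oo%E)) f <=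
  C%:E * nu E (wt cs (fun n => Jop (nu E1) (slow beta) p^-1 n.+2 (Fs f))).
Proof.
have [C1 C10 H1] := inner2_upper.
exact: (weighted_upper hE cc pc C10 inner2_ge0 (fun f n => J_ge0 n.+2 f) H1).
Qed.

Lemma LLR_lower : exists2 C : R, (0 < C)%R & forall f,
  nu E (wt cs (fun n => Jop (nu E1) (slow beta) p^-1 n (Fs f))) <= C%:E *
  fnorm (LLR_space p c E (fun=> 1%R) E1 (fun u => ell u `^ (beta - 1))%R (Lq +oo%E)) f.
Proof.
have [C1 C10 H1] := inner2_lower.
exact: (weighted_lower hE cc pc C10 inner2_ge0 (fun f n => J_ge0 n f) H1).
Qed.

End LLR_bridge.

(** * The weights of the theorem on the cells *)

Section space_weights.
Variable R : realType.
Variables (E0 E1 : function_norm R) (p0 p1 alpha beta : R) (b : R -> R).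
Hypotheses (hE0 : ri_space E0) (hE1 : ri_space E1) (hb : SV b).
Hypotheses (p0_gt0 : 0 < p0) (p01 : p0 <= p1) (halpha : alpha < 1).
Hypothesis halphaE0 : (E0 (fun u => ((1 + u) `^ (alpha - 1))%:E) < +oo)%E.

Let hn0 := ri_seq_norm hE0.
Let hn1 := ri_seq_norm hE1.

(** If m is the integer part of x then 1 + m >= (1 + x) / 2; as the exponent alpha - 1 is negative,
    the loss is 2^(1 - alpha). *)
Lemma nu_slow_lty : (nu E0 (fun n => (slow alpha n)%:E) < +oo)%E.
Proof.
pose h (x : R) := (((1 + x) `^ (alpha - 1))%:E)%E.
have h0 x : (0 <= h x)%E by rewrite lee_fin powR_ge0.
have Mh : Mplus h.
  split=> [|x _ //]; apply/measurable_EFinP.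
  apply: (measurableT_comp (measurable_powR (alpha - 1))).
  by apply: measurable_funD; [exact: measurable_cst|exact: measurable_id].
have c0 : 0 <= 2 `^ (1 - alpha) :> R by exact: powR_ge0.
apply: (@le_lt_trans _ _ ((2 `^ (1 - alpha))%:E * E0 h)%E); last first.
  by rewrite lte_mul_pinfty.
rewrite -(ri_scale hE0) //; apply: (ri_emono hE0).
- by apply: (Mplus_step (v := fun n => (slow alpha n)%:E)) => n; rewrite lee_fin powR_ge0.
- split=> [|x _]; last by rewrite mule_ge0.
  by apply: measurable_funeM; case: Mh.
move=> x x0; rewrite /h /slow -EFinM lee_fin.
have /andP[_ xt] := truncn_itv (ltW x0); rewrite -natr1 in xt.
set m := (Num.truncn x)%:R in xt *; have m0 : 0 <= m by rewrite /m.
have y0 : 0 < 1 + x by lra.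
have -> : 2 `^ (1 - alpha) * (1 + x) `^ (alpha - 1) = ((1 + x) / 2) `^ (alpha - 1).
  rewrite powRM ?invr_ge0 ?(ltW y0) // -powR_inv1 // -powRrM mulrC; congr (_ * 2 `^ _); ring.
have e : alpha - 1 = - (1 - alpha) by ring.
rewrite e !powRN lef_pV2 ?posrE ?powR_gt0 ?divr_gt0 //; last by lra.
apply: ge0_ler_powR; rewrite ?subr_ge0 ?(ltW halpha) ?nnegrE ?divr_ge0 ?(ltW y0) //; first by lra.
by rewrite ler_pdivrMr //; lra.
Qed.

Let A := wA (nu E0) (slow alpha).
Let P := wP (nu E1).

(** For u in cell [n], the norm over (0, u) is squeezed between the tail norms from [n.+1] and from
    [n]. The upper bound also shows that [fine] is applied to a finite value. *)
Lemma cellpos_wA : cellpos (ell_norm alpha E0) A /\ cellcmp (ell_norm alpha E0) A.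
Proof.
have fa := nu_slow_lty; have rA := reg_wA hn0 (reg_slow alpha) fa.
have [C1 C10 H1] := cellcmp_ell_powR (R := R) (alpha - 1).
have [C2 C20 H2] := reg_step rA.
pose N u := tnorm E0 `]0%R, u[ (fun t => (ell t `^ (alpha - 1))%:E).
have v0 n : nonneg (fun m => if (n <= m)%N then (slow alpha m)%:E else 0)%E.
  by move=> m; case: ifP => // _; rewrite lee_fin slow_ge0.
have up u : 0 < u < 1 -> (N u <= (C1 * A (tindex u))%:E)%E.
  move=> /andP[u0 u1]; rewrite EFinM /A -wA_E //; last exact: reg_slow.
  apply: tnorm_upper => //.
    by move=> t; rewrite /= !in_itv /= => /andP[-> tu]; exact: lt_trans u1.
  move=> t; rewrite /= in_itv /= => /andP[t0 tu]; rewrite (tindex_ni t0 (ltW tu) u1).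
  rewrite ger0_norm ?powR_ge0 // -EFinM lee_fin.
  by have [] := H1 t; rewrite ?t0 ?(lt_trans tu).
have lo u : 0 < u < 1 -> ((A (tindex u).+1)%:E <= C1%:E * N u)%E.
  move=> u01; rewrite /A -wA_E //; last exact: reg_slow.
  apply: tnorm_lower => // t t01; case: ifP => [tu _|]; last by rewrite eqxx.
  split; first by rewrite /= in_itv /= (lt_tindex t01 u01 tu); case/andP: t01 => ->.
  rewrite /= ger0_norm ?powR_ge0 // -EFinM lee_fin.
  by have [] := H1 t t01.
have fin u : 0 < u < 1 -> N u = (ell_norm alpha E0 u)%:E.
  move=> u01; rewrite /ell_norm fineK // ge0_fin_numE; last first.
    by apply: (ri_ge0 hE0); exact: Mplus_rearr.
  by apply: le_lt_trans (up u u01) _; rewrite ltry.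
have A0 n : 0 < A n by exact: (reg_gt0 _ rA).
have up' u : 0 < u < 1 -> ell_norm alpha E0 u <= C1 * A (tindex u).
  by move=> u01; rewrite -lee_fin -fin //; exact: up.
have lo' u : 0 < u < 1 -> A (tindex u).+1 <= C1 * ell_norm alpha E0 u.
  by move=> u01; rewrite -lee_fin EFinM -fin //; exact: lo.
have pos u : 0 < u < 1 -> 0 < ell_norm alpha E0 u.
  by move=> u01; have := lt_le_trans (A0 _) (lo' u u01); rewrite pmulr_rgt0.
split; first by split.
exists (C1 + C2 * C1); first by rewrite addr_gt0 // mulr_gt0.
move=> u u01; split.
  apply: le_trans (up' u u01) _; apply: ler_wpM2r; first exact: ltW.
  by rewrite lerDl mulr_ge0 // ltW.
apply: (@le_trans _ _ (C2 * C1 * ell_norm alpha E0 u)).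
  by apply: le_trans (H2 _).1 _; rewrite -mulrA ler_pM2l //; exact: lo'.
by apply: ler_wpM2r; [exact/ltW/pos|rewrite lerDr ltW].
Qed.

Lemma fundamental_initnorm (s : R) (n : nat) :
  (s <= n%:R -> (fundamental E1 s <= initnorm (nu E1) n)%E) /\
  (n%:R <= s -> (initnorm (nu E1) n <= fundamental E1 s)%E).
Proof.
have M1 : Mplus (fun x : R => (\1_(`]0, s[ : set R) x)%:E).
  split=> [|x _]; last by rewrite lee_fin.
  by apply/measurable_EFinP; exact: measurable_funTS.
have M2 : Mplus (fun x : R => (if (Num.truncn x < n)%N then 1 else 0) : \bar R)%E.
  by apply: (@Mplus_step _ (fun m => if (m < n)%N then 1 else 0)%E) => m; case: ifP.
split=> ns; apply: (ri_emono hE1) => // x x0; rewrite indicE mem_setE /= in_itv /= x0 /=;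
  have /andP[a b'] := truncn_itv (ltW x0).
  case: ltP => xs; last by case: ifP.
  by rewrite ifT // -(ltr_nat R); exact: le_lt_trans (lt_le_trans xs ns).
case: ifP => xn; last by case: ltP.
have -> // : (x < s) = true.
apply: lt_le_trans b' _; apply: le_trans ns; by rewrite ler_nat.
Qed.

(** On cell [n], 1 + n <= ell < 2 + n, which places the fundamental function between [P n] and
    [P n.+1]. *)
Lemma cellpos_phi : cellpos (ell_phi beta E1) (fun n => slow beta n * P n) /\
  cellcmp (ell_phi beta E1) (fun n => slow beta n * P n).
Proof.
have rP := reg_wP hn1; have [C C0 H] := reg_step rP.
have P0 n : 0 < P n by exact: (reg_gt0 _ rP).
have up u : 0 < u < 1 -> (fundamental E1 (ell u) <= (P (tindex u).+1)%:E)%E.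
  move=> u01; rewrite /P -wP_E //; apply: (fundamental_initnorm _ _).1.
  by have /andP[_ /ltW] := ell_cell u01; rewrite -!natr1; lra.
have lo u : 0 < u < 1 -> ((P (tindex u))%:E <= fundamental E1 (ell u))%E.
  move=> u01; rewrite /P -wP_E //; apply: (fundamental_initnorm _ _).2.
  by rewrite -natr1 addrC; have /andP[] := ell_cell u01.
have fin u : 0 < u < 1 -> fundamental E1 (ell u) = (fine (fundamental E1 (ell u)))%:E.
  move=> u01; rewrite fineK // ge0_fin_numE.
    by apply: le_lt_trans (up u u01) _; rewrite ltry.
  by apply: le_trans (lo u u01); rewrite lee_fin ltW.
have up' u : 0 < u < 1 -> fine (fundamental E1 (ell u)) <= P (tindex u).+1.
  by move=> u01; rewrite -lee_fin -fin //; exact: up.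
have lo' u : 0 < u < 1 -> P (tindex u) <= fine (fundamental E1 (ell u)).
  by move=> u01; rewrite -lee_fin -fin //; exact: lo.
have pos : cellpos (fun u => fine (fundamental E1 (ell u))) P.
  by split=> // u u01; exact: lt_le_trans (lo' u u01).
have cmp : cellcmp (fun u => fine (fundamental E1 (ell u))) P.
  exists (C + 1) => [|u u01]; first by rewrite addr_gt0.
  have f0 := pos.1 u u01; have := lo' u u01; have := up' u u01.
  have [_] := H (tindex u); have := P0 (tindex u); rewrite -/P.
  by move=> h1 h2 h3 h4; split; nra.
have pe : cellpos (fun u : R => ell u `^ (beta - 1)) (slow beta) by exact: cellpos_ell_powR.
have ce : cellcmp (fun u : R => ell u `^ (beta - 1)) (slow beta) by exact: cellcmp_ell_powR.
by split; [exact: cellposM pe pos|exact: cellcmpM pe pos ce cmp].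
Qed.

Let rs := wrho (nu E0) (nu E1) (slow alpha) (slow beta) p0^-1 p1^-1.
Let dl0 : 0 <= p0^-1 - p1^-1.
Proof. by rewrite subr_ge0 lef_pV2 ?posrE // (lt_le_trans p0_gt0). Qed.

Lemma cellpos_rho : cellpos (rho p0 p1 alpha beta E0 E1) rs /\
  cellcmp (rho p0 p1 alpha beta E0 E1) rs.
Proof.
have [pA cA] := cellpos_wA; have [pP cP] := cellpos_phi.
have e n : expR (- ((p0^-1 - p1^-1) * n%:R)) * (A n * (slow beta n * P n)^-1) = rs n.
  rewrite /rs /wrho /w0 /w1 -/A -/P !invfM -expRN opprK.
  rewrite (_ : - ((p0^-1 - p1^-1) * n%:R) = - (p0^-1 * n%:R) + p1^-1 * n%:R); last by ring.
  by rewrite expRD; ring.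
split.
  have [h1 h2] := cellposM (cellpos_pow (p0^-1 - p1^-1)) (cellposM pA (cellposV pP)).
  by split=> [t t01|n]; [exact: h1|rewrite -e; exact: h2].
apply: (eq_cellcmp (fun _ _ => erefl) e).
apply: cellcmpM (cellpos_pow _) (cellposM pA (cellposV pP)) (cellcmp_pow dl0) _.
exact: cellcmpM pA (cellposV pP) cA (cellcmpV pP cP).
Qed.

(** A bounded quotient of [W] and [w] is a bounded distance in the logarithmic variable. *)
Lemma cellcmp_logb W w : cellpos W w -> cellcmp W w ->
  cellcmp (fun u => sv_ext b (W u)) (fun n => logb b (- ln (w n))).
Proof.
move=> [pW pw] [C C0 H]; have [D D0 K] := logb_slow hb ltr01.
exists (D * expR `|ln C|) => [|t t01]; first by rewrite mulr_gt0 ?expR_gt0.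
have W0 := pW t t01; have w0 := pw (tindex t); have [h1 h2] := H t t01.
have -> : sv_ext b (W t) = logb b (- ln (W t)) by rewrite /logb opprK lnK.
have d : `|- ln (W t) - - ln (w (tindex t))| <= `|ln C|.
  have a1 : ln (W t) <= ln C + ln (w (tindex t)).
    by rewrite -lnM ?posrE // ler_ln ?posrE // mulr_gt0.
  have a2 : ln (w (tindex t)) <= ln C + ln (W t).
    by rewrite -lnM ?posrE // ler_ln ?posrE // mulr_gt0.
  rewrite (le_trans _ (ler_norm _)) // ler_norml; apply/andP; split; lra.
have d' : `|- ln (w (tindex t)) - - ln (W t)| <= `|ln C| by rewrite distrC.
have L x y : `|x - y| <= `|ln C| -> logb b x <= D * expR `|ln C| * logb b y.
  move=> xy; apply: le_trans (K x y) _; apply: ler_wpM2r; first exact/ltW/logb_gt0.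
  by rewrite ler_pM2l // ler_expR mul1r.
by split; exact: L.
Qed.

(** Up to an additive constant, [- ln (w n)] varies by at most [K] = |k| + 1 per index; slow
    variation is therefore used with exponent [e / K]. *)
Lemma reg_logb k w : reg k w -> reg 0 (fun n => logb b (- ln (w n))).
Proof.
move=> rw; split=> [n|e e0]; first exact: logb_gt0.
have w0 n := reg_gt0 n rw.
have [_ /(_ _ ltr01)[C C0 H]] := rw.
pose K := `|k| + 1; have K0 : 0 < K by rewrite /K; have := normr_ge0 k; lra.
have e10 : 0 < e / K by rewrite divr_gt0.
have [D D0 L] := logb_slow hb e10.
exists (D * expR (e / K * `|ln C|)) => [|n j]; first by rewrite mulr_gt0 ?expR_gt0.
have [h1 h2] := H n j.
have a1 : ln (w (n + j)%N) <= ln C - (k - 1) * j%:R + ln (w n).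
  by rewrite -(expRK (- ((k - 1) * j%:R))) -!lnM ?posrE ?mulr_gt0 ?expR_gt0 // ler_ln ?posrE ?mulr_gt0 ?expR_gt0.
have a2 : ln (w n) <= ln C + (k + 1) * j%:R + ln (w (n + j)%N).
  by rewrite -(expRK ((k + 1) * j%:R)) -!lnM ?posrE ?mulr_gt0 ?expR_gt0 // ler_ln ?posrE ?mulr_gt0 ?expR_gt0.
have j0 : (0 : R) <= j%:R by [].
have k1 : k <= `|k| by exact: ler_norm.
have k2 : - k <= `|k| by rewrite -normrN ler_norm.
have c1 : ln C <= `|ln C| by exact: ler_norm.
have d : `|- ln (w n) - - ln (w (n + j)%N)| <= `|ln C| + K * j%:R.
  by rewrite ler_norml /K; apply/andP; split; nra.
have d' : `|- ln (w (n + j)%N) - - ln (w n)| <= `|ln C| + K * j%:R by rewrite distrC.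
have M x y : `|x - y| <= `|ln C| + K * j%:R ->
    logb b x <= D * expR (e / K * `|ln C|) * expR (e * j%:R) * logb b y.
  move=> xy; apply: le_trans (L x y) _; apply: ler_wpM2r; first exact/ltW/logb_gt0.
  rewrite -[leRHS]mulrA ler_pM2l // -expRD ler_expR.
  have -> : e * j%:R = e / K * (K * j%:R) by field; exact: lt0r_neq0.
  by rewrite -mulrDr ler_pM2l.
have -> : - ((0 - e) * j%:R) = e * j%:R by ring.
by rewrite add0r; split; exact: M.
Qed.

Definition bseq n := logb b (- ln (rs n)).

Lemma bseq_gt0 n : 0 < bseq n. Proof. exact: logb_gt0. Qed.

Lemma reg_rs : reg (p0^-1 - p1^-1) rs.
Proof. exact: (reg_wrho hn0 hn1 p0^-1 p1^-1 (reg_slow alpha) (reg_slow beta) nu_slow_lty). Qed.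

Lemma reg_bseq : reg 0 bseq.
Proof. exact: reg_logb reg_rs. Qed.

Lemma cellpos_b_rho : cellpos (fun u => sv_ext b (rho p0 p1 alpha beta E0 E1 u)) bseq.
Proof.
split=> [t t01|n]; last exact: bseq_gt0.
have [[h _] _] := cellpos_rho.
have -> : sv_ext b (rho p0 p1 alpha beta E0 E1 t) = logb b (- ln (rho p0 p1 alpha beta E0 E1 t)).
  by rewrite /logb opprK lnK // posrE h.
exact: logb_gt0.
Qed.

Lemma cellcmp_b_rho : cellcmp (fun u => sv_ext b (rho p0 p1 alpha beta E0 E1 u)) bseq.
Proof. by have [h1 h2] := cellpos_rho; exact: cellcmp_logb. Qed.

(* The weight of the K-functional in the discretised interpolation norm. *)
Definition Kweight theta n := (rs n `^ theta)^-1 * bseq n.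

Lemma Kweight_gt0 theta n : 0 < Kweight theta n.
Proof. by rewrite mulr_gt0 ?invr_gt0 ?powR_gt0 ?bseq_gt0 ?(reg_gt0 _ reg_rs). Qed.

Lemma reg_Kweight theta : 0 <= theta ->
  reg (- ((p0^-1 - p1^-1) * theta)) (Kweight theta).
Proof.
move=> t0; have := regM (regV (reg_powR t0 reg_rs)) reg_bseq.
by rewrite addr0.
Qed.

Lemma reg_Kweight_rs theta : 0 <= theta ->
  reg ((p0^-1 - p1^-1) * (1 - theta)) (fun n => Kweight theta n * rs n).
Proof.
by move=> t0; apply: eq_reg (regM (reg_Kweight t0) reg_rs) => //; ring.
Qed.

(** The weight put on the single term [n] by the first part of the K-functional. By the choice of
    rho, [LweightE] finds the same weight in the second part. *)
Definition Lweight theta n := Kweight theta n * A n * w0 p0^-1 n.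

Lemma LweightE theta n :
  Lweight theta n = Kweight theta n * rs n * P n * w1 (slow beta) p1^-1 n.
Proof.
have P0 : P n != 0 by exact: lt0r_neq0 (reg_gt0 _ (reg_wP hn1)).
have w10 : w1 (slow beta) p1^-1 n != 0.
  by exact: lt0r_neq0 (reg_gt0 _ (reg_w1 p1^-1 (reg_slow beta))).
rewrite /Lweight /rs /wrho -/A -/P; field.
by rewrite P0 w10.
Qed.

Lemma reg_Lweight theta : 0 <= theta ->
  reg ((1 - theta) / p0 + theta / p1) (Lweight theta).
Proof.
move=> t0; have := regM (regM (reg_Kweight t0) (reg_wA hn0 (reg_slow alpha) nu_slow_lty)) (reg_w0 p0^-1).
by apply: eq_reg => //; ring.
Qed.

Lemma cellcmp_Lweight theta p : 0 <= theta <= 1 -> p^-1 = (1 - theta) / p0 + theta / p1 ->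
  cellpos (fun t => t `^ p^-1 * Btheta theta p0 p1 alpha beta E0 E1 b t) (Lweight theta) /\
  cellcmp (fun t => t `^ p^-1 * Btheta theta p0 p1 alpha beta E0 E1 b t) (Lweight theta).
Proof.
move=> /andP[t0 t1] pE; have [pA cA] := cellpos_wA; have [pP cP] := cellpos_phi.
have t10 : 0 <= 1 - theta by rewrite subr_ge0.
have kp : 0 <= p^-1.
  by rewrite pE addr_ge0 // mulr_ge0 // invr_ge0 ltW // (lt_le_trans p0_gt0).
have e n : expR (- (p^-1 * n%:R)) * (A n `^ (1 - theta) * (slow beta n * P n) `^ theta * bseq n) =
    Lweight theta n.
  rewrite /Lweight /Kweight /rs /wrho -/A -/P /w1 /w0.
  have [h1 h2] := (pA.2 n, pP.2 n).
  have P0 : 0 < P n := reg_gt0 n (reg_wP hn1).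
  have s0 : 0 < slow beta n := reg_gt0 n (reg_slow beta).
  (* With all positive factors written as exponentials, the identity becomes linear in the
     exponents, and 1/p is the given convex combination. *)
  rewrite -(lnK (h1 : A n \is Num.pos)) -(lnK (P0 : P n \is Num.pos)) -(lnK (s0 : slow beta n \is Num.pos)).
  rewrite mulrA; set x := ln (A n); set y := ln (slow beta n); set z := ln (P n).
  suff -> : expR (- (p^-1 * n%:R)) * (expR x `^ (1 - theta) * (expR y * expR z) `^ theta) =
    ((expR x * expR (- (p0^-1 * n%:R)) / (expR z * (expR (- (p1^-1 * n%:R)) * expR y))) `^ theta)^-1 *
    expR x * expR (- (p0^-1 * n%:R)) by ring.
  do 6! rewrite -?expRD -?expRN -?expRM.
  by rewrite pE; congr expR; ring.
have pB := cellpos_b_rho; have cB := cellcmp_b_rho.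
have qA := cellpos_powR (1 - theta) pA; have qP := cellpos_powR theta pP.
split.
  have [h1 h2] := cellposM (cellpos_pow p^-1) (cellposM (cellposM qA qP) pB).
  by split=> [t t01|n]; [exact: h1|rewrite -e; exact: h2].
apply: (eq_cellcmp (fun _ _ => erefl) e).
apply: cellcmpM (cellpos_pow _) (cellposM (cellposM qA qP) pB) (cellcmp_pow kp) _.
apply: cellcmpM (cellposM qA qP) pB _ cB.
exact: cellcmpM qA qP (cellcmp_powR t10 pA cA) (cellcmp_powR t0 pP cP).
Qed.

End space_weights.

(** * The K-functional *)

Section K_functional.
Local Open Scope ereal_scope.
Variable R : realType.
Local Notation U := (`]0%R, 1%R[%classic : set R).
Implicit Types (f : R -> R).
Variables (E0 E1 : function_norm R) (p0 p1 alpha beta : R).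
Hypotheses (hE0 : ri_space E0) (hE1 : ri_space E1).
Hypotheses (p0_gt1 : (1 < p0)%R) (p01 : (p0 < p1)%R) (halpha : (alpha < 1)%R).
Hypothesis halphaE0 : E0 (fun u => ((1 + u) `^ (alpha - 1))%:E) < +oo.

Let hn0 := ri_seq_norm hE0.
Let hn1 := ri_seq_norm hE1.
Let a := slow alpha : nat -> R.
Let d := slow beta : nat -> R.
Let ra : reg 0 a. Proof. exact: reg_slow. Qed.
Let rd : reg 0 d. Proof. exact: reg_slow. Qed.
Let fa : nu E0 (fun n => (a n)%:E) < +oo. Proof. exact: nu_slow_lty. Qed.
Let p0_gt0 : (0 < p0)%R. Proof. exact: lt_trans p0_gt1. Qed.
Let p1_gt0 : (0 < p1)%R. Proof. exact: lt_trans p01. Qed.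
Let k0_lt1 : (p0^-1 < 1)%R. Proof. by rewrite invf_lt1. Qed.
Let k1_gt0 : (0 < p1^-1)%R. Proof. by rewrite invr_gt0. Qed.
Let k10 : (p1^-1 < p0^-1)%R. Proof. by rewrite ltf_pV2 // posrE. Qed.
Let rs := wrho (nu E0) (nu E1) a d p0^-1 p1^-1.
Let rs0 n : (0 < rs n)%R.
Proof. exact: reg_gt0 n (reg_wrho hn0 hn1 p0^-1 p1^-1 ra rd fa). Qed.
Let I n G := Iop (nu E0) a p0^-1 n G.
Let J n G := Jop (nu E1) d p1^-1 n G.
Let S f := avg (Fs f).
Let A0 := A_space p0 alpha E0.
Let B1 := B_space p1 beta E1.

Let S0 f : nonneg (S f). Proof. exact/avg_ge0/Fs_ge0. Qed.
Let Snd f : {homo S f : i j / (i <= j)%N >-> i <= j}.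
Proof. by apply: avg_nd; [exact: Fs_nd|exact: Fs_ge0]. Qed.
Let I0 n f : 0 <= I n (S f). Proof. exact: Iop_ge0. Qed.
Let J0 n f : 0 <= J n (S f). Proof. exact: Jop_ge0. Qed.

Lemma A_norm_ge0 f : 0 <= fnorm A0 f.
Proof. by apply: (ri_ge0 hE0); exact: Mplus_rearr. Qed.

Lemma B_norm_ge0 f : 0 <= fnorm B1 f.
Proof. by apply: (ri_ge0 hE1); exact: Mplus_rearr. Qed.

Lemma K_functional_ge0 (t : R) f : (0 <= t)%R -> 0 <= K_functional A0 B1 t f.
Proof.
move=> t0; apply: le_ereal_inf_tmp => _ [f0 [f1 [_ _ _ ->]]].
by rewrite adde_ge0 ?A_norm_ge0 // mule_ge0 ?B_norm_ge0 // lee_fin.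
Qed.

(** Each decomposition costs at most [M] times as much at t' as at t; this merges the monotonicity
    of K(t) and of K(t) / t. *)
Lemma K_functional_quasi (t t' M : R) f : (0 <= t)%R -> (1 <= M)%R -> (t' <= M * t)%R ->
  K_functional A0 B1 t' f <= M%:E * K_functional A0 B1 t f.
Proof.
move=> t0 M1 tt'; have M0 : (0 < M)%R by exact: lt_le_trans M1.
rewrite -lee_pdivrMl //; apply: le_ereal_inf_tmp => _ [f0 [f1 [h0 h1 h2 ->]]].
rewrite lee_pdivrMl //.
apply: (@le_trans _ _ (fnorm A0 f0 + t'%:E * fnorm B1 f1)).
  by apply: ereal_inf_lbound; exists f0, f1.
rewrite ge0_muleDr ?A_norm_ge0 ?mule_ge0 ?B_norm_ge0 ?lee_fin //; apply: leeD.
  by rewrite -[leLHS]mul1e; apply: lee_wpM2r; rewrite ?A_norm_ge0.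
by rewrite muleA -EFinM; apply: lee_wpM2r; rewrite ?B_norm_ge0.
Qed.

(** A decomposition produces four terms. [I] of [f0] and [J] of [f1] are controlled by the norms in
    their own spaces; the crossed terms are [Iop_le_normB] for [f1] and [Jop_le_Iop0] for [f0]. *)
Lemma K_functional_lower : exists2 C : R, (0 < C)%R & forall f n,
  measurable_fun U f ->
  I n (S f) + (rs n)%:E * J n (S f) <= C%:E * K_functional A0 B1 (rs n) f.
Proof.
have [CA CA0 HA] := A_norm_bridge alpha hE0 p0_gt0.
have [CB CB0 HB] := B_norm_lower beta hE1 p1_gt0.
have [C1 C10 H1] := Iop_le_normB hn0 hn1 ra rd fa k10.
have [C2 C20 H2] := Jop_le_Iop0 hn0 hn1 ra rd fa k10.
have e0 : (0 < expR 1 :> R)%R := expR_gt0 _.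
pose KA := (CA + C2 * CA)%R; pose KB := (C1 * CB + CB)%R.
have KA0 : (0 < KA)%R by rewrite addr_gt0 // mulr_gt0.
have KB0 : (0 < KB)%R by rewrite addr_gt0 // mulr_gt0.
exists (expR 1 * (KA + KB))%R => [|f n mf]; first by rewrite mulr_gt0 // addr_gt0.
have C0 : (0 < expR 1 * (KA + KB))%R by rewrite mulr_gt0 // addr_gt0.
rewrite -lee_pdivrMl //; apply: le_ereal_inf_tmp => _ [f0 [f1 [[m0 _] [m1 _] ae ->]]].
rewrite lee_pdivrMl // (EFinM (expR 1)) -muleA.
have SS0 : nonneg (S f0 \+ S f1) by move=> k; apply: adde_ge0; exact: S0.
have SS k : S f k <= (expR 1)%:E * (S f0 \+ S f1) k by exact: avg_Fs_add.
have eSS0 : nonneg (fun k => (expR 1)%:E * (S f0 \+ S f1) k).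
  by move=> k; rewrite mule_ge0 // lee_fin ltW.
have hI : I n (S f) <= (expR 1)%:E * (I n (S f0) + I n (S f1)).
  apply: le_trans (le_Iop hn0 _ ra n (S0 f) eSS0 SS) _.
  rewrite (IopZ hn0) ?(ltW e0) //; apply: lee_wpmul2l; first by rewrite lee_fin ltW.
  exact: Iop_add.
have hJ : J n (S f) <= (expR 1)%:E * (J n (S f0) + J n (S f1)).
  apply: le_trans (le_Jop hn1 _ rd n (S0 f) eSS0 SS) _.
  apply: le_trans (JopZ_le hn1 _ rd n (ltW e0) SS0) _.
  by apply: lee_wpmul2l; [rewrite lee_fin ltW|exact: Jop_add].
have nA := A_norm_ge0 f0; have nB := B_norm_ge0 f1.
have rE : 0 <= (rs n)%:E by rewrite lee_fin ltW.
have x0 : I n (S f0) <= CA%:E * fnorm A0 f0.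
  by apply: le_trans (Iop_ni hn0 _ ra (leq0n n) (S0 f0)) _; case: (HA f0).
have x1 : I n (S f1) <= (C1 * CB)%:E * ((rs n)%:E * fnorm B1 f1).
  apply: le_trans (H1 _ n (S0 f1) (@Snd f1)) _.
  have -> : (C1 * CB)%:E * ((rs n)%:E * fnorm B1 f1) = (C1 * rs n)%:E * (CB%:E * fnorm B1 f1).
    by rewrite !muleA -!EFinM; congr (_%:E * _); ring.
  by apply: lee_wpmul2l; [rewrite lee_fin mulr_ge0 // ltW|exact: HB].
have y0 : (rs n)%:E * J n (S f0) <= (C2 * CA)%:E * fnorm A0 f0.
  apply: le_trans (H2 _ n (S0 f0)) _; rewrite EFinM -muleA.
  by apply: lee_wpmul2l; [rewrite lee_fin ltW|case: (HA f0)].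
have y1 : (rs n)%:E * J n (S f1) <= CB%:E * ((rs n)%:E * fnorm B1 f1).
  rewrite muleCA; apply: lee_wpmul2l => //.
  exact: le_trans (Jop_le_normB hn1 _ rd n (S0 f1)) (HB f1).
set XA := fnorm A0 f0 in nA x0 y0 *.
have nB' : 0 <= (rs n)%:E * fnorm B1 f1 by rewrite mule_ge0.
set XB := (rs n)%:E * fnorm B1 f1 in x1 y1 nB' *.
apply: (@le_trans _ _ ((expR 1)%:E * ((I n (S f0) + I n (S f1)) + ((rs n)%:E * J n (S f0) + (rs n)%:E * J n (S f1))))).
  rewrite ge0_muleDr ?adde_ge0 ?mule_ge0 //; apply: leeD => //.
  by rewrite -ge0_muleDr // muleCA; apply: lee_wpmul2l.
apply: lee_wpmul2l; first by rewrite lee_fin ltW.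
apply: (@le_trans _ _ (KA%:E * XA + KB%:E * XB)).
  rewrite /KA /KB !EFinD !ge0_muleDl ?lee_fin ?mulr_ge0 ?(ltW CA0) ?(ltW CB0) ?(ltW C10) ?(ltW C20) //.
  by rewrite addeACA; apply: leeD; apply: leeD.
rewrite ge0_muleDr //; apply: leeD; apply: lee_wpM2r => //.
  by rewrite lerDl ltW.
by rewrite lerDr ltW.
Qed.

(** The truncated part leaves the term [wP n * w1 n * Fs f n] of [normB_lower_part]. Multiplied by
    [rs n] it becomes [wA n * w0 n * Fs f n], which [le_Iop_point] bounds by [I n (S f)]. *)
Lemma K_functional_upper : exists2 C : R, (0 < C)%R & forall f n,
  measurable_fun U f ->
  K_functional A0 B1 (rs n) f <= C%:E * (I n (S f) + (rs n)%:E * J n (S f)).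
Proof.
have [CA CA0 HA] := A_norm_bridge alpha hE0 p0_gt0.
have [CB CB0 HB] := B_norm_upper beta hE1 p1_gt0.
have [C1 C10 H1] := Iop0_upper_part hn0 ra fa k0_lt1.
have [C2 C20 H2] := normB_lower_part hn1 rd k1_gt0.
have [C3 C30 H3] := le_Iop_point hn0 p0^-1 ra fa.
pose C := (CA * C1 + CB + CB * C2 * C3)%R.
have C0 : (0 < C)%R by rewrite !addr_gt0 ?mulr_gt0.
exists C => // f n mf.
have rE : 0 <= (rs n)%:E by rewrite lee_fin ltW.
set X := I n (S f); set Y := J n (S f).
have X0 : 0 <= X := I0 n f; have Y0 : 0 <= Y := J0 n f.
have Z0 : 0 <= X + (rs n)%:E * Y by rewrite adde_ge0 // mule_ge0.
(* Finiteness is needed below to know that [f0] and [f1] belong to the two spaces, hence that the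
   decomposition is admissible. *)
have [Zoo|Zfin] := eqVneq (X + (rs n)%:E * Y) +oo.
  by rewrite Zoo gt0_muley ?leey // lte_fin.
have Zlt : X + (rs n)%:E * Y < +oo by rewrite ltey.
have Xlt : X < +oo by apply: le_lt_trans Zlt; rewrite leeDl // mule_ge0.
have Ylt : Y < +oo.
  rewrite ltey; apply: contra_ltN Zlt => /eqP ->.
  by rewrite gt0_muley ?lte_fin // addey // -ltNye (lt_le_trans _ X0).
have [f0 [f1 [m0 m1 fE [h1 h2 h3 h4]]]] := truncation n mf.
have nA : fnorm A0 f0 <= (CA * C1)%:E * X.
  apply: le_trans (HA f0).1 _; rewrite EFinM -muleA.
  apply: lee_wpmul2l; first by rewrite lee_fin ltW.
  by apply: (H1 (Fs f)) => //; exact: Fs_ge0.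
have FS : Fs f n <= S f n by exact: le_avg (Fs_ge0 f).
have Dpt : (rs n)%:E * ((wP (nu E1) n * w1 d p1^-1 n)%:E * Fs f n) <= C3%:E * X.
  apply: le_trans (H3 _ n (S0 f)).
  have P0 : wP (nu E1) n != 0%R by exact: lt0r_neq0 (reg_gt0 _ (reg_wP hn1)).
  have w10 : w1 d p1^-1 n != 0%R by exact: lt0r_neq0 (reg_gt0 _ (reg_w1 p1^-1 rd)).
  have -> : (wA (nu E0) a n * w0 p0^-1 n = rs n * (wP (nu E1) n * w1 d p1^-1 n))%R.
    by rewrite /rs /wrho; field; rewrite P0 w10.
  rewrite (EFinM (rs n)) -muleA; apply: lee_wpmul2l => //; apply: lee_wpmul2l => //.
  by rewrite lee_fin mulr_ge0 // ?(reg_ge0 _ (reg_wP hn1)) // (reg_ge0 _ (reg_w1 p1^-1 rd)).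
have nB : (rs n)%:E * fnorm B1 f1 <= CB%:E * ((rs n)%:E * Y) + (CB * C2 * C3)%:E * X.
  apply: (@le_trans _ _ ((rs n)%:E * (CB%:E * (Y + C2%:E * ((wP (nu E1) n * w1 d p1^-1 n)%:E * Fs f n))))).
    apply: lee_wpmul2l => //; apply: le_trans (HB f1) _.
    apply: lee_wpmul2l; first by rewrite lee_fin ltW.
    apply: (H2 (Fs f)) => //; exact: Fs_ge0.
  set W := (wP _ n * _)%:E * Fs f n in Dpt *.
  have W0 : 0 <= W.
    rewrite mule_ge0 ?Fs_ge0 // lee_fin.
    by rewrite mulr_ge0 // ?(reg_ge0 _ (reg_wP hn1)) // (reg_ge0 _ (reg_w1 p1^-1 rd)).
  have cW0 : 0 <= C2%:E * W by rewrite mule_ge0 // lee_fin ltW.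
  have CBE : 0 <= CB%:E by rewrite lee_fin ltW.
  have C2E : 0 <= C2%:E by rewrite lee_fin ltW.
  rewrite muleCA (ge0_muleDr _ Y0 cW0) ge0_muleDr; [|exact: mule_ge0..].
  apply: leeD; first exact: lexx.
  rewrite -mulrA (EFinM CB) -muleA; apply: lee_wpmul2l => //.
  by rewrite muleCA (EFinM C2) -muleA; apply: lee_wpmul2l.
apply: (@le_trans _ _ (fnorm A0 f0 + (rs n)%:E * fnorm B1 f1)).
  apply: ereal_inf_lbound; exists f0, f1; split=> //.
  - by split=> //; apply: le_lt_trans nA _; rewrite lte_mul_pinfty // lee_fin mulr_ge0 // ltW.
  - split=> //; rewrite -[X in X < _]/(fnorm B1 f1).
    have -> : fnorm B1 f1 = ((rs n)^-1)%:E * ((rs n)%:E * fnorm B1 f1).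
      by rewrite muleA -EFinM mulVf ?mul1e // lt0r_neq0.
    rewrite lte_mul_pinfty ?lee_fin ?invr_ge0 ?(ltW (rs0 n)) //.
    apply: le_lt_trans nB _; apply: lte_add_pinfty; rewrite lte_mul_pinfty ?lee_fin ?mulr_ge0 ?(ltW CB0) ?(ltW C20) ?(ltW C30) //.
    by rewrite lte_mul_pinfty.
  - by apply: aeW => x _; exact: fE.
apply: le_trans (leeD nA nB) _.
rewrite addeCA -ge0_muleDl ?lee_fin ?mulr_ge0 ?(ltW CA0) ?(ltW CB0) ?(ltW C10) ?(ltW C20) ?(ltW C30) //.
have YE : 0 <= (rs n)%:E * Y by rewrite mule_ge0.
have z1 : (0 < CA * C1)%R by rewrite mulr_gt0.
have z2 : (0 < CB * C2 * C3)%R by rewrite !mulr_gt0.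
rewrite -EFinD addeC (ge0_muleDr _ X0 YE); apply: leeD; apply: lee_wpM2r => //; rewrite /C; lra.
Qed.

End K_functional.

(** * The interpolation norm *)

Section dominated.
Local Open Scope ereal_scope.
Variable R : realType.
Implicit Types X Y Z : (R -> R) -> \bar R.

Definition dominated X Y := exists2 C : R, (0 < C)%R & forall f,
  measurable_fun (`]0%R, 1%R[%classic : set R) f -> X f <= C%:E * Y f.

Lemma dominated_trans Y X Z : dominated X Y -> dominated Y Z -> dominated X Z.
Proof.
move=> [C C0 H] [D D0 K]; exists (C * D)%R => [|f mf]; first by rewrite mulr_gt0.
apply: le_trans (H f mf) _; rewrite EFinM -muleA.
by apply: lee_wpmul2l; [rewrite lee_fin ltW|exact: K].
Qed.

Lemma dominated_add X Y Z : (forall f, 0 <= Z f) ->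
  dominated X Z -> dominated Y Z -> dominated (fun f => X f + Y f) Z.
Proof.
move=> Z0 [C C0 H] [D D0 K]; exists (C + D)%R => [|f mf]; first by rewrite addr_gt0.
by rewrite EFinD ge0_muleDl ?lee_fin ?(ltW C0) ?(ltW D0) //; apply: leeD; [exact: H|exact: K].
Qed.

End dominated.

Section interpolation_norm.
Local Open Scope ereal_scope.
Variable R : realType.
Local Notation U := (`]0%R, 1%R[%classic : set R).
Implicit Types (f : R -> R).
Variables (E E0 E1 : function_norm R) (b : R -> R) (p0 p1 alpha beta theta : R).
Hypotheses (hE : ri_space E) (hE0 : ri_space E0) (hE1 : ri_space E1) (hb : SV b).
Hypotheses (p0_gt1 : (1 < p0)%R) (p01 : (p0 < p1)%R) (halpha : (alpha < 1)%R).
Hypothesis halphaE0 : E0 (fun u => ((1 + u) `^ (alpha - 1))%:E) < +oo.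
Hypothesis theta0 : (0 <= theta)%R.

Let hn := ri_seq_norm hE.
Let hn0 := ri_seq_norm hE0.
Let hn1 := ri_seq_norm hE1.
Let a := slow alpha : nat -> R.
Let d := slow beta : nat -> R.
Let ra : reg 0 a. Proof. exact: reg_slow. Qed.
Let rd : reg 0 d. Proof. exact: reg_slow. Qed.
Let rs := wrho (nu E0) (nu E1) a d p0^-1 p1^-1.
Let rrs : reg (p0^-1 - p1^-1) rs. Proof. exact: reg_rs. Qed.
Let v := Kweight E0 E1 p0 p1 alpha beta b theta.
Let A0 := A_space p0 alpha E0.
Let B1 := B_space p1 beta E1.
Let K t f := K_functional A0 B1 t f.

(** The integrand of the interpolation norm in the variable x = - ln t, extended to all real x as
    required by [reparam]. *)
Let kl f (x : R) := (expR (theta * x) * logb b x)%:E * K (expR (- x)) f.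

Let kl_ge0 f x : 0 <= kl f x.
Proof.
rewrite mule_ge0 ?K_functional_ge0 ?expR_ge0 // lee_fin mulr_ge0 ?expR_ge0 //.
exact/ltW/logb_gt0.
Qed.

(** In the exponent, theta comes from the power, one unit from [b] and one from the K-functional. *)
Let kl_quasi : exists2 D : R, (0 < D)%R & forall f x y,
  kl f x <= (D * expR ((theta + 2) * `|x - y|))%:E * kl f y.
Proof.
have [D D0 H] := logb_slow hb (@ltr01 R); exists D => // f x y.
set z := `|x - y|%R.
have z0 : (0 <= z)%R by exact: normr_ge0.
have xy : (x - y <= z)%R by exact: ler_norm.
have yx : (y - x <= z)%R by rewrite /z distrC ler_norm.
have lx := ltW (logb_gt0 hb x); have ly := ltW (logb_gt0 hb y).
have -> : (D * expR ((theta + 2) * z))%:E * kl f y =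
  (expR (theta * y + theta * z) * (D * expR (1 * z) * logb b y))%:E * ((expR z)%:E * K (expR (- y)) f).
  rewrite /kl !muleA -!EFinM; congr (_%:E * _).
  have -> : ((theta + 2) * z = theta * z + z + z)%R by ring.
  by rewrite !expRD mul1r; ring.
apply: lee_pmul.
- by rewrite lee_fin mulr_ge0 ?expR_ge0.
- by rewrite K_functional_ge0 ?expR_ge0.
- rewrite lee_fin; apply: ler_pM; rewrite ?expR_ge0 //; last exact: H.
  by rewrite ler_expR -mulrDr ler_wpM2l //; lra.
- apply: K_functional_quasi => //; rewrite ?expR_ge0 //.
    by rewrite -expR0 ler_expR.
  by rewrite -expRD ler_expR; lra.
Qed.

(** On a cell, - ln t is within 1 of the index, so [kl] may be sampled at the integers; [reparam]
    then moves the samples to [- ln (rs n)]. *)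
Lemma interp_bridge : exists2 C : R, (0 < C)%R & forall f,
  interp_norm A0 B1 theta b E f <= C%:E * nu E (wt v (fun n => K (rs n) f)) /\
  nu E (wt v (fun n => K (rs n) f)) <= C%:E * interp_norm A0 B1 theta b E f.
Proof.
have [D D0 H] := kl_quasi.
have dl0 : (0 < p0^-1 - p1^-1)%R.
  by rewrite subr_gt0 ltf_pV2 ?posrE // (lt_trans ltr01) // (lt_trans p0_gt1).
have c0 : (0 <= theta + 2)%R by rewrite addr_ge0.
have [C1 C10 H1] := reparam hn dl0 rrs c0 D0.
pose M := (D * expR (theta + 2))%R; have M0 : (0 < M)%R by rewrite mulr_gt0 ?expR_gt0.
exists (M * C1)%R => [|f]; first by rewrite mulr_gt0.
have [h1 h2] := H1 (kl f) (kl_ge0 f) (H f).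
have -> : wt v (fun n => K (rs n) f) = (fun n => kl f (- ln (rs n)))%R.
  apply/funext => n; have r0 := reg_gt0 n rrs.
  rewrite /wt /v /Kweight /kl opprK lnK //; congr (_%:E * _).
  by rewrite -/a -/d -/rs mulrN expRN /powR gt_eqF.
have klt t : (0 < t < 1)%R -> (t `^ (- theta) * b t)%:E * K t f = kl f (- ln t)%R.
  move=> /andP[t0 t1]; rewrite /kl opprK lnK //; congr ((_ * _)%:E * _).
    by rewrite /powR gt_eqF // mulrN mulNr.
  by rewrite /logb opprK lnK // /sv_ext t1.
have near t : (0 < t < 1)%R -> (`|- ln t - (tindex t)%:R| <= 1)%R.
  move=> t01; have /andP[t0 t1] := t01.
  have l0 : (0 <= - ln t)%R by rewrite oppr_ge0 ln_le0 // ltW.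
  have /andP[] := truncn_itv l0; rewrite -/(tindex t) -natr1 => x y.
  by rewrite ler_norml; apply/andP; split; lra.
have cmp x y : (`|x - y| <= 1)%R -> kl f x <= M%:E * kl f y.
  move=> xy; apply: le_trans (H f x y) _; apply: lee_wpM2r; last exact: kl_ge0.
  by rewrite ler_pM2l // ler_expR ler_piMr.
split.
- apply: (@le_trans _ _ (M%:E * nu E (fun n => kl f n%:R))).
    apply: tnorm_upper => // t; rewrite /= in_itv /= => t01.
    rewrite -/(K t f) klt // gee0_abs //; exact/cmp/near.
  by rewrite (EFinM M C1) -muleA; apply: lee_wpmul2l; first by rewrite lee_fin ltW.
- apply: le_trans h1 _; rewrite mulrC (EFinM C1 M) -muleA.
  apply: lee_wpmul2l; first by rewrite lee_fin ltW.
  apply: tnorm_lower => // t t01 _; split; first by rewrite /= in_itv.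
  rewrite -/(K t f) klt // gee0_abs //; apply: cmp; rewrite distrC; exact: near.
Qed.

Let fa : nu E0 (fun n => (a n)%:E) < +oo. Proof. exact: nu_slow_lty. Qed.
Let p0_gt0 : (0 < p0)%R. Proof. exact: lt_trans p0_gt1. Qed.
Let rs0 n : (0 < rs n)%R. Proof. exact: reg_gt0 n rrs. Qed.
Let v0 n : (0 < v n)%R. Proof. exact: Kweight_gt0. Qed.
Let S f := avg (Fs f).
Let S0 f : nonneg (S f). Proof. exact/avg_ge0/Fs_ge0. Qed.
Let I n f := Iop (nu E0) a p0^-1 n (S f).
Let J n f := Jop (nu E1) d p1^-1 n (S f).
Let I0 n f : 0 <= I n f. Proof. exact: Iop_ge0. Qed.
Let J0 n f : 0 <= J n f. Proof. exact: Jop_ge0. Qed.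
Let N f := interp_norm A0 B1 theta b E f.
Let wI f := wt v (I^~ f).
Let wJ f := wt (fun n => v n * rs n)%R (J^~ f).
Let wI0 f : nonneg (wI f). Proof. by move=> n; rewrite mule_ge0 // lee_fin ltW. Qed.
Let wJ0 f : nonneg (wJ f).
Proof. by move=> n; rewrite mule_ge0 // lee_fin mulr_ge0 // ltW. Qed.
Let vK0 f : nonneg (wt v (fun n => K (rs n) f)).
Proof. by move=> n; rewrite mule_ge0 ?K_functional_ge0 ?lee_fin // ltW. Qed.

Let interp_upper : dominated N (fun f => nu E (wI f) + nu E (wJ f)).
Proof.
have [C1 C10 H1] := interp_bridge.
have [C2 C20 H2] := K_functional_upper beta hE0 hE1 p0_gt1 p01 halpha halphaE0.
exists (C1 * C2)%R => [|f mf]; first by rewrite mulr_gt0.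
apply: le_trans (H1 f).1 _; rewrite EFinM -muleA.
apply: lee_wpmul2l; first by rewrite lee_fin ltW.
apply: (@le_trans _ _ (C2%:E * nu E (fun n => wI f n + wJ f n))).
  apply: (sn_le hn) => [|//||n]; first exact: ltW.
    by move=> n; apply: adde_ge0; [exact: wI0|exact: wJ0].
  apply: (@le_trans _ _ ((v n)%:E * (C2%:E * (I n f + (rs n)%:E * J n f)))).
    by apply: lee_wpmul2l; [rewrite lee_fin ltW|exact: H2].
  rewrite muleCA; apply: lee_wpmul2l; first by rewrite lee_fin ltW.
  by rewrite ge0_muleDr ?mule_ge0 ?lee_fin ?(ltW (rs0 n)) // /wI /wJ /wt muleA -EFinM.
by apply: lee_wpmul2l; [rewrite lee_fin ltW|exact: nu_add].
Qed.

Let interp_lower w : (forall f, nonneg (w f)) ->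
  (forall f n, w f n <= (v n)%:E * (I n f + (rs n)%:E * J n f)) ->
  dominated (fun f => nu E (w f)) N.
Proof.
move=> w0 h; have [C1 C10 H1] := interp_bridge.
have [C2 C20 H2] := K_functional_lower beta hE0 hE1 p0_gt1 p01 halpha halphaE0.
exists (C2 * C1)%R => [|f mf]; first by rewrite mulr_gt0.
have vE n : 0 <= (v n)%:E by rewrite lee_fin ltW.
apply: (@le_trans _ _ (C2%:E * nu E (wt v (fun n => K (rs n) f)))).
  apply: (sn_le hn) => [|//|//|n]; first exact: ltW.
  apply: le_trans (h f n) _; rewrite /wt muleCA; apply: lee_wpmul2l => //.
  exact: H2.
rewrite (EFinM C2 C1) -muleA; apply: lee_wpmul2l; first by rewrite lee_fin ltW.
exact: (H1 f).2.
Qed.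

Let vE n : 0 <= (v n)%:E. Proof. by rewrite lee_fin ltW. Qed.

Let wI_le_interp : dominated (fun f => nu E (wI f)) N.
Proof.
apply: interp_lower => // f n; apply: lee_wpmul2l => //.
by rewrite leeDl // mule_ge0 // lee_fin ltW.
Qed.

Let wJ_le_interp : dominated (fun f => nu E (wJ f)) N.
Proof.
apply: interp_lower => // f n; rewrite /wJ /wt EFinM -muleA.
by apply: lee_wpmul2l => //; rewrite leeDr.
Qed.

Let N_ge0 f : 0 <= N f.
Proof. by apply: (ri_ge0 hE); exact: Mplus_rearr. Qed.

(** The interpolation space consists of elements of A. The single entry 0 of [wI f] already contains
    the whole discrete norm of A. *)
Let interp_lty_A f : measurable_fun U f -> N f < +oo -> fnorm A0 f < +oo.
Proof.
move=> mf Nf; have [C C0 /(_ f mf) H] := wI_le_interp.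
have [CA CA0 /(_ f)[HA _]] := A_norm_bridge alpha hE0 p0_gt0.
apply: le_lt_trans HA _; rewrite lte_mul_pinfty ?lee_fin ?(ltW CA0) // -/a -/(S f) -/(I 0 f).
have wlt : nu E (wI f) < +oo by apply: le_lt_trans H _; rewrite lte_mul_pinfty ?lee_fin ?(ltW C0).
have : wI f 0%N * nu E (fun n => if n == 0%N then 1 else 0) <= nu E (wI f).
  rewrite -(sn_scalee hn (wI0 f 0%N)); last by move=> n; case: (n == 0%N).
  by apply: (sn_mono hn) => [||] [|n] /=; rewrite ?mule1 ?mule0 ?lexx //; exact: (wI0 f).
move=> /le_lt_trans/(_ wlt); have dl := sn_delta_gt0 hn.
rewrite !ltey; apply: contraNN => /eqP; rewrite /wI /wt => ->.
by rewrite gt0_muley ?lte_fin // gt0_mulye.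
Qed.

Let same_space_interp (M : (R -> R) -> \bar R) : (forall f, 0 <= M f) ->
  dominated N M -> dominated M N ->
  same_space (interp_space A0 B1 theta b E) (fspace_of M).
Proof.
move=> M0 [C1 C10 H1] [C2 C20 H2]; split.
  apply/seteqP; split=> f /=.
    move=> [[mf _] Nf]; split=> //; apply: le_lt_trans (H2 f mf) _.
    by rewrite lte_mul_pinfty // lee_fin ltW.
  move=> [mf Mf]; have Nf : N f < +oo.
    by apply: le_lt_trans (H1 f mf) _; rewrite lte_mul_pinfty // lee_fin ltW.
  by split=> //; split=> //; exact: interp_lty_A.
exists (C1 + C2)%R => [|f [[mf _] _]]; first by rewrite addr_gt0.
split.
  apply: le_trans (H1 f mf) _; apply: lee_wpM2r; [by rewrite lerDl ltW|exact: M0].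
apply: le_trans (H2 f mf) _; apply: lee_wpM2r; [by rewrite lerDr ltW|exact: N_ge0].
Qed.

Let F f := Fs f.
Let F0 f : nonneg (F f). Proof. exact: Fs_ge0. Qed.
Let Fnd f : {homo F f : i j / (i <= j)%N >-> i <= j}. Proof. exact: Fs_nd. Qed.
Let lam := Lweight E0 E1 p0 p1 alpha beta b theta.
Let rl : reg ((1 - theta) / p0 + theta / p1) lam.
Proof. exact: reg_Lweight. Qed.
Let lam_ge0 n : (0 <= lam n)%R. Proof. exact: reg_ge0 n rl. Qed.
Let wlam0 G : nonneg G -> nonneg (wt lam G). Proof. exact: wt_ge0 rl. Qed.
Let rv : reg (- ((p0^-1 - p1^-1) * theta)) v. Proof. exact: reg_Kweight. Qed.
Let rvr : reg ((p0^-1 - p1^-1) * (1 - theta)) (fun n => v n * rs n)%R.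
Proof. exact: reg_Kweight_rs. Qed.
Let k10 : (p1^-1 < p0^-1)%R.
Proof. by rewrite ltf_pV2 // posrE // (lt_trans p0_gt0). Qed.
Let k0_lt1 : (p0^-1 < 1)%R. Proof. by rewrite invf_lt1. Qed.

(** Only for theta > 0 does the weight [v] have a nonzero index, the source of the geometric gain;
    in [wJ_le_lam] this role falls to theta < 1. *)
Let wI_le_lam : (0 < theta)%R ->
  dominated (fun f => nu E (wI f)) (fun f => nu E (wt lam (S f))).
Proof.
move=> t0; have k0 : (- ((p0^-1 - p1^-1) * theta) < 0)%R by rewrite oppr_lt0 mulr_gt0 // subr_gt0.
have [C C0 H] := norm_Iop_le hn0 p0^-1 ra fa hn k0 rv.
by exists C => // f _; exact: H.
Qed.

Let wJ_le_lam : (theta < 1)%R ->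
  dominated (fun f => nu E (wJ f)) (fun f => nu E (wt lam (S f))).
Proof.
move=> t1; have k0 : (0 < (p0^-1 - p1^-1) * (1 - theta))%R by rewrite mulr_gt0 // subr_gt0.
have [C C0 H] := norm_Jop_le hn1 p1^-1 rd hn k0 rvr.
exists C => // f _; apply: le_trans (H _ (S0 f)) _; apply: lee_wpmul2l; first by rewrite lee_fin ltW.
rewrite (_ : (fun n => _) = lam) //; apply/funext => n.
by rewrite /lam LweightE.
Qed.

Let lam_le_wI : dominated (fun f => nu E (wt lam (S f))) (fun f => nu E (wI f)).
Proof.
have [C C0 H] := le_Iop_point hn0 p0^-1 ra fa.
exists C => // f _; apply: (sn_le hn) => [|n|//|n]; first exact: ltW.
  exact: wlam0 (S0 f) n.
rewrite /wI /wt muleCA /lam /Lweight -mulrA EFinM -muleA.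
by apply: lee_wpmul2l => //; exact: H.
Qed.

Let lamS_le_lamF : dominated (fun f => nu E (wt lam (S f))) (fun f => nu E (wt lam (F f))).
Proof.
have k1 : ((1 - theta) / p0 + theta / p1 < 1)%R.
  have h : (0 <= theta * (p0^-1 - p1^-1))%R by rewrite mulr_ge0 // subr_ge0 ltW.
  have -> : ((1 - theta) / p0 + theta / p1 = p0^-1 - theta * (p0^-1 - p1^-1))%R by ring.
  by have := k0_lt1; lra.
have [C C0 H] := norm_avg_le hn k1 rl.
by exists C => // f _; exact: H.
Qed.

Let lamF_le_lamS : dominated (fun f => nu E (wt lam (F f))) (fun f => nu E (wt lam (S f))).
Proof.
exists 1%R => // f _; rewrite mul1e; apply: (sn_mono hn) => n.
- exact: wlam0 (F0 f) n.
- exact: wlam0 (S0 f) n.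
- by apply: lee_wpmul2l; rewrite ?lee_fin //; exact: le_avg (F0 f).
Qed.

Lemma same_space_L p : (0 < theta)%R -> (theta < 1)%R ->
  (p^-1 = (1 - theta) / p0 + theta / p1)%R ->
  same_space (interp_space (A_space p0 alpha E0) (B_space p1 beta E1) theta b E)
    (L_space p (Btheta theta p0 p1 alpha beta E0 E1 b) E).
Proof.
move=> t0 t1 pE; have t01 : (0 <= theta <= 1)%R by rewrite theta0 ltW.
have [pW cW] := cellcmp_Lweight beta hE0 hE1 hb p0_gt0 (ltW p01) halpha halphaE0 t01 pE.
have [C1 C10 H1] := L_norm_upper hE cW pW rl.
have [C2 C20 H2] := L_norm_lower hE cW pW rl.
have h1 : dominated (fnorm (L_space p (Btheta theta p0 p1 alpha beta E0 E1 b) E))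
    (fun f => nu E (wt lam (F f))) by exists C1 => // f _; exact: H1.
have h2 : dominated (fun f => nu E (wt lam (F f)))
    (fnorm (L_space p (Btheta theta p0 p1 alpha beta E0 E1 b) E)) by exists C2 => // f _; exact: H2.
apply: same_space_interp => [f||].
- by apply: (ri_ge0 hE); exact: Mplus_rearr.
- apply: dominated_trans h2; apply: dominated_trans lamS_le_lamF.
  apply: dominated_trans interp_upper _; apply: dominated_add (wI_le_lam t0) (wJ_le_lam t1) => f.
  exact/(sn_ge0 hn)/wlam0.
- apply: dominated_trans h1 _; apply: dominated_trans lamF_le_lamS _.
  exact: dominated_trans lam_le_wI wI_le_interp.
Qed.

Let bs := bseq E0 E1 p0 p1 alpha beta b.
Let bs0 n : (0 < bs n)%R. Proof. exact: bseq_gt0. Qed.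
Let pb : cellpos (fun u => sv_ext b (rho p0 p1 alpha beta E0 E1 u)) bs.
Proof. by apply: cellpos_b_rho => //; exact: ltW. Qed.
Let cb : cellcmp (fun u => sv_ext b (rho p0 p1 alpha beta E0 E1 u)) bs.
Proof. by apply: cellcmp_b_rho => //; exact: ltW. Qed.
Let rb : reg 0 bs. Proof. exact: reg_bseq. Qed.

Let IF f := wt bs (fun n => Iop (nu E0) a p0^-1 n.+1 (F f)).
Let IF0 f : nonneg (IF f).
Proof. by move=> n; rewrite mule_ge0 ?lee_fin ?(ltW (bs0 n)) //; exact: Iop_ge0. Qed.

(** The term [wJ] is still dominated by [lam S], hence by [wI], so only [wI] remains. With no outer
    decay, f** is replaced by f* inside the operator, by [Iop_avg_le]. *)
Lemma same_space_LRL : theta = 0%R ->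
  same_space (interp_space (A_space p0 alpha E0) (B_space p1 beta E1) theta b E)
    (LRL_space p0 (fun u => sv_ext b (rho p0 p1 alpha beta E0 E1 u)) E
       (fun u => ell u `^ (alpha - 1))%R E0 (fun=> 1%R) (Lq 1%E)).
Proof.
move=> t0; have vb : v = bs by apply/funext => n; rewrite /v /Kweight t0 powRr0 invr1 mul1r.
have [C1 C10 H1] := LRL_upper alpha hE hE0 p0_gt0 cb pb.
have [C2 C20 H2] := LRL_lower alpha hE hE0 p0_gt0 cb pb.
set M := fnorm _ in H1; rewrite -/M in H2.
have h1 : dominated M (fun f => nu E (IF f)) by exists C1.
have h2 : dominated (fun f => nu E (IF f)) M by exists C2 => // f _; exact: H2.
apply: same_space_interp => [f||].
- by apply: (ri_ge0 hE); exact: Mplus_rearr.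
- apply: dominated_trans h2; apply: (@dominated_trans _ (fun f => nu E (wI f))).
    apply: dominated_trans interp_upper _; apply: dominated_add => [f||].
    + exact: (sn_ge0 hn).
    + by exists 1%R => // f _; rewrite mul1e.
    + by apply: dominated_trans (wJ_le_lam _) lam_le_wI; rewrite t0.
  have [C C0 H] := Iop_avg_le hn0 ra k0_lt1.
  exists C => // f _; apply: (sn_le hn) => [|//|//|n]; first exact: ltW.
  rewrite /wI /IF /wt muleCA vb; apply: lee_wpmul2l; first by rewrite lee_fin ltW.
  by apply: H; [exact: F0|exact: Fnd].
- apply: dominated_trans h1 _; apply: dominated_trans _ wI_le_interp.
  exists 1%R => // f _; rewrite mul1e; apply: (sn_mono hn) => // n.
  rewrite /wI /IF vb; apply: lee_wpmul2l; first by rewrite lee_fin ltW.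
  apply: le_trans (Iop_ni hn0 p0^-1 ra (leqnSn n) (F0 f)) _.
  by apply: (le_Iop hn0) => // k; exact: le_avg (F0 f).
Qed.

Let JF j f := wt bs (fun n => Jop (nu E1) d p1^-1 (n + j)%N (F f)).
Let JF0 j f : nonneg (JF j f).
Proof. by move=> n; rewrite mule_ge0 ?lee_fin ?(ltW (bs0 n)) //; exact: Jop_ge0. Qed.

Let JF_shift : dominated (fun f => nu E (JF 2 f)) (fun f => nu E (JF 0 f)).
Proof.
have [C C0 H] := reg_step rb; exists (C * C)%R => [|f _]; first by rewrite mulr_gt0.
apply: (@le_trans _ _ ((C * C)%:E * nu E (fun n => JF 0 f (n + 2)%N))).
  apply: (sn_le hn) => [|//|n|n]; first by rewrite mulr_ge0 // ltW.
    exact: JF0.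
  rewrite /JF /wt addn0 muleA -EFinM; apply: lee_wpM2r; last exact: Jop_ge0.
  have [h1 _] := H n; have [h2 _] := H n.+1; apply: le_trans h1 _.
  by rewrite addn2 -mulrA ler_pM2l.
apply: lee_wpmul2l; first by rewrite lee_fin mulr_ge0 // ltW.
exact: (sn_shift hn 2 (JF0 0 f)).
Qed.

(** Here [wJ] remains. Both [wI] and the remainder of [Jop_avg_le] are controlled by [lam S], which
    returns to f* by Hardy's inequality and to [Jop] at [n.+2] by [le_Jop_point]; [JF_shift] then
    restores the index [n]. *)
Lemma same_space_LLR : theta = 1%R ->
  same_space (interp_space (A_space p0 alpha E0) (B_space p1 beta E1) theta b E)
    (LLR_space p1 (fun u => sv_ext b (rho p0 p1 alpha beta E0 E1 u)) E
       (fun=> 1%R) E1 (fun u => ell u `^ (beta - 1))%R (Lq +oo%E)).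
Proof.
move=> t1; have vb n : (v n * rs n = bs n)%R.
  rewrite /v /Kweight t1 powRr1 ?(ltW (rs0 n)) // -/a -/d -/rs -/(bs n).
  by field; exact: lt0r_neq0.
have vbf : (fun n => v n * rs n)%R = bs by apply/funext.
have lamE n : lam n = (bs n * (wP (nu E1) n * w1 d p1^-1 n))%R.
  by rewrite /lam LweightE // -[Kweight _ _ _ _ _ _ _ _ _]/(v n) -/rs vb mulrA.
have [C1 C10 H1] := LLR_upper beta hE hE1 (lt_trans p0_gt0 p01) cb pb.
have [C2 C20 H2] := LLR_lower beta hE hE1 (lt_trans p0_gt0 p01) cb pb.
set M := fnorm _ in H1.
have h1 : dominated M (fun f => nu E (JF 2 f)).
  by exists C1 => // f _; apply: le_trans (H1 f) _; rewrite /JF; under [in leRHS]eq_fun do rewrite addn2.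
have h2 : dominated (fun f => nu E (JF 0 f)) M.
  by exists C2 => // f _; apply: le_trans (H2 f); rewrite /JF; under [in leLHS]eq_fun do rewrite addn0.
have nn : forall f, 0 <= nu E (JF 0 f) by move=> f; exact: (sn_ge0 hn).
have lamJ : dominated (fun f => nu E (wt lam (S f))) (fun f => nu E (JF 0 f)).
  apply: dominated_trans lamS_le_lamF _; apply: dominated_trans JF_shift.
  have [C C0 H] := le_Jop_point hn1 p1^-1 rd.
  exists C => // f _; apply: (sn_le hn) => [|n|//|n]; first exact: ltW.
    exact: wlam0 (F0 f) n.
  rewrite /JF /wt muleCA lamE EFinM -muleA addn2.
  apply: lee_wpmul2l; first by rewrite lee_fin ltW.
  by apply: H; [exact: F0|exact: Fnd].
apply: same_space_interp => [f||].
- by apply: (ri_ge0 hE); exact: Mplus_rearr.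
- apply: dominated_trans h2; apply: dominated_trans interp_upper _.
  apply: dominated_add => //; first by apply: dominated_trans (wI_le_lam _) lamJ; rewrite t1.
  have [C C0 H] := Jop_avg_le hn1 rd k10 k0_lt1.
  apply: (@dominated_trans _ (fun f => nu E (JF 0 f) + nu E (wt lam (S f)))); last first.
    by apply: dominated_add => //; exists 1%R => // f _; rewrite mul1e.
  have lS0 f : nonneg (wt lam (S f)) by exact: wlam0.
  exists C => // f _; apply: (@le_trans _ _ (C%:E * nu E (fun n => JF 0 f n + wt lam (S f) n))).
    apply: (sn_le hn) => [|//||n]; first exact: ltW.
      by move=> n; apply: adde_ge0; [exact: JF0|exact: lS0].
    rewrite /wJ vbf; apply: le_trans (lee_wpmul2l _ (H _ n (F0 f))) _; first by rewrite lee_fin ltW.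
    rewrite muleCA; apply: lee_wpmul2l; first by rewrite lee_fin ltW.
    rewrite ge0_muleDr; last 2 first.
      exact: Jop_ge0.
      apply: mule_ge0; last exact: S0.
      by rewrite lee_fin (reg_ge0 _ (regM (reg_wP hn1) (reg_w1 p1^-1 rd))).
    by rewrite /JF /wt addn0 lamE muleA -EFinM.
  by apply: lee_wpmul2l; [rewrite lee_fin ltW|exact: nu_add].
- apply: dominated_trans h1 _; apply: dominated_trans JF_shift _; apply: dominated_trans wJ_le_interp.
  exists 1%R => // f _; rewrite mul1e; apply: (sn_mono hn) => // n.
  rewrite /wJ /JF /wt addn0 vb; apply: lee_wpmul2l; first by rewrite lee_fin ltW.
  by apply: (le_Jop hn1) => // k; exact: le_avg (F0 f).
Qed.

End interpolation_norm.

Theorem corollary5p17 (R : realType) (E E0 E1 : function_norm R) (b : R -> R)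
    (p0 p1 alpha beta : R)
    (hE : ri_space E) (hE0 : ri_space E0) (hE1 : ri_space E1) (hb : SV b)
    (hp0 : 1 < p0) (hp01 : p0 < p1) (halpha : alpha < 1) (hbeta : beta < 1)
    (halphaE0 : (E0 (fun u => ((1 + u) `^ (alpha - 1))%:E) < +oo)%E) :
  [/\ (forall theta p : R, 0 < theta -> theta < 1 ->
         p^-1 = (1 - theta) / p0 + theta / p1 ->
         same_space
           (interp_space (A_space p0 alpha E0) (B_space p1 beta E1) theta b E)
           (L_space p (Btheta theta p0 p1 alpha beta E0 E1 b) E)),
      same_space
        (interp_space (A_space p0 alpha E0) (B_space p1 beta E1) 0 b E)
        (LRL_space p0 (fun u => sv_ext b (rho p0 p1 alpha beta E0 E1 u)) E
           (fun u => ell u `^ (alpha - 1)) E0 (fun=> 1) (Lq 1%E)) &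
      ((tnorm E `]0%R, 1%R[ (fun t => (b t)%:E) < +oo)%E ->
       same_space
         (interp_space (A_space p0 alpha E0) (B_space p1 beta E1) 1 b E)
         (LLR_space p1 (fun u => sv_ext b (rho p0 p1 alpha beta E0 E1 u)) E
            (fun=> 1) E1 (fun u => ell u `^ (beta - 1)) (Lq +oo%E)))].
Proof.
split.
- by move=> theta p t0 t1 pE; apply: same_space_L => //; exact: ltW.
- exact: same_space_LRL.
- by move=> _; apply: same_space_LLR.
Qed.
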